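(* Let $\delta\in(0,1)$ and let $T$ be a linear operator such that for every $b\in BMO(\mathbb{R}^n)$, every $w\in A_{1}$, every ball $B\subset\mathbb{R}^n$ with center $c_B$, and every $f\in L^\infty_c(\mathbb{R}^n)$, $$\inf_{c_{1}\in\mathbb{R}}\left(\frac1{|B|}\int_{B}\big|[b,T]f(x)-c_{1}-T(f\chi_{(2B)^{c}})(c_{B})\,b(x)\big|^{\delta}dx\right)^{\frac{1}{\delta}}\leq c_{w,T}\left\Vert \frac{f}{w}\right\Vert _{L^{\infty}}\|b\|_{BMO}\operatorname*{ess\,inf}_{z\in B}w(z),$$ where $c_{w,T}$ depends on $w$ only through $[w]_{A_1}$. Suppose moreover that Lerner's grand maximal operator $$\mathcal{M}_{T}f(x)=\sup_{B\ni x}\ \operatorname*{ess\,sup}_{z\in B}\big|T(f\chi_{(2B)^{c}})(z)\big|$$ is bounded on $L^{p}(v)$ for some $p\in(1,\infty)$ and some $v\in A_{p}$. Then there is a constant $c_{v,T}$, independent of $b$ and $f$, such that $$\left\Vert [b,T]f\right\Vert _{L^{p}(v)}\leq c_{v,T}\|b\|_{BMO}\|f\|_{L^{p}(v)}$$ for every $b\in BMO(\mathbb{R}^n)$ and every $f\in L^\infty_c(\mathbb{R}^n)$ (with this same $p$ and $v$).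
   Context: All functions are real-valued. $L^\infty_c(\mathbb{R}^n)$ denotes the bounded measurable functions with compact support. A weight is a non-negative locally integrable function on $\mathbb{R}^n$. For $1<p<\infty$, $w\in A_p$ if $[w]_{A_p}=\sup_Q\left(\frac1{|Q|}\int_Q w\right)\left(\frac1{|Q|}\int_Q w^{-\frac1{p-1}}\right)^{p-1}<\infty$ (supremum over cubes with sides parallel to the axes); $w\in A_1$ if $[w]_{A_1}=\|Mw/w\|_{L^\infty}<\infty$, where $Mf(x)=\sup_{x\in Q}\frac1{|Q|}\int_Q|f|$. $\|f\|_{L^p(v)}=\left(\int|f|^pv\right)^{1/p}$. $\|b\|_{BMO}=\sup_B\frac1{|B|}\int_B|b-b_B|$ with $B$ ranging over balls and $b_B=\frac1{|B|}\int_Bb$; $b\in BMO$ means that $b$ is locally integrable and $\|b\|_{BMO}<\infty$. $2B$ is the ball concentric with $B$ with twice the radius, $(2B)^c=\mathbb{R}^n\setminus 2B$. The supremum defining $\mathcal{M}_T$ is over balls $B$ containing $x$. The commutator is $[b,T]f=b\,Tf-T(bf)$. Conventions on $T$: it is defined on a linear space $\mathcal{D}$ of measurable functions on $\mathbb{R}^n$, with values in measurable functions. The space $\mathcal D$ contains $L^\infty_c(\mathbb{R}^n)$ and all products $bf$ with $b\in BMO$, $f\in L^\infty_c$, and is closed under multiplication by indicator functions of balls. Boundedness of $\mathcal{M}_T$ on $L^p(v)$ means $\|\mathcal{M}_Tf\|_{L^p(v)}\le C\|f\|_{L^p(v)}$ for all $f\in\mathcal{D}\cap L^p(v)$, with $C$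 independent of $f$. The pointwise value $T(f\chi_{(2B)^c})(c_B)$ is a specified value of $T(f\chi_{(2B)^c})$ at the center of $B$, consistent with its values in $B$ in the sense that $|T(f\chi_{(2B)^c})(c_B)|\le\operatorname{ess\,sup}_{z\in B}|T(f\chi_{(2B)^c})(z)|$ (as is automatic when this function is continuous in $B$). *)

(* Defs.v *)
From HB Require Import structures.
From mathcomp Require Import all_boot all_order all_algebra.
From mathcomp Require Import all_classical all_reals all_analysis.

Set Implicit Arguments.
Unset Strict Implicit.
Unset Printing Implicit Defensive.

Import Order.TTheory GRing.Theory Num.Theory.
Import numFieldNormedType.Exports.

Local Open Scope classical_set_scope.
Local Open Scope ring_scope.

(* The library only has Lebesgue measure on the line. Here it is built on
   R^{n+1} (so every dimension >= 1 is covered) as the Caratheodory restriction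
   of the Lebesgue outer measure; "measurable" is therefore Lebesgue
   measurable, and the measure is complete. *)
Section lebesgue_outer_measure.
Context (R : realType) (n : nat).
Local Notation E := 'rV[R]_n.+1.

Definition box (ab : E * E) : set E :=
  [set x | forall i, ab.1 ord0 i < x ord0 i <= ab.2 ord0 i].

Definition box_vol (ab : E * E) : R :=
  \prod_(i < n.+1) Num.max 0 (ab.2 ord0 i - ab.1 ord0 i).

Definition box_cover (A : set E) : set (nat -> E * E) :=
  [set F | A `<=` \bigcup_k box (F k)].

Local Open Scope ereal_scope.

Definition lebesgue_outer (A : set E) : \bar R :=
  ereal_inf [set \sum_(0 <= k <oo) (box_vol (F k))%:E | F in box_cover A].

Let box_vol_ge0 ab : 0 <= (box_vol ab)%:E.
Proof. by rewrite lee_fin; apply: prodr_ge0 => i _; rewrite le_max lexx. Qed.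

Let lebesgue_outer_ge0 A : 0 <= lebesgue_outer A.
Proof.
by apply: le_ereal_inf_tmp => _ [F _ <-]; apply: nneseries_ge0 => *; exact: box_vol_ge0.
Qed.

Let lebesgue_outer0 : lebesgue_outer set0 = 0.
Proof.
apply/eqP; rewrite eq_le lebesgue_outer_ge0 andbT.
apply: ereal_inf_lbound; exists (fun=> (0%R, 0%R)) => //.
apply: eseries0 => k _ _.
by rewrite /box_vol big_ord_recl !mxE subrr maxxx mul0r.
Qed.

Let le_lebesgue_outer : {homo lebesgue_outer : A B / A `<=` B >-> A <= B}.
Proof.
move=> A B AB; apply/ereal_inf_le_tmp => x [F BF <-]; exists F => //.
exact: subset_trans BF.
Qed.

Let lebesgue_outer_sigma_subadditive : sigma_subadditive lebesgue_outer.
Proof.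
move=> A; have [[i ioo]|] := pselect (exists i, lebesgue_outer (A i) = +oo).
  rewrite (eseries_pinfty _ _ ioo) ?leey// => k _.
  by rewrite -ltNye (lt_le_trans _ (lebesgue_outer_ge0 _)).
rewrite -forallNE => Aoo.
suff add2e (e : {posnum R}) : lebesgue_outer (\bigcup_n A n) <=
    \sum_(i <oo) lebesgue_outer (A i) + e%:num%:E.
  by apply/lee_addgt0Pr => _/posnumP[].
rewrite (le_trans _ (epsilon_trick _ _ _))//.
pose P k (F : nat -> E * E) := box_cover (A k) F /\
  \sum_(j <oo) (box_vol (F j))%:E <=
    lebesgue_outer (A k) + (e%:num / (2 ^ k.+1)%:R)%:E.
have [G PG] : {G : nat -> nat -> E * E & forall k, P k (G k)}.
  apply: (@choice _ _ P) => k; rewrite /P /lebesgue_outer.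
  set S := (X in ereal_inf X); move infS : (ereal_inf S) => iS.
  case: iS infS => [r Sr|Soo|Soo].
  - have en1 : (0 < e%:num / (2 ^ k.+1)%:R)%R by [].
    have /(lb_ereal_inf_adherent en1) : ereal_inf S \is a fin_num by rewrite Sr.
    move=> [x [F AF <-] xS].
    by exists F; split => //; rewrite -Sr; exact/ltW.
  - by have := Aoo k; rewrite /lebesgue_outer Soo.
  - suff : lbound S 0 by move/le_ereal_inf_tmp; rewrite Soo.
    by move=> /= _ [F _ <-]; apply: nneseries_ge0 => *; exact: box_vol_ge0.
pose h := (fun ij : nat * nat => (box_vol (uncurry G ij))%:E).
have h_ge0 x : 0 <= h x by exact: box_vol_ge0.
apply: (@le_trans _ _ (\esum_(i in setT) h i)).
  apply: ereal_inf_lbound => /=.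
  have /card_esym/ppcard_eqP[f] := card_nat2.
  exists (uncurry G \o f).
    apply: (@subset_trans _ (\bigcup_k \bigcup_j box (G k j))) => [t [i _]|].
      by move=> /((PG i).1) -[j _ ?]; exists i => //; exists j.
    move=> t [i _ [j _ Bijt]]; exists (f^-1%FUN (i, j)) => //=.
    by rewrite invK ?inE.
  rewrite -(esum_pred_image h _ xpredT) ?[fun=> _]set_true//.
  by rewrite image_eq.
rewrite (_ : esum _ _ = \sum_(i <oo) \sum_(j <oo) h (i, j)); last first.
  pose J : nat -> set (nat * nat) := fun i => [set (i, j) | j in setT].
  rewrite (_ : setT = \bigcup_k J k); last first.
    by rewrite predeqE => -[a b]; split => // _; exists a => //; exists b.
  rewrite esum_bigcupT //=; last first.
    apply/trivIsetP => i j _ _ ij.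
    rewrite predeqE => -[k m] /=; split => //= -[] [_] _ [<-{k} _].
    by move=> [m' _] [] /esym/eqP; rewrite (negbTE ij).
  rewrite -(image_id [set: nat]) -fun_true esum_pred_image//; last first.
    by move=> k _; exact: esum_ge0.
  apply: eq_eseriesr => /= j _.
  rewrite -(esum_pred_image h (pair j) predT)//=; last first.
    by move=> ? ? _ _; exact: (@can_inj _ _ _ snd).
  by congr esum; rewrite predeqE => -[a b]; split; move=> [i _ <-]; exists i.
apply: lee_nneseries => [k _|k _]; last exact: (PG k).2.
by move=> _; apply: nneseries_ge0 => *; exact: h_ge0.
Qed.

HB.instance Definition _ := isOuterMeasure.Build R E lebesgue_outer
  lebesgue_outer0 lebesgue_outer_ge0 le_lebesgue_outer
  lebesgue_outer_sigma_subadditive.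

End lebesgue_outer_measure.

(* R^{n+1}. Pitfall: the norm and the library balls of 'rV are those of the sup
   norm; only the (common) topology is used below. *)
Definition Rn (R : realType) (n : nat) : Type := 'rV[R]_n.+1.

HB.instance Definition _ (R : realType) (n : nat) :=
  PointedTopological.copy (Rn R n) 'rV[R]_n.+1.
HB.instance Definition _ (R : realType) (n : nat) :=
  Measurable.copy (Rn R n) (caratheodory_type (@lebesgue_outer R n)).

Definition lebesgue (R : realType) (n : nat) : set (Rn R n) -> \bar R :=
  @lebesgue_outer R n.

HB.instance Definition _ (R : realType) (n : nat) :=
  isMeasure.Build _ (Rn R n) R (@lebesgue R n)
    (@caratheodory_measure0 _ _ (@lebesgue_outer R n))
    (@caratheodory_measure_ge0 _ _ (@lebesgue_outer R n))
    (@caratheodory_measure_sigma_additive _ _ (@lebesgue_outer R n)).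

Section weights_and_bmo.
Context (R : realType) (n : nat).
Local Notation E := (Rn R n).
Local Notation mu := (@lebesgue R n).

Definition eball (c : E) (r : R) : set E :=
  [set x | Num.sqrt (\sum_(i < n.+1) (x ord0 i - c ord0 i) ^+ 2) < r].

Definition cube (a : E) (l : R) : set E :=
  [set x | forall i, a ord0 i <= x ord0 i <= a ord0 i + l].

Definition locally_integrable_Rn (f : E -> R) :=
  measurable_fun setT f /\
  forall K : set E, compact K -> (\int[mu]_(x in K) `|f x|%:E < +oo)%E.

Definition Linfty_c (f : E -> R) :=
  [/\ measurable_fun setT f, exists M : R, forall x, `|f x| <= M
    & compact (closure [set x | f x != 0])].

Definition mean (A : set E) (f : E -> R) : R :=
  (fine (mu A))^-1 * \int[mu]_(x in A) f x.

(* for nonnegative functions; may be +oo *)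
Definition emean (A : set E) (f : E -> R) : \bar R :=
  (((fine (mu A))^-1)%:E * \int[mu]_(x in A) (f x)%:E)%E.

Definition ess_sup_on (A : set E) (f : E -> \bar R) : \bar R :=
  ereal_inf [set y | \forall x \ae mu, A x -> (f x <= y)%E].

Definition ess_inf_on (A : set E) (f : E -> \bar R) : \bar R :=
  ereal_sup [set y | \forall x \ae mu, A x -> (y <= f x)%E].

Definition bmo_norm (b : E -> R) : \bar R :=
  ereal_sup [set emean (eball B.1 B.2)
                   (fun x => `|b x - mean (eball B.1 B.2) b|)
            | B in [set B : E * R | 0 < B.2]].

Definition BMO (b : E -> R) :=
  locally_integrable_Rn b /\ (bmo_norm b < +oo)%E.

Definition weight (w : E -> R) :=
  (forall x, 0 <= w x) /\ locally_integrable_Rn w.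

Definition maximal (f : E -> R) (x : E) : \bar R :=
  ereal_sup [set emean (cube Q.1 Q.2) (fun y => `|f y|)
            | Q in [set Q : E * R | 0 < Q.2 /\ cube Q.1 Q.2 x]].

Definition A1_const (w : E -> R) : \bar R :=
  ('N[mu]_+oo[(fun x => maximal w x * ((w x)^-1)%:E)])%E.

Definition Ap_const (p : R) (w : E -> R) : \bar R :=
  ereal_sup [set (emean (cube Q.1 Q.2) w *
                  emean (cube Q.1 Q.2) (fun x => (w x `^ (- (p - 1)^-1))%R)
                    `^ (p - 1))%E
            | Q in [set Q : E * R | 0 < Q.2]].

(* Positivity almost everywhere is forced by the finiteness of the constants
   as soon as w is not null, provided 1/0 is read as +oo; it is explicit here
   because 0^-1 = 0 and 0 `^ r = 0 for r != 0 in the library. *)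
Definition A1_weight (w : E -> R) :=
  [/\ weight w, {ae mu, forall x, 0 < w x} & (A1_const w < +oo)%E].

Definition Ap_weight (p : R) (w : E -> R) :=
  [/\ weight w, {ae mu, forall x, 0 < w x} & (Ap_const p w < +oo)%E].

Definition Lp_norm (p : R) (v : E -> R) (f : E -> \bar R) : \bar R :=
  ((\int[mu]_x (`|f x| `^ p * (v x)%:E)) `^ p^-1)%E.

End weights_and_bmo.

Section operators.
Context (R : realType) (n : nat).
Local Notation E := (Rn R n).
Local Notation mu := (@lebesgue R n).
Implicit Types (D : set (E -> R)) (T : (E -> R) -> (E -> R)) (b f : E -> R).

Definition off_double_ball f (c : E) (r : R) : E -> R :=
  f \* \1_(~` eball c (2 * r)).

Record operator_domain D : Prop := OperatorDomain {
  domain_measurable : forall f, D f -> measurable_fun setT f;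
  domain_linear : forall (a : R) f g, D f -> D g ->
    D (fun x => a * f x + g x);
  domain_Linfty_c : forall f, Linfty_c f -> D f;
  domain_BMO : forall b f, BMO b -> Linfty_c f -> D (b \* f);
  domain_indic : forall f (c : E) (r : R), 0 < r -> D f ->
    D (f \* \1_(eball c r)) }.

(* Functions are not quotiented, so linearity is an equality almost everywhere;
   the values of T outside D are irrelevant. *)
Definition linear_operator D T :=
  (forall f, D f -> measurable_fun setT (T f)) /\
  forall (a : R) f g, D f -> D g ->
    \forall x \ae mu, T (fun y => a * f y + g y) x = a * T f x + T g x.

Definition commutator b T f : E -> R :=
  fun x => b x * T f x - T (b \* f) x.

Definition grand_maximal T f (x : E) : \bar R :=
  ereal_sup [set ess_sup_on (eball B.1 B.2)
                   (fun z => `|T (off_double_ball f B.1 B.2) z|%:E)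
            | B in [set B : E * R | 0 < B.2 /\ eball B.1 B.2 x]].

(* Tc f c r is the specified value, at the center c of B = B(c, r), of
   T (f 1_{(2B)^c}); the function being defined only up to null sets, the value
   is a separate datum, tied to T by consistency on B. *)
Definition center_value T (Tc : (E -> R) -> E -> R -> R) :=
  forall f (c : E) (r : R), Linfty_c f -> 0 < r ->
    (`|Tc f c r|%:E <= ess_sup_on (eball c r)
                         (fun z => `|T (off_double_ball f c r) z|%:E))%E.

Definition grand_maximal_bounded D T (p : R) (v : E -> R) :=
  exists C : R, forall f, D f -> (Lp_norm p v (EFin \o f) < +oo)%E ->
    (Lp_norm p v (grand_maximal T f) <= C%:E * Lp_norm p v (EFin \o f))%E.

End operators.

(* Main.v *)
(* Write F = [b,T]f. Chebyshev's inequality, applied on the ball B circumscribing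
   a cube Q to the hypothesis and to b - b_B, gives a constant c_Q with
   |F - c_Q| <= o_Q outside a small portion of Q, where o_Q is
   at most g = C |b|_BMO (w + M_T f) everywhere on Q; here w is any A_1 weight
   with |f| <= w. A good-lambda argument on dyadic subcubes turns this into
   |F - c_Q|_{L^p(v, Q)} <= C |g|_{L^p(v)} for v in A_p, and the constants c_Q
   tend to 0 along growing cubes, because on cubes far from the support of f both
   Tf and T(bf) are controlled by the grand maximal function; bf is in L^p(v) by
   the same local estimate applied to b. Hence |F|_{L^p(v)} <= C |g|_{L^p(v)}.
   The majorant w comes from the Rubio de Francia iteration and Muckenhoupt's
   theorem, with |w|_{L^p(v)} <= C |f|_{L^p(v)}. Since the constant in the
   hypothesis is an arbitrary function of [w]_{A_1}, w is rescaled on one cube so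
   that its A_1 constant takes a prescribed value. *)
Require Import Defs.
From HB Require Import structures.
From mathcomp Require Import all_boot all_order all_algebra.
From mathcomp Require Import all_classical all_reals all_analysis.
From mathcomp Require Import measurable_realfun ess_sup_inf.
From mathcomp Require Import ring lra.

Set Implicit Arguments.
Unset Strict Implicit.
Unset Printing Implicit Defensive.

Import Order.TTheory GRing.Theory Num.Theory.
Import numFieldNormedType.Exports.

Local Open Scope classical_set_scope.
Local Open Scope ring_scope.

(** * Lebesgue measure of boxes *)

(** Since delta < 1, the hypothesis bounds no mean of F, which is not known to be locally
    integrable; this is why constants with small exceptional sets replace means, and why the
    good-lambda argument runs on the constants of the dyadic cells rather than on F. These cells lie
    in one cube, of finite v-measure, so the sums to be absorbed are finite with no a priori bound
    on F; F is compared with the constants only afterwards, by a density argument. The local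
    estimate leaves the constant of the cube itself undetermined. Along the centred cubes the
    constants telescope, with differences controlled by a geometric sequence because v(Q) grows
    geometrically, so it is enough that they come arbitrarily close to 0. Only there does the norm
    of M_T(bf) occur, through its finiteness: its size does not enter the final constant. Two
    parameters remove degenerate cases: a number beta above |b|_BMO, positive also for constant b,
    and a bump of size e added to |f|, which keeps w positive when f = 0. At the end beta tends to
    |b|_BMO and e to 0. *)

Section box_volume.
Context (R : realType) (n : nat).
Local Notation E := 'rV[R]_n.+1.

Let chi (b : bool) : R := b%:R.

(* Volumes are compared by counting lattice points. *)
Lemma count_halfopen (c d : R) (M : nat) :
  \sum_(j < M) chi (c < j%:R <= d) <= Num.max 0 (d - c + 1).
Proof.
elim: M d => [|M IH] d; first by rewrite big_ord0 le_max lexx.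
rewrite big_ord_recr /=; case: (boolP (c < M%:R <= d)) => [/andP[cM Md]|_].
  (* Once M itself is counted, the other integers are at most M - 1; the induction hypothesis is
     used on the interval ending there, and the unit of length gained pays for M. *)
  have -> : \sum_(j < M) chi (c < j%:R <= d)
      = \sum_(j < M) chi (c < j%:R <= (M%:R - 1 : R)).
    apply: eq_bigr => j _; congr (chi (_ && _)).
    have jM : j.+1%:R <= M%:R :> R by rewrite ler_nat.
    rewrite -natr1 in jM.
    by apply/idP/idP => _; lra.
  apply: (le_trans (lerD (IH _) (lexx _))).
  rewrite le_max /chi/=; apply/orP; right.
  rewrite -lerBrDr ge_max; apply/andP; split; lra.
by rewrite /chi addr0; exact: IH.
Qed.

(** Cut the box into [M.+1] slices along every axis and count the upper corners of the cells, all of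
    which lie in the box. A covering box with sides c_i holds at most prod (c_i / h_i + 1) of them;
    multiplying by the volume of a cell leaves an error h_i per side, which vanishes as M grows. *)
Lemma le_box_vol_finite (ab : E * E) (F : seq (E * E)) (M : nat) :
  (forall i, ab.1 ord0 i < ab.2 ord0 i) ->
  (forall x, box ab x -> exists2 cd, cd \in F & box cd x) ->
  \prod_i (ab.2 ord0 i - ab.1 ord0 i) <=
  \sum_(cd <- F) \prod_i (Num.max 0 (cd.2 ord0 i - cd.1 ord0 i)
                          + (ab.2 ord0 i - ab.1 ord0 i) / M.+1%:R).
Proof.
move=> abP cov.
pose l i := ab.2 ord0 i - ab.1 ord0 i.
have l0 i : 0 < l i by rewrite subr_gt0.
pose h i := l i / M.+1%:R.
have h0 i : 0 < h i by rewrite divr_gt0.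
pose pt (f : {ffun 'I_n.+1 -> 'I_M.+1}) : E :=
  \row_i (ab.1 ord0 i + (f i)%:R * h i + h i).
have hM i : h i * M.+1%:R = l i by rewrite /h divfK.
have ptbox f : box ab (pt f).
  move=> i; rewrite mxE; apply/andP; split.
    by rewrite -addrA ltrDl ltr_wpDl// mulr_ge0// ltW.
  rewrite -addrA -lerBrDl -/(l i) -hM -{2}(mul1r (h i)) -mulrDl mulrC natr1.
  by rewrite ler_wpM2l ?ler_nat// ltW.
have H0 : \sum_(f : {ffun 'I_n.+1 -> 'I_M.+1}) (1 : R) <=
    \sum_(cd <- F) \prod_i (Num.max 0 (cd.2 ord0 i - cd.1 ord0 i) / h i + 1).
  apply: (@le_trans _ _ (\sum_(f : {ffun 'I_n.+1 -> 'I_M.+1}) \sum_(cd <- F)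
     \prod_i chi (cd.1 ord0 i < pt f ord0 i <= cd.2 ord0 i))).
    apply: ler_sum => f _; have [cd cdF cdx] := cov _ (ptbox f).
    rewrite (big_rem cd)//= big1 => [|i _]; last by rewrite cdx.
    rewrite lerDl; apply: sumr_ge0 => c _; apply: prodr_ge0 => i _.
    by rewrite /chi ler0n.
  rewrite exchange_big/=; apply: ler_sum => cd _.
  rewrite (eq_bigr (fun f : {ffun 'I_n.+1 -> 'I_M.+1} => \prod_i
     (fun (i : 'I_n.+1) (j : 'I_M.+1) =>
      chi (cd.1 ord0 i < ab.1 ord0 i + j%:R * h i + h i <= cd.2 ord0 i))
        i (f i)));
    last by move=> f _; apply: eq_bigr => i _; rewrite mxE.
  rewrite -(bigA_distr_bigA (fun (i : 'I_n.+1) (j : 'I_M.+1) =>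
      chi (cd.1 ord0 i < ab.1 ord0 i + j%:R * h i + h i <= cd.2 ord0 i))).
  apply: ler_prod => i _; apply/andP; split.
    by apply: sumr_ge0 => j _; by rewrite /chi ler0n.
  pose c := (cd.1 ord0 i - ab.1 ord0 i) / h i - 1.
  pose d := (cd.2 ord0 i - ab.1 ord0 i) / h i - 1.
  rewrite (eq_bigr (fun j : 'I_M.+1 => chi (c < j%:R <= d))); last first.
    move=> j _; congr (chi (_ && _)).
      rewrite /c ltrBlDr ltr_pdivrMr// mulrDl mul1r; lra.
    rewrite /d lerBrDr ler_pdivlMr// mulrDl mul1r; lra.
  apply: (le_trans (count_halfopen _ _ _)).
  rewrite ge_max addr_ge0 ?divr_ge0 ?le_max ?lexx ?(ltW (h0 i)) ?(ltW (l0 i))//=.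
  rewrite lerD2r /d /c opprB addrA subrK -mulrBl opprB addrA subrK.
  by rewrite ler_wpM2r ?invr_ge0 ?(ltW (h0 i)) ?(ltW (l0 i))// le_max lexx orbT.
have H0' : 0 <= \prod_i h i by apply: prodr_ge0 => i _; exact: ltW.
have := ler_wpM2l H0' H0.
have -> : \sum_(f : {ffun 'I_n.+1 -> 'I_M.+1}) (1 : R)
    = \prod_(i < n.+1) M.+1%:R.
  by rewrite sumr_const cardT -cardE card_ffun !card_ord prodr_const card_ord natrX.
rewrite -big_split/= => H1.
rewrite (eq_bigr (fun i => h i * M.+1%:R)); last by move=> i _; rewrite hM.
apply: (le_trans H1); rewrite mulr_sumr; apply: ler_sum => cd _.
rewrite -big_split/=; apply: ler_prod => i _; apply/andP; split.
  apply: mulr_ge0; first exact: ltW.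
  by apply: addr_ge0 => //; apply: divr_ge0; [rewrite le_max lexx|exact: ltW].
by rewrite mulrDr mulr1 mulrC divfK// gt_eqF.
Qed.

Lemma cvg_box_vol_enlarge (ab : E * E) (l : 'I_n.+1 -> R) :
  (fun e : R => \prod_i (Num.max 0 (ab.2 ord0 i - ab.1 ord0 i) + l i * e))
    @ 0 --> box_vol ab.
Proof.
have -> : box_vol ab =
    \prod_i (Num.max 0 (ab.2 ord0 i - ab.1 ord0 i) + l i * 0).
  by apply: eq_bigr => i _; rewrite mulr0 addr0.
apply: cvg_big => [|i _].
  by move=> x; exact: mul_continuous.
apply: cvgD; first exact: cvg_cst.
by apply: cvgM; [exact: cvg_cst|exact: cvg_id].
Qed.

End box_volume.

Section box_measure.
Context (R : realType) (n : nat).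
Local Notation E := 'rV[R]_n.+1.

Lemma box_vol_ge0 (ab : E * E) : 0 <= box_vol ab.
Proof. by apply: prodr_ge0 => i _; rewrite le_max lexx. Qed.

Lemma open_rV_rect (A : 'I_n.+1 -> set R) : (forall i, open (A i)) ->
  open [set x : E | forall i, A i (x ord0 i)].
Proof.
move=> oA; rewrite openE => x Ax.
exists (fun _ j => A j).
  by move=> i j; apply: open_nbhs_nbhs; split; [exact: oA|rewrite (ord1 i); exact: Ax].
by move=> y Ay i; exact: Ay.
Qed.

Lemma exists_enlarged_box (ab : E * E) (t : R) : 0 < t -> exists e : R, 0 < e /\
  box_vol (ab.1, \row_i (ab.2 ord0 i + e)) <= box_vol ab + t.
Proof.
move=> t0.
pose enl (e : R) : E * E := (ab.1, \row_i (ab.2 ord0 i + e)).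
have enlE e : 0 < e -> box_vol (enl e) <=
    \prod_i (Num.max 0 (ab.2 ord0 i - ab.1 ord0 i) + 1 * e).
  move=> e0; apply: ler_prod => i _; rewrite le_max lexx/= mxE mul1r ge_max.
  apply/andP; split; first by rewrite addr_ge0 ?le_max ?lexx// ltW.
  by rewrite addrAC lerD2r le_max lexx orbT.
have /cvgrPdist_le/(_ _ t0) := @cvg_box_vol_enlarge R n ab (fun=> 1).
move=> /nbhs_ballP[d d0 dP]; exists (d / 2); split; first by rewrite divr_gt0.
apply: (le_trans (enlE _ _)); first by rewrite divr_gt0.
have /dP : ball 0 d (d / 2).
  by rewrite /ball/= sub0r normrN gtr0_norm ?divr_gt0// ltr_pdivrMr// ltr_pMr// ltr1n.
by rewrite /= ler_norml => /andP[]; lra.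
Qed.

(** Heine-Borel: moving the lower faces in by a proportion t gives a compact box inside the
    half-open one, and raising the upper faces of the k-th covering box makes it open at a cost t /
    2^(k+1). The lattice count applies to the finite subcover. *)
Lemma box_vol_le_shrunk (ab : E * E) (F : nat -> E * E) (t : R) :
  (forall i, ab.1 ord0 i < ab.2 ord0 i) -> 0 < t < 1 ->
  box_cover (box ab) F ->
  (((1 - t) ^+ n.+1 * \prod_i (ab.2 ord0 i - ab.1 ord0 i))%:E
     <= \sum_(0 <= k <oo) (box_vol (F k))%:E + t%:E)%E.
Proof.
move=> abP /andP[t0 t1] cov.
pose enl k (e : R) : E * E := ((F k).1, \row_i ((F k).2 ord0 i + e)).
have /choice[e eP] (k : nat) : exists e : R, 0 < e /\
    box_vol (enl k e) <= box_vol (F k) + t / (2 ^ k.+1)%:R.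
  by apply: exists_enlarged_box; rewrite divr_gt0// ltr0n expn_gt0.
pose K := [set x : E | forall i,
  `[ab.1 ord0 i + t * (ab.2 ord0 i - ab.1 ord0 i), ab.2 ord0 i]%classic (x ord0 i)].
have cK : compact K.
  by apply: (@rV_compact _ _ (fun i => `[ab.1 ord0 i + t * (ab.2 ord0 i - ab.1 ord0 i),
    ab.2 ord0 i]%classic)) => i; exact: segment_compact.
pose O k := [set x : E | forall i,
  `](F k).1 ord0 i, (F k).2 ord0 i + e k[%classic (x ord0 i)].
have KO : K `<=` cover [set: nat] O.
  move=> x Kx; have /cov[k _ Fkx] : box ab x.
    move=> i; have := Kx i; rewrite /= in_itv/= => /andP[xa ->]; rewrite andbT.
    by apply: lt_le_trans xa; rewrite ltrDl mulr_gt0// subr_gt0.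
  exists k => // i; have := Fkx i; rewrite /= in_itv/= => /andP[-> xb]/=.
  by apply: (le_lt_trans xb); rewrite ltrDl; exact: (eP k).1.
rewrite compact_cover in cK.
have [|D _ KD] := cK nat setT O _ KO.
  move=> k _; apply: (@open_rV_rect (fun i =>
    `](F k).1 ord0 i, (F k).2 ord0 i + e k[%classic)) => i.
  exact: interval_open.
pose ab' : E * E := (\row_i (ab.1 ord0 i + t * (ab.2 ord0 i - ab.1 ord0 i)), ab.2).
have ab'P i : ab'.1 ord0 i < ab'.2 ord0 i.
  rewrite /= mxE; have := abP i.
  by nra.
have ab'E : \prod_i (ab'.2 ord0 i - ab'.1 ord0 i) =
    (1 - t) ^+ n.+1 * \prod_i (ab.2 ord0 i - ab.1 ord0 i).
  rewrite -[X in _ ^+ X](card_ord n.+1) -prodr_const -big_split/=.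
  by apply: eq_bigr => i _; rewrite mxE; ring.
have fin : \prod_i (ab'.2 ord0 i - ab'.1 ord0 i) <=
    \sum_(k <- finmap.enum_fset D) box_vol (enl k (e k)).
  have H M : \prod_i (ab'.2 ord0 i - ab'.1 ord0 i) <=
     \sum_(k <- finmap.enum_fset D) \prod_i (Num.max 0 ((enl k (e k)).2 ord0 i - (enl k (e k)).1 ord0 i)
        + (ab'.2 ord0 i - ab'.1 ord0 i) * M.+1%:R^-1).
    rewrite -(big_map (fun k => enl k (e k)) predT (fun cd => \prod_i
      (Num.max 0 (cd.2 ord0 i - cd.1 ord0 i)
        + (ab'.2 ord0 i - ab'.1 ord0 i) * M.+1%:R^-1))).
    apply: le_box_vol_finite => // x xab'.
    have /KD[k kD Okx] : K x.
      by move=> i; have := xab' i; rewrite /= in_itv/= mxE => /andP[/ltW -> ->].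
    exists (enl k (e k)); first by apply: map_f.
    move=> i; have := Okx i; rewrite /= in_itv/= mxE => /andP[-> /=]; exact: ltW.
  (* The finite subcover being fixed, the mesh of the lattice tends to 0. *)
  pose g (x : R) := \sum_(k <- finmap.enum_fset D) \prod_i (Num.max 0 ((enl k (e k)).2 ord0 i - (enl k (e k)).1 ord0 i)
        + (ab'.2 ord0 i - ab'.1 ord0 i) * x).
  have cg : g x @[x --> 0] --> \sum_(k <- finmap.enum_fset D) box_vol (enl k (e k)).
    apply: cvg_big => [|k _]; last exact: cvg_box_vol_enlarge.
    by move=> x; exact: add_continuous.
  have cg' : g (M.+1%:R^-1) @[M --> \oo] --> \sum_(k <- finmap.enum_fset D) box_vol (enl k (e k)).
    exact: (cvg_comp _ _ (@cvg_harmonic R) cg).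
  rewrite -(cvg_lim _ cg')//; apply: limr_ge; first by apply/cvg_ex; eexists; exact: cg'.
  by near=> M; exact: H.
rewrite -ab'E.
have tk0 k : (0 <= t / (2 ^ k.+1)%:R)%R by rewrite divr_ge0// ltW.
apply: (@le_trans _ _ (\sum_(k <- finmap.enum_fset D) ((box_vol (F k))%:E + (t / (2 ^ k.+1)%:R)%:E)))%E.
  by rewrite sumEFin lee_fin (le_trans fin)// ler_sum// => k _; exact: (eP k).2.
apply: le_trans (epsilon_trick predT _ (ltW t0)); last first.
  by move=> k; rewrite lee_fin box_vol_ge0.
apply: (@lee_sum_fset_lim R (fun k => (box_vol (F k))%:E + (t / (2 ^ k.+1)%:R)%:E)%E).
by move=> k _; rewrite adde_ge0// lee_fin ?box_vol_ge0.
Unshelve. all: by end_near. Qed.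

Lemma lebesgue_outer_box (ab : E * E) : lebesgue_outer (box ab) = (box_vol ab)%:E.
Proof.
apply/eqP; rewrite eq_le; apply/andP; split.
  apply: ereal_inf_lbound => /=.
  exists (fun k => if k == 0%N then ab else (0, 0)).
    by move=> x abx; exists 0%N.
  rewrite (@nneseries_split _ _ _ 1)//; last first.
    by move=> k _; rewrite lee_fin box_vol_ge0.
  rewrite big_nat1 eseries0 ?adde0// => -[//|k] _ _.
  by rewrite /box_vol big_ord_recl !mxE subrr maxxx mul0r.
apply: le_ereal_inf_tmp => _ [F cov <-].
have [abP|] := pselect (forall i, ab.1 ord0 i < ab.2 ord0 i); last first.
  move/existsNP => [i /negP]; rewrite -leNgt => abi.
  rewrite /box_vol (bigD1 i)//= max_l ?subr_le0// mul0r.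
  by apply: nneseries_ge0 => *; rewrite lee_fin box_vol_ge0.
have -> : box_vol ab = \prod_i (ab.2 ord0 i - ab.1 ord0 i).
  by apply: eq_bigr => i _; rewrite max_r// subr_ge0 ltW.
set V := \prod_i _; set S := (X in (_ <= X)%E).
have [->|Sfin] := eqVneq S +oo%E; first by rewrite leey.
have S0 : (0 <= S)%E by apply: nneseries_ge0 => *; rewrite lee_fin box_vol_ge0.
have SE : S = (fine S)%:E by rewrite fineK// ge0_fin_numE// ltey.
rewrite SE lee_fin.
pose u k : R := (1 - k.+2%:R^-1) ^+ n.+1 * V - k.+2%:R^-1.
have h0 : k.+2%:R^-1 @[k --> \oo] --> (0 : R).
  have := @cvg_harmonic R; rewrite -(cvg_shiftn 1) => h.
  apply: cvg_trans h; apply: near_eq_cvg; near=> k.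
  by rewrite /harmonic/= addn1.
have cu : u k @[k --> \oo] --> V.
  have -> : V = (1 - 0) ^+ n.+1 * V - 0 by rewrite !subr0 expr1n mul1r.
  apply: cvgB => //; apply: cvgMl.
  apply: (cvg_comp _ (fun x : R => x ^+ n.+1) _ (@exprn_continuous _ _ _)).
  by apply: cvgB => //; exact: cvg_cst.
rewrite -(cvg_lim _ cu)//; apply: limr_le; first by apply/cvg_ex; eexists; exact: cu.
near=> k; rewrite /u lerBlDr -lee_fin EFinD -SE.
apply: box_vol_le_shrunk => //.
by rewrite invr_gt0 ltr0n/= invf_lt1 ?ltr1n.
Unshelve. all: by end_near. Qed.

End box_measure.

Section lebesgue_measurable.
Context (R : realType) (n : nat).
Local Notation E := (Rn R n).
Local Notation mu := (@lebesgue R n).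

(** A half-space cuts every box of a cover into two boxes whose volumes add up, so a cover of X
    gives covers of the two parts of X with the same total volume. *)
Lemma measurable_halfspace (i : 'I_n.+1) (t : R) :
  measurable [set x : E | x ord0 i <= t].
Proof.
suff : caratheodory_measurable (@lebesgue_outer R n) [set x : E | x ord0 i <= t] by [].
apply: le_caratheodory_measurable => X.
apply: le_ereal_inf_tmp => _ [F cov <-].
pose lo (ab : E * E) : E * E :=
  (ab.1, \row_j (if j == i then Num.min (ab.2 ord0 j) t else ab.2 ord0 j)).
pose hi (ab : E * E) : E * E :=
  (\row_j (if j == i then Num.max (ab.1 ord0 j) t else ab.1 ord0 j), ab.2).
have volE ab : box_vol ab = box_vol (lo ab) + box_vol (hi ab).
  rewrite /box_vol (bigD1 i)//= [in X in _ = X + _](bigD1 i)//=.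
  rewrite [in X in _ = _ + X](bigD1 i)//= !mxE eqxx.
  rewrite [in X in _ = X + _](eq_bigr (fun j => Num.max 0 (ab.2 ord0 j - ab.1 ord0 j))); last first.
    by move=> j /negbTE ji; rewrite mxE ji.
  rewrite [in X in _ = _ + X](eq_bigr (fun j => Num.max 0 (ab.2 ord0 j - ab.1 ord0 j))); last first.
    by move=> j /negbTE ji; rewrite mxE ji.
  rewrite -mulrDl; congr (_ * _).
  set a := ab.1 _ _; set b := ab.2 _ _.
  by rewrite !maxEle minEle; case: (leP b t) => ?; case: (leP a t) => ?; (repeat case: leP => ?); lra.
rewrite (eq_eseriesr (g := fun k => ((box_vol (lo (F k)))%:E + (box_vol (hi (F k)))%:E)%E)); last first.
  by move=> k _; rewrite volE.
rewrite nneseriesD; last 2 first.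
- by move=> k _; rewrite lee_fin box_vol_ge0.
- by move=> k _; rewrite lee_fin box_vol_ge0.
apply: leeD.
  apply: ereal_inf_lbound; exists (fun k => lo (F k)) => // x [Xx /= xt].
  have [k _ Fkx] := cov _ Xx; exists k => // j; rewrite mxE.
  have := Fkx j; case: eqP => [->|//] /andP[-> /=] h.
  by rewrite le_min h xt.
apply: ereal_inf_lbound; exists (fun k => hi (F k)) => // x [Xx /= /negP xt].
rewrite -ltNge in xt.
have [k _ Fkx] := cov _ Xx; exists k => // j; rewrite mxE.
have := Fkx j; case: eqP => [->|//] /andP[h ->]; rewrite andbT.
by rewrite gt_max h xt.
Qed.

Lemma measurable_coord (i : 'I_n.+1) : measurable_fun [set: E] (fun x : E => x ord0 i).
Proof.
apply: (measurability _ (RGenOInfty.measurableE R)) => // _ [_ [t ->] <-].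
rewrite setTI.
rewrite (_ : _ @^-1` _ = ~` [set x : E | x ord0 i <= t]).
  by apply: measurableC; exact: measurable_halfspace.
by apply/seteqP; split => x /=; rewrite in_itv/= andbT ltNge => /negP.
Qed.

Lemma measurable_box (ab : E * E) : measurable (box ab : set E).
Proof.
have -> : (box ab : set E) = \bigcap_(i in [set: 'I_n.+1])
    ((fun x : E => x ord0 i) @^-1` `]ab.1 ord0 i, ab.2 ord0 i]).
  apply/seteqP; split=> x /=; first by move=> h i _; rewrite /= in_itv/=; exact: h.
  by move=> h i; have := h i I; rewrite /= in_itv.
apply: fin_bigcap_measurable => [|i _]; first exact: finite_finset.
rewrite -[X in measurable X]setTI; apply: measurable_coord => //.
Qed.

Lemma lebesgue_box (ab : E * E) : mu (box ab) = (box_vol ab)%:E.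
Proof. exact: lebesgue_outer_box. Qed.

(** Half-open cubes replace the closed [cube] throughout the proof: they are boxes, so their measure
    is known exactly, and the dyadic ones form genuine partitions. *)
Definition hcube (a : E) (l : R) : set E := box (a, \row_i (a ord0 i + l)).

Lemma hcubeP (a x : E) (l : R) :
  hcube a l x <-> forall i, a ord0 i < x ord0 i <= a ord0 i + l.
Proof. by split=> h i; have := h i; rewrite mxE. Qed.

Lemma measurable_hcube a l : measurable (hcube a l).
Proof. exact: measurable_box. Qed.

Lemma lebesgue_hcube a l : 0 <= l -> mu (hcube a l) = (l ^+ n.+1)%:E.
Proof.
move=> l0; rewrite lebesgue_box; congr (_%:E).
rewrite -[X in _ ^+ X](card_ord n.+1) -prodr_const; apply: eq_bigr => i _.
by rewrite mxE addrAC subrr add0r max_r.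
Qed.

Lemma open_rat_box (U : set E) x : open U -> U x ->
  exists q : 'rV[rat]_n.+1 * 'rV[rat]_n.+1,
    box (map_mx ratr q.1, map_mx ratr q.2) x /\
    (box (map_mx ratr q.1, map_mx ratr q.2) : set E) `<=` U.
Proof.
rewrite openE => oU /oU [P Px PU].
have /choice[q qP] (i : 'I_n.+1) : exists q : rat * rat,
    ratr q.1 < x ord0 i /\ x ord0 i < ratr q.2 /\
    (forall y : R, ratr q.1 < y <= ratr q.2 -> P ord0 i y).
  have /nbhs_ballP[e /= e0 eP] := Px ord0 i.
  have [|q1] := @rat_in_itvoo R (x ord0 i - e) (x ord0 i); first by rewrite ltrBlDr ltrDl.
  rewrite in_itv/= => /andP[q1l q1r].
  have [|q2] := @rat_in_itvoo R (x ord0 i) (x ord0 i + e); first by rewrite ltrDl.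
  rewrite in_itv/= => /andP[q2l q2r].
  exists (q1, q2); split=> //; split=> //= y /andP[y1 y2]; apply: eP.
  rewrite /ball/= ltr_norml; apply/andP; split; lra.
exists (\row_i (q i).1, \row_i (q i).2); split.
  by move=> i; rewrite /= !mxE; have [-> [/ltW -> _]] := qP i.
move=> y yq; apply: PU => i j; rewrite (ord1 i); have [_ [_]] := qP j; apply.
by have := yq j; rewrite /= !mxE.
Qed.

Lemma open_measurable_Rn (U : set E) : open U -> measurable U.
Proof.
move=> oU.
have -> : U = \bigcup_(q in [set q : 'rV[rat]_n.+1 * 'rV[rat]_n.+1 |
    (box (map_mx ratr q.1, map_mx ratr q.2) : set E) `<=` U])
    (box (map_mx ratr q.1, map_mx ratr q.2) : set E).
  apply/seteqP; split=> [x /(open_rat_box oU)[q [qx qU]]|x [q qU] /qU//].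
  by exists q.
rewrite bigcup_mkcond; apply: countable_bigcupT_measurable => [|q].
  exact: countableP.
by case: ifP => _; [exact: measurable_box|exact: measurable0].
Qed.

End lebesgue_measurable.

(** * Layer cake and maximal operators *)

Section density_measure.
Context d (T : measurableType d) (R : realType) (m : {measure set T -> \bar R}).
Variables (v : T -> R) (mv : measurable_fun [set: T] v) (v0 : forall x, 0 <= v x).
Local Open Scope ereal_scope.

(** The proofs [mv] and [v0] are arguments so that the measure structure can be attached to the
    term; the maximal theorem, proved for an arbitrary measure, then applies to v and to its dual
    weight. *)
Definition density_of (v : T -> R) (mv : measurable_fun [set: T] v)
    (v0 : forall x, (0 <= v x)%R) (A : set T) : \bar R :=
  \int[m]_(x in A) (v x)%:E.

Let density0 : density_of mv v0 set0 = 0.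
Proof. by rewrite /density_of integral_set0. Qed.

Let density_ge0 A : 0 <= density_of mv v0 A.
Proof. by apply: integral_ge0 => x _; rewrite lee_fin. Qed.

Let measurable_EFin_density D : measurable_fun D (fun x => (v x)%:E).
Proof. by apply/measurable_EFinP; exact: measurable_funTS. Qed.

Let density_sigma_additive : semi_sigma_additive (density_of mv v0).
Proof.
move=> F mF tF mUF; rewrite /density_of ge0_integral_bigcup//.
  by apply: is_cvg_ereal_nneg_natsum => n _; exact: density_ge0.
by move=> x _; rewrite lee_fin.
Qed.

HB.instance Definition _ := isMeasure.Build d T R (density_of mv v0)
  density0 density_ge0 density_sigma_additive.

Import HBNNSimple.

Let integral_density_nnsfun (h : {nnsfun T >-> R}) :
  \int[density_of mv v0]_x (h x)%:E = \int[m]_x ((h x)%:E * (v x)%:E).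
Proof.
transitivity (\sum_(k \in range h) k%:E * \int[m]_(x in h @^-1` [set k]) (v x)%:E).
  by rewrite integralT_nnsfun sintegralE.
transitivity (\int[m]_x (\sum_(k \in range h)
    (k%:E * (((fun x => (v x)%:E) \_ (h @^-1` [set k])) x)))).
  rewrite ge0_integral_fsum//.
  - apply: eq_fsbigr => k _.
    have [k0|k0] := ltP k 0%R.
      rewrite preimage_nnfun0// integral_set0 mule0.
      by rewrite integral0_eq// => x _; rewrite patch_set0 mule0.
    rewrite ge0_integralZl//.
    + by rewrite -integral_mkcond.
    + by apply/(measurable_restrictT _ _).1 => //.
    + by move=> x _; rewrite patchE; case: ifP => // _; rewrite lee_fin.
  - move=> k; apply: measurable_funeM.
    by apply/(measurable_restrictT _ _).1 => //.
  - move=> k x _; rewrite patchE; case: ifP; last by rewrite mule0.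
    by rewrite inE/= => <-; rewrite -EFinM lee_fin mulr_ge0.
apply: eq_integral => x _; rewrite (fsbigD1 (h x))//=; last first.
  by exists x.
rewrite [X in _ + X]fsbig1.
  by rewrite adde0 patchE mem_set.
move=> k [_ /= /eqP kh]; rewrite patchE memNset ?mule0//= => hk.
by move: kh; rewrite hk eqxx.
Qed.

Lemma ge0_integral_density (f : T -> \bar R) :
  measurable_fun setT f -> (forall x, 0 <= f x) ->
  \int[density_of mv v0]_x f x = \int[m]_x (f x * (v x)%:E).
Proof.
move=> mf f0; pose f_ := nnsfun_approx measurableT mf.
have cvf x : (f_ n x)%:E @[n --> \oo] --> f x by apply: cvg_nnsfun_approx.
transitivity (limn (fun n => \int[density_of mv v0]_x (f_ n x)%:E)).
  rewrite -monotone_convergence//.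
  - by apply: eq_integral => x _; apply/esym/cvg_lim => //; exact: cvf.
  - by move=> n; exact/measurable_EFinP/measurable_funP.
  - by move=> n x _; rewrite lee_fin.
  - by move=> x _ k n kn; rewrite lee_fin; exact/lefP/nd_nnsfun_approx.
rewrite [X in limn X](_ : _ = fun n => \int[m]_x ((f_ n x)%:E * (v x)%:E)); last first.
  by apply/funext => n; exact: integral_density_nnsfun.
rewrite -monotone_convergence//.
- apply: eq_integral => x _; apply/cvg_lim => //.
  by apply: cvgeZr => //; exact: cvf.
- move=> n; apply: emeasurable_funM => //.
  by apply/measurable_EFinP/measurable_funP.
- by move=> n x _; rewrite -EFinM lee_fin mulr_ge0.
- move=> x _ k n kn; rewrite lee_wpmul2r ?lee_fin//.
  exact/lefP/nd_nnsfun_approx.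
Qed.

Lemma ge0_integral_density_in (D : set T) (f : T -> \bar R) :
  measurable D -> measurable_fun D f -> (forall x, D x -> 0 <= f x) ->
  \int[density_of mv v0]_(x in D) f x = \int[m]_(x in D) (f x * (v x)%:E).
Proof.
move=> mD mf f0; rewrite [LHS]integral_mkcond ge0_integral_density.
- rewrite [RHS]integral_mkcond; apply: eq_integral => x _.
  by rewrite !patchE; case: ifP => // _; rewrite mul0e.
- by apply/(measurable_restrictT _ _).1.
- by move=> x; rewrite patchE; case: ifP => // /[!inE]; exact: f0.
Qed.

End density_measure.

Lemma measurable_nneseries d (T : measurableType d) (R : realType) (D : set T)
    (h : nat -> T -> \bar R) :
  (forall k x, D x -> (0 <= h k x)%E) -> (forall k, measurable_fun D (h k)) ->
  measurable_fun D (fun x => \sum_(0 <= k <oo) h k x)%E.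
Proof.
move=> h0 mh; apply: (@ge0_emeasurable_sum _ _ _ D h predT) => // k x Dx _.
exact: h0.
Qed.

Lemma powR_gt1 (R : realType) (x p : R) : 1 < x -> 0 < p -> 1 < x `^ p.
Proof.
move=> x1 p0; rewrite /powR gt_eqF ?(lt_trans _ x1)// expR_gt1.
by rewrite mulr_gt0// ln_gt0.
Qed.

Lemma lee_poweR (R : realType) (x y : \bar R) (r : R) :
  0 <= r -> (0 <= x)%E -> (x <= y)%E -> (x `^ r <= y `^ r)%E.
Proof.
move=> r0 x0 xy; apply: gt0_ler_poweR => //; rewrite in_itv/= leey andbT//.
exact: le_trans xy.
Qed.

Section layer_cake.
Context (R : realType) (p r : R).
Hypotheses (p0 : 0 < p) (r1 : 1 < r).

Let r0 : 0 < r. Proof. exact: lt_trans r1. Qed.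

Let rho1 : 1 < r `^ p.
Proof. exact: powR_gt1. Qed.

Lemma powR_geom (s : R) k : 0 <= s -> (s * r ^+ k) `^ p = s `^ p * (r `^ p) ^+ k.
Proof.
move=> s0; rewrite powRM ?exprn_ge0 ?(ltW r0)//; congr (_ * _).
by rewrite -powR_mulrn ?(ltW r0)// -powRrM mulrC powRrM powR_mulrn ?powR_ge0.
Qed.

Let levelC := (1 - (r `^ p)^-1)^-1.

(** The levels below y are in geometric progression, so their p-th powers add up to at most the last
    one times [levelC], the sum of the series of ratio r^-p. *)
Lemma level_sum_le_real (s y : R) K : 0 < s -> 0 <= y ->
  \sum_(k < K) ((s * r ^+ k) `^ p * (s * r ^+ k < y)%R%:R) <= levelC * y `^ p.
Proof.
move=> s0 y0; have rho0 : 0 < r `^ p by rewrite powR_gt0.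
have C0 : 0 <= levelC by rewrite invr_ge0 subr_ge0 invf_le1// ltW.
elim: K => [|K IH]; first by rewrite big_ord0 mulr_ge0// powR_ge0.
rewrite big_ord_recr/=; have [sy|_] := ltP (s * r ^+ K) y; last first.
  by rewrite mulr0 addr0.
rewrite mulr1; apply: (@le_trans _ _ (\sum_(k < K.+1) (s * r ^+ k) `^ p)).
  rewrite big_ord_recr/= lerD2r; apply: ler_sum => k _.
  by rewrite ler_piMr ?powR_ge0//; case: (_ < _); rewrite ?lexx ?ler01.
apply: (@le_trans _ _ (levelC * (s * r ^+ K) `^ p)); last first.
  rewrite ler_wpM2l// ge0_ler_powR ?nnegrE ?(ltW p0)// ?(ltW sy)//.
  by rewrite mulr_ge0 ?exprn_ge0// ltW.
under eq_bigr do rewrite powR_geom ?(ltW s0)//.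
rewrite powR_geom ?(ltW s0)// -mulr_sumr mulrCA ler_wpM2l ?powR_ge0//.
rewrite /levelC mulrC ler_pdivlMr ?subr_gt0 ?invf_lt1//.
have := subrX1 (r `^ p) K.+1.
set S := \sum_(_ < _) _; set q := r `^ p => E.
have -> : S * (1 - q^-1) = (q ^+ K.+1 - 1) / q.
  by rewrite E; field; rewrite gt_eqF.
by rewrite ler_pdivrMr// -exprSr lerBlDr lerDl.
Qed.

Lemma exists_level (s y : R) : 0 < s -> s < y ->
  exists k, s * r ^+ k < y <= s * r ^+ k.+1.
Proof.
move=> s0 sy.
have : exists k, y <= s * r ^+ k.
  (* Bernoulli's inequality: r^k >= 1 + k (r - 1). *)
  have [k yk] : exists k : nat, y / s <= 1 + k%:R * (r - 1).
    exists (Num.truncn (y / s / (r - 1))).+1.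
    have := truncnS_gt (y / s / (r - 1)).
    by rewrite ltr_pdivrMr ?subr_gt0// => h; lra.
  exists k; rewrite mulrC -ler_pdivrMr//; apply: (le_trans yk).
  elim: k {yk} => [|k IH]; first by rewrite mul0r addr0.
  rewrite exprS; apply: le_trans (ler_wpM2l (ltW r0) IH).
  have : 0 <= k%:R * (r - 1) ^+ 2 :> R by rewrite mulr_ge0// sqr_ge0.
  by rewrite -natr1; lra.
move=> ex; case: (ex_minnP ex) => -[|k] yk kmin.
  by move: yk; rewrite expr0 mulr1 leNgt sy.
exists k; rewrite yk andbT ltNge; apply/negP => /kmin.
by rewrite ltnn.
Qed.

Local Open Scope ereal_scope.

Lemma level_sum_le (s : R) (y : \bar R) : (0 < s)%R -> 0 <= y ->
  \sum_(0 <= k <oo) (((s * r ^+ k) `^ p)%:E * ((s * r ^+ k)%:E < y)%E%:R%:E)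
  <= levelC%:E * y `^ p.
Proof.
move=> s0; have C0 : (0 < levelC)%R by rewrite invr_gt0 subr_gt0 invf_lt1// (lt_trans _ rho1).
case: y => [y| |//]; last first.
  by move=> _; rewrite poweRyr ?gt_eqF// gt0_muley ?lte_fin// leey.
rewrite lee_fin => y0; apply: lime_le.
  by apply: is_cvg_ereal_nneg_natsum => k _; rewrite -EFinM lee_fin mulr_ge0 ?powR_ge0.
apply: nearW => K; rewrite big_mkord; under eq_bigr do rewrite -EFinM lte_fin.
by rewrite sumEFin poweR_EFin -EFinM lee_fin level_sum_le_real.
Qed.

(** One term is enough, that of the level k with s r^k < y <= s r^(k+1). An infinite y is handled
    through arbitrarily large finite values below it. *)
Lemma le_level_sum (s : R) (y : \bar R) : (0 < s)%R -> s%:E < y ->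
  y `^ p <=
  \sum_(0 <= k <oo) (((s * r ^+ k.+1) `^ p)%:E * ((s * r ^+ k)%:E < y)%E%:R%:E).
Proof.
move=> s0.
have ge0 (z : \bar R) k :
    0 <= ((s * r ^+ k.+1) `^ p)%:E * ((s * r ^+ k)%:E < z)%E%:R%:E.
  by rewrite -EFinM lee_fin mulr_ge0 ?powR_ge0.
have fin (x : R) (z : \bar R) : (s < x)%R -> x%:E <= z -> (x%:E) `^ p <=
    \sum_(0 <= k <oo) (((s * r ^+ k.+1) `^ p)%:E * ((s * r ^+ k)%:E < z)%E%:R%:E).
  move=> sx xz; have [k /andP[kx xk]] := exists_level s0 sx.
  apply: le_trans (nneseries_lim_ge k.+1 _); last by move=> *; exact: ge0.
  rewrite big_nat_recr//=; apply: (@le_trans _ _ (((s * r ^+ k.+1) `^ p)%:E)).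
    rewrite lee_fin ge0_ler_powR ?nnegrE ?(ltW p0) ?(ltW s0)//.
      by rewrite ltW// (lt_trans s0).
    by rewrite mulr_ge0 ?exprn_ge0// ltW.
  rewrite (lt_le_trans _ xz) ?lte_fin// mule1 leeDr//.
  by apply: sume_ge0 => *; exact: ge0.
case: y => [y| |//]; first by rewrite lte_fin => /fin; apply.
move=> _; rewrite poweRyr ?gt_eqF// leye_eq; apply/eqP/eq_infty => t.
pose x : R := Num.max (s + 1)%R ((Num.max 0 t) `^ p^-1)%R.
apply: (@le_trans _ _ (x%:E `^ p)); last first.
  by apply: fin; [rewrite lt_max ltrDl ltr01|rewrite leey].
rewrite poweR_EFin lee_fin.
apply: (@le_trans _ _ (((Num.max 0 t) `^ p^-1) `^ p)%R).
  by rewrite -powRrM mulVf ?gt_eqF// powRr1 ?le_max ?lexx ?orbT.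
rewrite ge0_ler_powR ?nnegrE ?(ltW p0) ?powR_ge0//.
  by rewrite le_max powR_ge0 orbT.
by rewrite le_max lexx orbT.
Qed.

Context d (T : measurableType d) (m : {measure set T -> \bar R}).
Variable (G : T -> \bar R).
Hypotheses (mG : measurable_fun setT G) (G0 : forall x, 0 <= G x).

Lemma measurable_super_level (s : \bar R) : measurable [set x | s < G x].
Proof.
rewrite (_ : [set x | s < G x] = [set: T] `&` G @^-1` `]s, +oo]%classic).
  by apply: mG => //; exact: emeasurable_itv.
by rewrite setTI; apply/seteqP; split => x /=; rewrite in_itv/= leey andbT.
Qed.

Lemma measurable_poweR_fun : measurable_fun setT (fun x => G x `^ p).
Proof. exact: (measurableT_comp (measurable_poweR p)). Qed.

Let indE (s : R) k x : ((s * r ^+ k)%:E < G x)%E%:R%:E =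
  (\1_[set x | ((s * r ^+ k)%:E < G x)%E] x)%:E :> \bar R.
Proof. by rewrite indicE mem_setE. Qed.

Let level_integralE (c s : R) k : (0 <= c)%R ->
  c%:E * m [set x | (s * r ^+ k)%:E < G x] =
  \int[m]_x (c%:E * (\1_[set x | ((s * r ^+ k)%:E < G x)%E] x)%:E).
Proof.
move=> c0; rewrite ge0_integralZl_EFin//.
- by rewrite integral_indic ?setIT//; exact: measurable_super_level.
- by apply/measurable_EFinP; exact: measurable_indic (measurable_super_level _).
Qed.

Lemma series_level_le (s : R) : (0 < s)%R ->
  \sum_(0 <= k <oo) (((s * r ^+ k) `^ p)%:E * m [set x | (s * r ^+ k)%:E < G x])
  <= levelC%:E * \int[m]_x (G x `^ p).
Proof.
move=> s0; have C0 : (0 <= levelC)%R.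
  by rewrite invr_ge0 subr_ge0 invf_le1 ?(lt_trans _ rho1)// ltW.
rewrite -ge0_integralZl_EFin//; last 2 first.
- by move=> x _; exact: poweR_ge0.
- exact: measurable_poweR_fun.
under eq_eseriesr => k _ do rewrite level_integralE ?powR_ge0//.
rewrite -integral_nneseries//; last 2 first.
- move=> k; apply: measurable_funeM; apply/measurable_EFinP.
  exact: measurable_indic (measurable_super_level _).
- by move=> k x _; rewrite -EFinM lee_fin mulr_ge0 ?powR_ge0.
apply: ge0_le_integral => //.
- by move=> x _; apply: nneseries_ge0 => k _ _; rewrite -EFinM lee_fin mulr_ge0 ?powR_ge0.
- apply: measurable_nneseries => k.
    by move=> x _; rewrite -EFinM lee_fin mulr_ge0 ?powR_ge0.
  apply: measurable_funeM; apply/measurable_EFinP.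
  exact: measurable_indic (measurable_super_level _).
- by apply: measurable_funeM; exact: measurable_poweR_fun.
- move=> x _; under eq_eseriesr do rewrite -indE; exact: level_sum_le.
Qed.

Lemma integral_above_level (s : R) : (0 < s)%R ->
  \int[m]_(x in [set x | s%:E < G x]) (G x `^ p) <=
  \sum_(0 <= k <oo) (((s * r ^+ k.+1) `^ p)%:E * m [set x | (s * r ^+ k)%:E < G x]).
Proof.
move=> s0.
under eq_eseriesr => k _ do rewrite level_integralE ?powR_ge0//.
rewrite -integral_nneseries//; last 2 first.
- move=> k; apply: measurable_funeM; apply/measurable_EFinP.
  exact: measurable_indic (measurable_super_level _).
- by move=> k x _; rewrite -EFinM lee_fin mulr_ge0 ?powR_ge0.
rewrite integral_mkcond; apply: ge0_le_integral => //.
- by move=> x _; rewrite patchE; case: ifP => // _; exact: poweR_ge0.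
- apply/(measurable_restrictT _ (measurable_super_level _)).1.
  by apply: measurable_funTS; exact: measurable_poweR_fun.
- apply: measurable_nneseries => k.
    by move=> x _; rewrite -EFinM lee_fin mulr_ge0 ?powR_ge0.
  apply: measurable_funeM; apply/measurable_EFinP.
  exact: measurable_indic (measurable_super_level _).
- move=> x _; rewrite patchE; case: ifPn => [/[!inE]/= sG|_].
    by under eq_eseriesr do rewrite -indE; exact: le_level_sum.
  by apply: nneseries_ge0 => k _ _; rewrite -EFinM lee_fin mulr_ge0 ?powR_ge0.
Qed.

(** The levels from s on control the integral over {G > s} only, so s has to tend to 0. The
    remainder D s^p vanishes in the limit; it accommodates the initial term of a good-lambda
    recursion. *)
Lemma integral_poweR_le_level (C : \bar R) (D : R) :
  (forall s : R, (0 < s)%R ->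
    \sum_(0 <= k <oo) (((s * r ^+ k.+1) `^ p)%:E * m [set x | (s * r ^+ k)%:E < G x])
      <= C + (D * s `^ p)%:E) ->
  \int[m]_x (G x `^ p) <= C.
Proof.
move=> H.
(* Chosen so that s_N^p = 1 / (N + 1), which makes the remainder a multiple of the harmonic
   sequence. *)
pose s (N : nat) : R := ((N.+1%:R^-1) `^ p^-1)%R.
have s0 N : (0 < s N)%R by rewrite powR_gt0// invr_gt0.
have sp N : (s N `^ p = N.+1%:R^-1)%R.
  by rewrite -powRrM mulVf ?gt_eqF// powRr1.
pose F N := [set x | (s N)%:E < G x].
have FU : \bigcup_N F N = [set x | 0 < G x].
  apply/seteqP; split=> [x [N _]|x /= Gx].
    by apply: lt_trans; rewrite lte_fin.
  have [Gy|Gfin] := eqVneq (G x) +oo.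
    by exists 0%N => //; rewrite /F/= Gy ltry.
  have GE : G x = (fine (G x))%:E by rewrite fineK// ge0_fin_numE// ltey.
  have g0 : (0 < fine (G x))%R by rewrite -lte_fin -GE.
  exists (Num.truncn (fine (G x) `^ p)^-1) => //; rewrite /F/= GE lte_fin.
  rewrite ltNge; apply/negP => gs.
  have : (fine (G x) `^ p <= s (Num.truncn (fine (G x) `^ p)^-1) `^ p)%R.
    by rewrite ge0_ler_powR ?nnegrE ?(ltW p0) ?(ltW g0) ?powR_ge0.
  rewrite sp leNgt => /negP; apply.
  by rewrite -[ltRHS]invrK ltf_pV2 ?posrE ?invr_gt0 ?powR_gt0// truncnS_gt.
have intE : \int[m]_x (G x `^ p) = \int[m]_(x in \bigcup_N F N) (G x `^ p).
  rewrite FU [RHS]integral_mkcond; apply: eq_integral => x _.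
  rewrite patchE; case: ifPn => // /negP; rewrite inE/= => /negP.
  rewrite -leNgt => G_le0; have -> : G x = 0 by apply/le_anti; rewrite G_le0 G0.
  by rewrite poweR0r// gt_eqF.
have cF := @ge0_nondecreasing_set_cvg_integral _ T R F (fun x => G x `^ p) m.
rewrite intE.
have {cF}cF : \int[m]_(x in F N) (G x `^ p) @[N --> \oo] -->
    \int[m]_(x in \bigcup_N F N) (G x `^ p).
  apply: cF.
  - move=> i j ij; apply/subsetPset => x; rewrite /F/=; apply: le_lt_trans.
    rewrite lee_fin ge0_ler_powR ?nnegrE ?invr_ge0 ?(ltW p0)//.
    by rewrite lef_pV2 ?posrE// ler_nat ltnS.
  - by move=> N; exact: measurable_super_level.
  - by move=> N; apply: measurable_funTS; exact: measurable_poweR_fun.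
  - by move=> N x _; exact: poweR_ge0.
have cR : C + (D * N.+1%:R^-1)%R%:E @[N --> \oo] --> C.
  rewrite -[X in _ --> X]adde0; apply: cvgeD.
  - by rewrite fin_num_adde_defl.
  - exact: cvg_cst.
  - apply: cvg_EFin; first exact: nearW.
    rewrite -(mulr0 D); apply: cvgMr; exact: cvg_harmonic.
rewrite -(cvg_lim _ cF)// -(cvg_lim _ cR)//.
apply: lee_lim.
- by apply/cvg_ex; eexists; exact: cF.
- by apply/cvg_ex; eexists; exact: cR.
- apply: nearW => N; rewrite -(sp N).
  by apply: le_trans (integral_above_level (s0 N)) (H _ (s0 N)).
Qed.

End layer_cake.

(** * Vitali covering and the maximal theorem for a countable family of sets *)

Section maximal_operator.
Context d (T : measurableType d) (R : realType) (m : {measure set T -> \bar R}).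
Variables (B B' : nat -> set T) (rad : nat -> R) (K : R).
Hypotheses (mB : forall i, measurable (B i)) (mB' : forall i, measurable (B' i)).
Hypothesis (m_gt0 : forall i, (0 < m (B i))%E).
Hypothesis (m_fin : forall i, (m (B i) < +oo)%E).
Hypothesis engulf : forall i j, B i `&` B j !=set0 -> rad i <= rad j -> B i `<=` B' j.
Hypothesis K0 : 0 < K.
Hypothesis doubling : forall i, (m (B' i) <= K%:E * m (B i))%E.

Definition average (g : T -> \bar R) (A : set T) : \bar R :=
  (((fine (m A))^-1)%:E * \int[m]_(x in A) g x)%E.

(** Thanks to the indicator the supremum runs over all indices: a point in no set of the family gets
    0 instead of the supremum of the empty set. Countability of the family makes the result
    measurable. *)
Definition maxop (g : T -> \bar R) (x : T) : \bar R :=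
  ereal_sup (range (fun i => ((\1_(B i) x)%:E * average g (B i))%E)).

Lemma exists_max_rad (s : seq nat) : s != [::] ->
  exists2 j, j \in s & forall i, i \in s -> rad i <= rad j.
Proof.
elim: s => // i [|k s] IH _.
  by exists i; rewrite ?mem_head// => j; rewrite inE => /eqP ->.
have [//|j js jmax] := IH _.
have [ij|ji] := leP (rad i) (rad j).
  exists j; first by rewrite inE js orbT.
  by move=> l; rewrite inE => /predU1P[-> //|]; exact: jmax.
exists i; first by rewrite mem_head.
by move=> l; rewrite inE => /predU1P[-> //|/jmax] /le_trans; apply; exact: ltW.
Qed.

(** Greedy choice: keep a set of largest [rad], drop all sets that meet it, and recurse on the rest.
    By [engulf] a dropped set lies in the enlargement of the set that eliminated it. *)
Lemma vitali_selection (s : seq nat) : exists D : seq nat,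
  [/\ {subset D <= s}, uniq D, trivIset [set` D] B &
      forall i, i \in s -> exists2 j, j \in D & B i `<=` B' j].
Proof.
have [N sN] := ubnP (size s); elim: N s sN => // N IH s sN.
have [->|s0] := eqVneq s [::].
  by exists [::]; split => //; move=> i j; rewrite /= in_nil.
have [j js jmax] := exists_max_rad s0.
pose s' := [seq i <- s | `[< B i `&` B j = set0 >]].
have Bj0 : B j !=set0.
  apply/set0P/eqP => Bj0; have := m_gt0 j; by rewrite Bj0 measure0 ltxx.
have s's : (size s' < size s)%N.
  rewrite size_filter -(count_predC (fun i => `[< B i `&` B j = set0 >]) s).
  rewrite -[ltnLHS]addn0 ltn_add2l -has_count; apply/hasP; exists j => //=.
  by apply/asboolPn; rewrite setIid; exact/eqP/set0P.
have [|D [Ds uD tD cD]] := IH s'; first by rewrite (leq_trans s's).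
have jD i : i \in D -> B i `&` B j = set0.
  by move/Ds; rewrite mem_filter => /andP[/asboolP].
exists (j :: D); split.
- move=> i; rewrite inE => /predU1P[-> //|/Ds].
  by rewrite mem_filter => /andP[].
- rewrite /= uD andbT; apply/negP => /jD; rewrite setIid => Bj.
  by case: Bj0; rewrite Bj.
- move=> i k /=; rewrite !inE => /predU1P[->|iD] /predU1P[->|kD] //.
  + by rewrite setIC jD// => -[].
  + by rewrite jD// => -[].
  + exact: tD.
- move=> i is_; have [ij|ij] := pselect (B i `&` B j = set0).
    have [k kD Bik] : exists2 k, k \in D & B i `<=` B' k.
      by apply: cD; rewrite mem_filter is_ andbT; exact/asboolP.
    by exists k => //; rewrite inE kD orbT.
  exists j; first exact: mem_head.
  by apply: engulf; [exact/set0P/eqP|exact: jmax].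
Qed.

Local Open Scope ereal_scope.

Lemma average_ge0 (g : T -> \bar R) A : (forall x, 0 <= g x) -> 0 <= average g A.
Proof.
move=> g0; rewrite mule_ge0 ?lee_fin ?invr_ge0 ?fine_ge0//.
by apply: integral_ge0 => x _.
Qed.

Lemma le_average_maxop (g : T -> \bar R) i x : B i x -> average g (B i) <= maxop g x.
Proof.
move=> Bx; apply: ereal_sup_ubound; exists i => //.
by rewrite indicE mem_set// mul1e.
Qed.

Lemma maxop_ge0 (g : T -> \bar R) x : (forall x, 0 <= g x) -> 0 <= maxop g x.
Proof.
move=> g0; apply: (@le_trans _ _ ((\1_(B 0%N) x)%:E * average g (B 0%N))).
  by rewrite mule_ge0 ?average_ge0// lee_fin.
by apply: ereal_sup_ubound; exists 0%N.
Qed.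

Lemma maxop_level (g : T -> \bar R) (t : \bar R) : 0 <= t ->
  [set x | t < maxop g x] =
  \bigcup_(i in [set i | t < average g (B i)]) B i.
Proof.
move=> t0; apply/seteqP; split => [x /=|x [i /= ti Bix]].
  move=> /ereal_sup_gt[_ [i _ <-]]; rewrite indicE.
  case: (boolP (x \in B i)) => [|_]; last by rewrite mul0e ltNge t0.
  by rewrite inE mul1e => Bx ti; exists i.
by rewrite /= (lt_le_trans ti)// le_average_maxop.
Qed.

Lemma measurable_maxop (g : T -> \bar R) : (forall x, 0 <= g x) ->
  measurable_fun setT (maxop g).
Proof.
move=> g0; apply: (measurability _ (ErealGenOInfty.measurableE R)) => // _ [_ [t ->] <-].
rewrite setTI (_ : _ @^-1` _ = [set x | t%:E < maxop g x]); last first.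
  by apply/seteqP; split => x /=; rewrite in_itv/= ?andbT.
have [t0|t0] := ltP t 0%R.
  rewrite (_ : [set x | _] = setT)//; apply/seteqP; split => // x _ /=.
  by rewrite (lt_le_trans _ (maxop_ge0 _ g0))// lte_fin.
by rewrite maxop_level ?lee_fin//; exact: bigcup_measurable.
Qed.

(** The level set is the increasing union of its parts built from the first N sets. For each part
    the selection gives disjoint sets with average above t whose enlargements cover it. *)
Lemma maxop_weak_type (g : T -> \bar R) (t : R) : (0 < t)%R ->
  measurable_fun setT g -> (forall x, 0 <= g x) ->
  t%:E * m [set x | t%:E < maxop g x] <= K%:E * \int[m]_x g x.
Proof.
move=> t0 mg g0; rewrite maxop_level ?lee_fin ?(ltW t0)//.
set P := [set i | _].
pose F N := \bigcup_(i in P `&` `I_N) B i.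
have mF N : measurable (F N) by apply: bigcup_measurable.
have FU : \bigcup_N F N = \bigcup_(i in P) B i.
  apply/seteqP; split => [x [N _ [i [Pi _] Bx]]|x [i Pi Bx]]; first by exists i.
  by exists i.+1 => //; exists i => //; split => //=.
have nF : nondecreasing_seq F.
  move=> i j ij; apply/subsetPset => x [k [Pk /= ki] Bx].
  by exists k => //; split => //=; exact: leq_trans ki ij.
have cF : m (F N) @[N --> \oo] --> m (\bigcup_(i in P) B i).
  by rewrite -FU; apply: nondecreasing_cvg_mu => //; rewrite FU; exact: bigcup_measurable.
rewrite -lee_pdivlMl//.
rewrite -(cvg_lim _ cF)//; apply: lime_le; first by apply/cvg_ex; eexists; exact: cF.
apply: nearW => N; rewrite lee_pdivlMl//.
pose s := [seq i <- iota 0 N | `[< P i >]].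
have [D [Ds uD tD cD]] := vitali_selection s.
have FD : F N `<=` \big[setU/set0]_(j <- D) B' j.
  move=> x [i [Pi /= iN] Bx]; have [|j jD Bij] := cD i.
    by rewrite mem_filter mem_iota/= add0n iN andbT; exact/asboolP.
  by rewrite -bigcup_seq; exists j => //; exact: Bij.
apply: (@le_trans _ _ (t%:E * \sum_(j <- D) m (B' j))).
  rewrite lee_wpmul2l ?lee_fin ?(ltW t0)//.
  apply: (@le_trans _ _ (m (\big[setU/set0]_(j <- D) B' j))).
    by apply: le_measure => //; rewrite inE//; exact: bigsetU_measurable.
  elim: D {Ds uD tD cD FD} => [|j D IH]; first by rewrite !big_nil measure0.
  rewrite !big_cons; apply: le_trans (leeD2l _ IH).
  by apply: measureU2 => //; exact: bigsetU_measurable.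
rewrite ge0_sume_distrr//.
apply: (@le_trans _ _ (\sum_(j <- D) (K%:E * \int[m]_(x in B j) g x))).
  rewrite big_seq [leRHS]big_seq; apply: lee_sum => j /Ds.
  rewrite mem_filter => /andP[/asboolP Pj _].
  apply: (@le_trans _ _ (t%:E * (K%:E * m (B j)))).
    by rewrite lee_wpmul2l ?lee_fin ?(ltW t0).
  rewrite muleCA lee_wpmul2l ?lee_fin ?(ltW K0)//.
  have mjE : m (B j) = (fine (m (B j)))%:E by rewrite fineK// ge0_fin_numE.
  have mj0 : (0 < fine (m (B j)))%R by rewrite -lte_fin -mjE.
  by move: Pj; rewrite /P/= /average lte_pdivlMl// -mjE muleC => /ltW.
rewrite -ge0_sume_distrr; last by move=> j _; exact: integral_ge0.
rewrite lee_wpmul2l ?lee_fin ?(ltW K0)//.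
rewrite -ge0_integral_bigsetU//; last exact: measurable_funTS.
by apply: ge0_subset_integral => //; exact: bigsetU_measurable.
Qed.

(** Since g <= g 1_{g > t} + t, an average of g above 2 t forces an average above t for the
    truncation. *)
Lemma maxop_weak_type_trunc (g : T -> \bar R) (t : R) : (0 < t)%R ->
  measurable_fun setT g -> (forall x, 0 <= g x) ->
  t%:E * m [set x | (2 * t)%:E < maxop g x]
    <= K%:E * \int[m]_x (g x * (\1_[set x | (t%:E < g x)%E] x)%:E).
Proof.
move=> t0 mg g0.
have mgt : measurable [set x | t%:E < g x] by exact: measurable_super_level.
pose h x := g x * (\1_[set x | (t%:E < g x)%E] x)%:E.
have h0 x : 0 <= h x by rewrite mule_ge0.
have mh : measurable_fun setT h.
  by apply: emeasurable_funM => //; apply/measurable_EFinP; exact: measurable_indic.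
apply: le_trans (maxop_weak_type t0 mh h0).
rewrite lee_wpmul2l ?lee_fin ?(ltW t0)//.
rewrite !maxop_level ?lee_fin ?mulr_ge0 ?(ltW t0)//.
apply: le_measure; rewrite ?inE; try exact: bigcup_measurable.
move=> x [i /= ti Bx]; exists i => //=.
have mjE : m (B i) = (fine (m (B i)))%:E by rewrite fineK// ge0_fin_numE.
have mj0 : (0 < fine (m (B i)))%R by rewrite -lte_fin -mjE.
move: ti; rewrite /average !lte_pdivlMl// => ti.
have : \int[m]_(x in B i) g x <= \int[m]_(x in B i) (h x + t%:E).
  apply: ge0_le_integral => //.
  - exact: measurable_funTS.
  - by apply: emeasurable_funD => //; exact: measurable_funTS.
  - move=> y _; rewrite /h indicE; case: (boolP (y \in _)).
      by rewrite mule1 leeDl// lee_fin ltW.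
    by move=> /negP; rewrite inE/= => /negP; rewrite -leNgt mule0 add0e.
rewrite ge0_integralD//; last 2 first.
- exact: measurable_funTS.
- by move=> y _; rewrite lee_fin ltW.
rewrite integral_cst//= => H; have := lt_le_trans ti H.
rewrite mjE -!EFinM.
have [->|fin] := eqVneq (\int[m]_(x in B i) h x) +oo; first by move=> _; rewrite ltry.
have hE : \int[m]_(x in B i) h x = (fine (\int[m]_(x in B i) h x))%:E.
  by rewrite fineK// ge0_fin_numE ?ltey//; apply: integral_ge0.
by rewrite hE -EFinD !lte_fin; lra.
Qed.

(** Marcinkiewicz interpolation in discrete form: the truncated weak type estimates are weighted by
    t_k^(q-1) and summed over dyadic levels. At each point the sum is a layer cake of exponent q - 1
    multiplied by g, that is g^q up to a constant. *)
Theorem maxop_strong_type (q : R) : (1 < q)%R -> exists2 C : R, (0 < C)%R &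
  forall g : T -> \bar R, measurable_fun setT g -> (forall x, 0 <= g x) ->
  \int[m]_x (maxop g x `^ q) <= C%:E * \int[m]_x (g x `^ q).
Proof.
move=> q1.
have q10 : (0 < q - 1)%R by rewrite subr_gt0.
have q0 : (0 < q)%R by rewrite (lt_trans _ q1).
have r1 : (1 < 2 :> R)%R by rewrite ltr1n.
have L0 : (0 < (1 - (2 `^ (q - 1))^-1)^-1 :> R)%R.
  rewrite invr_gt0 subr_gt0 invf_lt1 ?powR_gt0//.
  by rewrite powR_gt1.
pose C : R := (4 `^ q * K * (1 - (2 `^ (q - 1))^-1)^-1)%R.
exists C; first by rewrite !mulr_gt0// powR_gt0.
move=> g mg g0.
apply: (@integral_poweR_le_level R q 2 q0 r1 _ _ m (maxop g) (measurable_maxop g0)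
  (fun x => maxop_ge0 x g0) _ 0) => s s0.
rewrite mul0r adde0.
(* Half the level s 2^k, because the truncated estimate concerns the level 2 t. Then s 2^(k+1) = 4
   t_k, whence the factor 4^q in the constant. *)
pose t k : R := (s / 2 * 2 ^+ k)%R.
have t0 k : (0 < t k)%R by rewrite mulr_gt0 ?divr_gt0 ?exprn_gt0.
have ct0 k : (0 <= 4 `^ q * t k `^ (q - 1))%R by rewrite mulr_ge0 ?powR_ge0.
apply: (@le_trans _ _ (\sum_(0 <= k <oo) ((4 `^ q * t k `^ (q - 1))%:E *
   (K%:E * \int[m]_x (g x * (\1_[set x | ((t k)%:E < g x)%E] x)%:E))))).
  apply: lee_nneseries => [k _ _|k _].
    by rewrite mule_ge0 ?lee_fin ?powR_ge0.
  have -> : (s * 2 ^+ k = 2 * t k)%R by rewrite /t; field.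
  have -> : ((s * 2 ^+ k.+1) `^ q = 4 `^ q * t k `^ (q - 1) * t k)%R.
    rewrite -mulrA (mulrC (t k `^ (q - 1))%R) mulr_powRB1 ?(ltW (t0 k))//.
    by rewrite -powRM ?(ltW (t0 k))//; congr (powR _ _); rewrite /t exprS; field.
  rewrite EFinM -muleA lee_wpmul2l ?lee_fin//.
  exact: maxop_weak_type_trunc.
have mi k : measurable_fun setT (fun x => g x * (\1_[set x | ((t k)%:E < g x)%E] x)%:E).
  apply: emeasurable_funM => //; apply/measurable_EFinP.
  by apply: measurable_indic; exact: measurable_super_level.
rewrite (eq_eseriesr (g := fun k => \int[m]_x ((4 `^ q * K)%:E * ((t k `^ (q - 1))%:E *
   (g x * (\1_[set x | ((t k)%:E < g x)%E] x)%:E)))%E)); last first.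
  move=> k _; rewrite ge0_integralZl_EFin//; last 3 first.
  - by move=> x _; rewrite mule_ge0 ?lee_fin ?powR_ge0// mule_ge0.
  - by apply: measurable_funeM.
  - by rewrite mulr_ge0 ?powR_ge0// ltW.
  rewrite ge0_integralZl_EFin ?powR_ge0//; last by move=> x _; rewrite mule_ge0.
  rewrite !EFinM -!muleA; congr (_ * _); exact: muleCA.
rewrite -integral_nneseries//; last 2 first.
- by move=> k; do 2 apply: measurable_funeM.
- move=> k x _; rewrite mule_ge0 ?lee_fin ?mulr_ge0 ?powR_ge0 ?(ltW K0)//.
  by rewrite mule_ge0 ?lee_fin ?powR_ge0// mule_ge0.
rewrite -ge0_integralZl_EFin//; last 3 first.
- by move=> x _; exact: poweR_ge0.
- exact: measurable_poweR_fun.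
- by rewrite ltW// !mulr_gt0// powR_gt0.
apply: ge0_le_integral => //.
- move=> x _; apply: nneseries_ge0 => k _ _.
  rewrite mule_ge0 ?lee_fin ?mulr_ge0 ?powR_ge0 ?(ltW K0)//.
  by rewrite mule_ge0 ?lee_fin ?powR_ge0// mule_ge0.
- apply: measurable_nneseries => k.
    move=> x _; rewrite mule_ge0 ?lee_fin ?mulr_ge0 ?powR_ge0 ?(ltW K0)//.
    by rewrite mule_ge0 ?lee_fin ?powR_ge0// mule_ge0.
  by do 2 apply: measurable_funeM.
- by apply: measurable_funeM; exact: measurable_poweR_fun.
- move=> x _; rewrite nneseriesZl; last first.
    by move=> k _; rewrite mule_ge0 ?lee_fin ?powR_ge0// mule_ge0.
  rewrite /C (EFinM (4 `^ q * K)%R) -muleA lee_wpmul2l ?lee_fin ?mulr_ge0 ?powR_ge0 ?(ltW K0)//.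
  under eq_eseriesr => k _ do rewrite muleCA.
  have gq : g x * g x `^ (q - 1) = g x `^ q.
    have := g0 x; case: (g x) => [y| |//]; last first.
      by rewrite !poweRyr ?gt_eqF// mulyy.
    by rewrite lee_fin => y0; rewrite !poweR_EFin -EFinM mulr_powRB1.
  have [gy|gfin] := eqVneq (g x) +oo.
    by rewrite gy poweRyr ?gt_eqF// gt0_muley ?lte_fin// leey.
  have gE : g x = (fine (g x))%:E by rewrite fineK// ge0_fin_numE// ltey.
  rewrite gE nneseriesZl; last by move=> k _; rewrite mule_ge0 ?lee_fin ?powR_ge0.
  rewrite -gE -gq muleCA lee_wpmul2l//.
  have s20 : (0 < s / 2)%R by rewrite divr_gt0.
  have := @level_sum_le R (q - 1) 2 q10 r1 (s / 2) (g x) s20 (g0 x).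
  apply: le_trans; apply: lee_nneseries => [k _ _|k _].
    by rewrite mule_ge0 ?lee_fin ?powR_ge0.
  by rewrite indicE mem_setE.
Qed.

End maximal_operator.

Lemma powRV (R : realType) (a r : R) : 0 <= a -> a^-1 `^ r = (a `^ r)^-1.
Proof. by move=> a0; rewrite -powR_inv1// -powRrM mulN1r powRN. Qed.

(** Arithmetic for [weight_subset_le]: [vq] and [va] are the v-masses of Q and of A, [sq] and [sa]
    the (p-1)-th powers of their dual masses, [q] and [aa] the p-th powers of their measures. *)
Lemma weight_product_le (R : realType) (vq va sq sa aa q K : R) :
  0 <= vq -> 0 <= va -> aa <= va * sa -> sa <= sq -> vq * sq <= K * q ->
  vq * aa <= K * q * va.
Proof.
move=> vq0 va0 h1 h2 h3.
have : vq * (va * sq) <= K * q * va by rewrite mulrCA mulrC ler_wpM2r.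
by apply: le_trans; rewrite ler_wpM2l// (le_trans h1)// ler_wpM2l.
Qed.

Definition positive_fun (T : Type) (R : realType) (f : T -> R) := forall x, 0 < f x.

(** * Muckenhoupt weights *)

Section weight_pair.
Context d (T : measurableType d) (R : realType) (m : {measure set T -> \bar R}).
Local Open Scope ereal_scope.

Lemma measurable_powR_fun (f : T -> R) (r : R) :
  measurable_fun setT f -> measurable_fun setT (fun x => f x `^ r)%R.
Proof. by move=> mf; exact: (measurableT_comp (measurable_powR r)). Qed.

Lemma measurable_EFin_in (A : set T) (f : T -> R) :
  measurable_fun setT f -> measurable_fun A (fun x => (f x)%:E).
Proof. by move=> mf; apply/measurable_EFinP; exact: measurable_funTS. Qed.
Local Notation mfA := measurable_EFin_in.

Lemma integral_gt0_of_pos (A : set T) (w : T -> R) : measurable A ->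
  measurable_fun setT w -> (forall x, (0 < w x)%R) -> 0 < m A ->
  0 < \int[m]_(x in A) (w x)%:E.
Proof.
move=> mA mw w0 A0; rewrite lt0e integral_ge0 ?andbT//; last first.
  by move=> x _; rewrite lee_fin ltW.
apply/eqP => I0.
have /ae_eq_integral_abs : \int[m]_(x in A) `|(w x)%:E| = 0.
  rewrite -I0; apply: eq_integral => x _.
  by rewrite gee0_abs// lee_fin ltW.
case=> //; first by apply/measurable_EFinP; exact: measurable_funTS.
move=> N [mN N0 AN]; have : m A <= m N.
  apply: le_measure; rewrite ?inE// => x Ax; apply: AN => /= /(_ Ax)[].
  by apply/eqP; rewrite gt_eqF.
by rewrite N0 leNgt A0.
Qed.

Variables (p K : R) (v s : T -> R).
Hypotheses (p1 : (1 < p)%R) (K0 : (0 < K)%R).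
Hypotheses (mv : measurable_fun setT v) (ms : measurable_fun setT s).
Hypotheses (v0 : positive_fun v) (s0 : positive_fun s).
Hypothesis vs : forall x, (v x * s x `^ (p - 1) = 1)%R.

Let p0 : (0 < p)%R. Proof. exact: lt_trans p1. Qed.
Let p10 : (0 < p - 1)%R. Proof. by rewrite subr_gt0. Qed.
Local Lemma pairv_ge0 x : (0 <= v x)%R. Proof. exact: ltW (v0 x). Qed.
Local Lemma pairs_ge0 x : (0 <= s x)%R. Proof. exact: ltW (s0 x). Qed.

Local Notation V A := (\int[m]_(x in A) (v x)%:E).
Local Notation S A := (\int[m]_(x in A) (s x)%:E).

Local Lemma pairV_ge0 A : 0 <= V A.
Proof. by apply: integral_ge0 => x _; rewrite lee_fin pairv_ge0. Qed.
Local Lemma pairS_ge0 A : 0 <= S A.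
Proof. by apply: integral_ge0 => x _; rewrite lee_fin pairs_ge0. Qed.

(* Young's inequality applied to v / V A and s / S A, whose weighted geometric
   mean is constant. *)
Lemma measure_powR_le (A : set T) : measurable A -> 0 < m A -> m A < +oo ->
  V A < +oo -> S A < +oo ->
  (fine (m A) `^ p <= fine (V A) * fine (S A) `^ (p - 1))%R.
Proof.
move=> mA A0 Afin Vfin Sfin.
have VA0 := pairV_ge0 A; have SA0 := pairS_ge0 A.
have VE : V A = (fine (V A))%:E by rewrite fineK// ge0_fin_numE.
have SE : S A = (fine (S A))%:E by rewrite fineK// ge0_fin_numE.
have AE : m A = (fine (m A))%:E by rewrite fineK// ge0_fin_numE.
have : 0 < V A by exact: integral_gt0_of_pos.
have : 0 < S A by exact: integral_gt0_of_pos.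
rewrite VE SE AE !lte_fin in A0 *.
set VV := fine (V A) in VE *; set SS := fine (S A) in SE *; set mm := fine _ in AE A0 *.
move=> S0 V0.
pose c := (VV `^ p^-1 * SS `^ ((p - 1) / p))^-1%R.
have young x : (c <= v x / VV / p + s x / SS * ((p - 1) / p))%R.
  have vx0 := pairv_ge0 x; have sx0 := pairs_ge0 x.
  have := @conjugate_powR R ((v x / VV) `^ p^-1)%R ((s x / SS) `^ ((p - 1) / p))%R p (p / (p - 1))%R.
  rewrite !powR_ge0 p0 divr_gt0// => /(_ isT isT isT isT).
  have -> : (p^-1 + (p / (p - 1))^-1 = 1)%R by field; rewrite !gt_eqF.
  move=> /(_ erefl); rewrite -!powRrM mulVf ?gt_eqF// powRr1 ?divr_ge0 ?(ltW V0)//.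
  have -> : ((p - 1) / p * (p / (p - 1)) = 1)%R by field; rewrite !gt_eqF.
  rewrite powRr1 ?divr_ge0 ?(ltW S0)// invf_div.
  apply: le_trans; rewrite le_eqVlt; apply/orP; left; apply/eqP.
  rewrite !powRM ?invr_ge0 ?(ltW V0) ?(ltW S0)//.
  rewrite !powRV ?(ltW V0) ?(ltW S0)// mulrACA -invfM -/c.
  rewrite mulrC (powRrM (s x)) -powRM ?powR_ge0//.
  by rewrite vs powR1 mulr1.
have c0 : (0 < c)%R by rewrite invr_gt0 mulr_gt0// powR_gt0.
have : \int[m]_(x in A) c%:E <=
    \int[m]_(x in A) ((VV^-1 / p)%:E * (v x)%:E + (SS^-1 * ((p - 1) / p))%:E * (s x)%:E).
  apply: ge0_le_integral.
  - exact: mA.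
  - by move=> x _; rewrite lee_fin ltW.
  - exact: measurable_cst.
  - by apply: emeasurable_funD; apply: measurable_funeM; exact: mfA.
  - move=> x _; rewrite -!EFinM -EFinD lee_fin (le_trans (young x))//.
    by rewrite le_eqVlt; apply/orP; left; apply/eqP; ring.
rewrite integral_cst//= ge0_integralD; [|exact: mA| | | |]; last 4 first.
- by move=> x _; rewrite mule_ge0// lee_fin ?pairv_ge0 ?pairs_ge0// divr_ge0 ?invr_ge0 ?(ltW V0) ?(ltW p0).
- by apply: measurable_funeM; exact: mfA.
- by move=> x _; rewrite mule_ge0// lee_fin ?pairv_ge0 ?pairs_ge0// mulr_ge0 ?divr_ge0 ?invr_ge0 ?(ltW S0) ?(ltW p0) ?(ltW p10).
- by apply: measurable_funeM; exact: mfA.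
rewrite !ge0_integralZl_EFin; [|exact: mA| | | |exact: mA| | |]; last 6 first.
- by move=> x _; rewrite lee_fin ?pairv_ge0 ?pairs_ge0.
- exact: mfA.
- by rewrite mulr_ge0 ?divr_ge0 ?invr_ge0 ?(ltW S0) ?(ltW p0) ?(ltW p10).
- by move=> x _; rewrite lee_fin ?pairv_ge0 ?pairs_ge0.
- exact: mfA.
- by rewrite divr_ge0 ?invr_ge0 ?(ltW V0) ?(ltW p0).
rewrite VE SE AE -!EFinM -EFinD lee_fin.
have -> : (VV^-1 / p * VV + SS^-1 * ((p - 1) / p) * SS = 1)%R.
  by field; rewrite !gt_eqF.
rewrite -ler_pdivlMl// mulr1 /c invrK => cm.
have : (mm `^ p <= (VV `^ p^-1 * SS `^ ((p - 1) / p)) `^ p)%R.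
  by rewrite ge0_ler_powR ?nnegrE ?(ltW p0) ?(ltW A0)// mulr_ge0 ?powR_ge0.
rewrite powRM ?powR_ge0// -!powRrM mulVf ?gt_eqF// powRr1 ?(ltW V0)//.
by rewrite divfK ?gt_eqF.
Qed.

Variable Q : set T.
Hypotheses (mQ : measurable Q) (Qfin : m Q < +oo) (VQ : V Q < +oo) (SQ : S Q < +oo).
Hypothesis KQ :
  (fine (V Q) * fine (S Q) `^ (p - 1) <= K * fine (m Q) `^ p)%R.

(** The A_infinity property: multiply |A|^p <= v(A) s(A)^(p-1) by v(Q), then use s(A) <= s(Q) and
    the A_p bound on Q. *)
Lemma weight_subset_le (A : set T) : measurable A -> A `<=` Q ->
  (fine (V Q) * fine (m A) `^ p <= K * fine (m Q) `^ p * fine (V A))%R.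
Proof.
move=> mA AQ.
have VA0 := pairV_ge0 A; have SA0 := pairS_ge0 A.
have VQ0 := pairV_ge0 Q; have SQ0 := pairS_ge0 Q.
have VAQ : V A <= V Q.
  by apply: ge0_subset_integral => // [|x _]; [exact: mfA|rewrite lee_fin ltW].
have SAQ : S A <= S Q.
  by apply: ge0_subset_integral => // [|x _]; [exact: mfA|rewrite lee_fin ltW].
have VA : V A < +oo by exact: le_lt_trans VQ.
have SA : S A < +oo by exact: le_lt_trans SQ.
have [A0|A0] := ltP 0 (m A); last first.
  have -> : m A = 0 by apply/le_anti; rewrite A0 measure_ge0.
  rewrite powR0 ?gt_eqF// mulr0 mulr_ge0 ?fine_ge0//.
  by rewrite mulr_ge0 ?powR_ge0// ltW.
have Afin : m A < +oo.
  by apply: le_lt_trans Qfin; apply: le_measure; rewrite ?inE.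
have h1 := measure_powR_le mA A0 Afin VA SA.
have h3 : (fine (S A) `^ (p - 1) <= fine (S Q) `^ (p - 1))%R.
  apply: ge0_ler_powR; rewrite ?nnegrE.
  - exact: ltW.
  - exact: fine_ge0.
  - exact: fine_ge0.
  - by apply: fine_le; rewrite ?ge0_fin_numE.
have h4 : (0 <= fine (V Q))%R by exact: fine_ge0.
have h5 : (0 <= fine (V A))%R by exact: fine_ge0.
exact: weight_product_le h4 h5 h1 h3 KQ.
Qed.

(** Apply the preceding bound to the complement of A, which fills at least half of Q: a fixed
    proportion of v(Q) lies outside A. *)
Lemma weight_half_le (A : set T) : 0 < m Q -> measurable A -> A `<=` Q ->
  m A <= (2^-1)%:E * m Q ->
  (fine (V A) <= (1 - (2^-1) `^ p / K) * fine (V Q))%R.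
Proof.
move=> Q0 mA AQ Ahalf.
have VA0 := pairV_ge0 A; have VQ0 := pairV_ge0 Q.
have VD0 := pairV_ge0 (Q `\` A).
have mD : measurable (Q `\` A) by exact: measurableD.
have VE : V Q = V A + V (Q `\` A).
  rewrite -ge0_integral_setU//.
  - by rewrite setDUK.
  - exact: mfA.
  - by move=> x _; rewrite lee_fin ltW.
  - by apply/disj_setPS; rewrite setDIK.
have VA : V A < +oo by apply: le_lt_trans VQ; rewrite VE leeDl.
have VD : V (Q `\` A) < +oo by apply: le_lt_trans VQ; rewrite VE leeDr.
have QE : m Q = (fine (m Q))%:E by rewrite fineK// ge0_fin_numE.
have Afin : m A \is a fin_num.
  by rewrite ge0_fin_numE// (le_lt_trans Ahalf)// QE -EFinM ltry.
have AE : m A = (fine (m A))%:E by rewrite fineK.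
have muD : (2^-1 * fine (m Q) <= fine (m (Q `\` A)))%R.
  have -> : m (Q `\` A) = m Q - m A.
    by rewrite measureD// (_ : Q `&` A = A)//; exact/setIidPr.
  rewrite AE QE -EFinB /=.
  by move: Ahalf; rewrite AE QE -EFinM lee_fin; lra.
have := weight_subset_le mD (@subDsetl _ Q A).
have -> : fine (V Q) = (fine (V A) + fine (V (Q `\` A)))%R.
  by rewrite VE fineD// ge0_fin_numE.
set x := fine (V A); set y := fine (V (Q `\` A)) => h.
have x0 : (0 <= x)%R by rewrite fine_ge0.
have y0 : (0 <= y)%R by rewrite fine_ge0.
have l0 : (0 < fine (m Q))%R by rewrite -lte_fin -QE.
have lp : (0 < fine (m Q) `^ p)%R by rewrite powR_gt0.
have : ((x + y) * (2^-1 * fine (m Q)) `^ p <= K * fine (m Q) `^ p * y)%R.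
  apply: le_trans h; rewrite ler_wpM2l ?addr_ge0//.
  by rewrite ge0_ler_powR ?nnegrE ?(ltW p0) ?fine_ge0// mulr_ge0 ?(ltW l0).
rewrite powRM ?(ltW l0)// => h'.
have h2 : ((x + y) * 2^-1 `^ p <= K * y)%R.
  rewrite -(ler_pM2r lp); move: h'.
  by rewrite mulrA (mulrAC K).
have : (2^-1 `^ p / K * (x + y) <= y)%R.
  by rewrite mulrAC ler_pdivrMr// mulrC [leRHS]mulrC.
lra.
Qed.

End weight_pair.

Section Ap_pairs.
Context (R : realType) (n : nat).
Local Notation E := (Rn R n).
Local Notation mu := (@lebesgue R n).
Local Open Scope ereal_scope.

Lemma lebesgue_hcube_gt0 (a : E) (l : R) : (0 < l)%R -> 0 < mu (hcube a l).
Proof. by move=> l0; rewrite lebesgue_hcube ?(ltW l0)// lte_fin exprn_gt0. Qed.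

Lemma lebesgue_hcube_lty (a : E) (l : R) : (0 < l)%R -> mu (hcube a l) < +oo.
Proof. by move=> l0; rewrite lebesgue_hcube ?(ltW l0)// ltry. Qed.

(* v is an A_p weight and s = v^(-1/(p-1)) its dual weight, in real form on
   half-open cubes; both are positive at every point, not only almost everywhere. *)
Record Ap_pair (p K : R) (v s : E -> R) : Prop := ApPair {
  pair_mv : measurable_fun setT v;
  pair_ms : measurable_fun setT s;
  pair_v0 : positive_fun v;
  pair_s0 : positive_fun s;
  pair_dual : forall x, (v x * s x `^ (p - 1) = 1)%R;
  pair_vfin : forall a l, \int[mu]_(x in hcube a l) (v x)%:E < +oo;
  pair_sfin : forall a l, \int[mu]_(x in hcube a l) (s x)%:E < +oo;
  pair_le : forall a l, (0 < l)%R ->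
    (fine (\int[mu]_(x in hcube a l) (v x)%:E)
     * fine (\int[mu]_(x in hcube a l) (s x)%:E) `^ (p - 1)
     <= K * (l ^+ n.+1) `^ p)%R }.

Lemma pair_v_ge0 (p K : R) v s : Ap_pair p K v s -> forall x, (0 <= v x)%R.
Proof. by move=> vs x; exact: ltW (pair_v0 vs x). Qed.

Lemma integral_positive_ge0 (v : E -> R) (A : set E) : positive_fun v ->
  0 <= \int[mu]_(x in A) (v x)%:E.
Proof. by move=> v0; apply: integral_ge0 => x _; rewrite lee_fin ltW. Qed.

(** With p' = p / (p - 1) one has p' - 1 = 1 / (p - 1), and the dual inequality is the A_p
    inequality raised to this power. *)
Lemma Ap_pair_swap (p K : R) v s : (1 < p)%R -> (0 <= K)%R -> Ap_pair p K v s ->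
  Ap_pair (p / (p - 1)) (K `^ (p - 1)^-1) s v.
Proof.
move=> p1 K0 vs.
have p10 : (0 < p - 1)%R by rewrite subr_gt0.
have p'1 : (p / (p - 1) - 1 = (p - 1)^-1)%R by field; rewrite gt_eqF.
split.
- exact: pair_ms vs.
- exact: pair_mv vs.
- exact: pair_s0 vs.
- exact: pair_v0 vs.
- move=> x; rewrite p'1.
  have sx0 := pair_s0 vs x; have dual := pair_dual vs x.
  have sp0 : (0 < s x `^ (p - 1))%R by exact: powR_gt0.
  have -> : v x = (s x `^ (p - 1))^-1%R.
    by apply: (mulIf (lt0r_neq0 sp0)); rewrite dual mulVf// gt_eqF.
  rewrite powRV ?(ltW sp0)// -powRrM mulfV ?gt_eqF// powRr1 ?(ltW sx0)//.
  by rewrite mulfV// gt_eqF.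
- exact: pair_sfin vs.
- exact: pair_vfin vs.
- move=> a l l0; rewrite p'1 mulrC.
  have := pair_le vs a l0.
  have VV0 : (0 <= fine (\int[mu]_(x in hcube a l) (v x)%:E))%R.
    by apply: fine_ge0; apply: integral_positive_ge0; exact: pair_v0 vs.
  have SS0 : (0 <= fine (\int[mu]_(x in hcube a l) (s x)%:E))%R.
    by apply: fine_ge0; apply: integral_positive_ge0; exact: pair_s0 vs.
  move: VV0 SS0; move: (fine _) => VV; move: (fine _) => SS VV0 SS0.
  move=> /(@ge0_ler_powR R (p - 1)^-1).
  rewrite ?invr_ge0 !nnegrE => /(_ (ltW p10) _ _).
  have -> : ((VV * SS `^ (p - 1)) `^ (p - 1)^-1 = VV `^ (p - 1)^-1 * SS)%R.
    by rewrite powRM ?powR_ge0// -powRrM mulfV ?gt_eqF// powRr1.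
  have l0' : (0 <= l ^+ n.+1)%R by rewrite exprn_ge0// ltW.
  have -> : ((K * (l ^+ n.+1) `^ p) `^ (p - 1)^-1 =
      K `^ (p - 1)^-1 * (l ^+ n.+1) `^ (p / (p - 1)))%R.
    by rewrite powRM ?powR_ge0// -powRrM.
  by apply; rewrite mulr_ge0 ?powR_ge0.
Qed.

Lemma pair_subset_le (p K : R) v s a l (A : set E) :
  (1 < p)%R -> (0 < K)%R -> Ap_pair p K v s ->
  (0 < l)%R -> measurable A -> A `<=` hcube a l ->
  (fine (\int[mu]_(x in hcube a l) (v x)%:E) * fine (mu A) `^ p
   <= K * (l ^+ n.+1) `^ p * fine (\int[mu]_(x in A) (v x)%:E))%R.
Proof.
move=> p1 K0 vs l0 mA Al.
have muQ : mu (hcube a l) = (l ^+ n.+1)%:E by exact: lebesgue_hcube (ltW l0).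
have Qfin : mu (hcube a l) < +oo by exact: lebesgue_hcube_lty.
have KQ : (fine (\int[mu]_(x in hcube a l) (v x)%:E)
     * fine (\int[mu]_(x in hcube a l) (s x)%:E) `^ (p - 1)
     <= K * fine (mu (hcube a l)) `^ p)%R by rewrite muQ; exact: pair_le vs a l l0.
rewrite -[(l ^+ n.+1)%R]/(fine (l ^+ n.+1)%:E) -muQ.
exact: (@weight_subset_le _ E R mu p K v s p1 K0 (pair_mv vs) (pair_ms vs)
  (pair_v0 vs) (pair_s0 vs) (pair_dual vs) (hcube a l) (measurable_hcube a l)
  Qfin (pair_vfin vs a l) (pair_sfin vs a l) KQ).
Qed.

Lemma pair_half_le (p K : R) v s a l (A : set E) :
  (1 < p)%R -> (0 < K)%R -> Ap_pair p K v s ->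
  (0 < l)%R -> measurable A -> A `<=` hcube a l ->
  mu A <= (2^-1)%:E * mu (hcube a l) ->
  (fine (\int[mu]_(x in A) (v x)%:E)
    <= (1 - (2^-1) `^ p / K) * fine (\int[mu]_(x in hcube a l) (v x)%:E))%R.
Proof.
move=> p1 K0 vs l0 mA Al Ah.
have muQ : mu (hcube a l) = (l ^+ n.+1)%:E by exact: lebesgue_hcube (ltW l0).
have Qfin : mu (hcube a l) < +oo by exact: lebesgue_hcube_lty.
have KQ : (fine (\int[mu]_(x in hcube a l) (v x)%:E)
     * fine (\int[mu]_(x in hcube a l) (s x)%:E) `^ (p - 1)
     <= K * fine (mu (hcube a l)) `^ p)%R by rewrite muQ; exact: pair_le vs a l l0.
have Q0 : 0 < mu (hcube a l) by exact: lebesgue_hcube_gt0.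
exact: (@weight_half_le _ E R mu p K v s p1 K0 (pair_mv vs) (pair_ms vs)
  (pair_v0 vs) (pair_s0 vs) (pair_dual vs) (hcube a l) (measurable_hcube a l)
  Qfin (pair_vfin vs a l) (pair_sfin vs a l) KQ).
Qed.

Lemma pair_doubling (p K : R) v s (a a' : E) (l l' : R) :
  (1 < p)%R -> (0 < K)%R -> Ap_pair p K v s -> (0 < l)%R -> (0 < l')%R ->
  hcube a l `<=` hcube a' l' ->
  (fine (\int[mu]_(x in hcube a' l') (v x)%:E)
   <= K * ((l' / l) ^+ n.+1) `^ p * fine (\int[mu]_(x in hcube a l) (v x)%:E))%R.
Proof.
move=> p1 K0 vs l0 l'0 sub.
have := pair_subset_le p1 K0 vs l'0 (measurable_hcube a l) sub.
rewrite (lebesgue_hcube _ (ltW l0)) /=.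
move: (fine _) => W'; move: (fine _) => W h.
have lp : (0 < (l ^+ n.+1) `^ p)%R by rewrite powR_gt0 ?exprn_gt0.
rewrite -(ler_pM2r lp) (le_trans h)// le_eqVlt; apply/orP; left; apply/eqP.
have -> : ((l' ^+ n.+1) `^ p = ((l' / l) ^+ n.+1) `^ p * (l ^+ n.+1) `^ p)%R.
  rewrite -powRM; last 2 first.
    by rewrite exprn_ge0 ?divr_ge0 ?(ltW l0) ?(ltW l'0).
    by rewrite exprn_ge0 ?(ltW l0).
  by rewrite -exprMn divfK ?gt_eqF.
by ring.
Qed.

Lemma pair_hcube_gt0 (p K : R) v s (a : E) (l : R) : Ap_pair p K v s -> (0 < l)%R ->
  (0 < fine (\int[mu]_(x in hcube a l) (v x)%:E))%R.
Proof.
move=> vs l0; apply: fine_gt0; rewrite (pair_vfin vs) andbT.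
apply: integral_gt0_of_pos.
- exact: measurable_hcube.
- exact: pair_mv vs.
- exact: pair_v0 vs.
- exact: lebesgue_hcube_gt0.
Qed.

End Ap_pairs.

Lemma measurable_inv_positive d (T : measurableType d) (R : realType) (f : T -> R) :
  measurable_fun setT f -> positive_fun f -> measurable_fun setT (fun x => (f x)^-1).
Proof.
move=> mf f0; rewrite (_ : (fun x => _) = (fun x => f x `^ (-1))).
  exact: measurable_powR_fun.
by apply/funext => x; rewrite powR_inv1// ltW.
Qed.

Section muckenhoupt.
Context d (T : measurableType d) (R : realType) (m : {measure set T -> \bar R}).
Variables (B B' : nat -> set T) (rad : nat -> R) (p K D : R) (v s : T -> R).
Hypotheses (mB : forall i, measurable (B i)) (mB' : forall i, measurable (B' i)).
Hypothesis (m_gt0 : forall i, (0 < m (B i))%E).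
Hypothesis (m_fin : forall i, (m (B i) < +oo)%E).
Hypothesis engulf : forall i j, B i `&` B j !=set0 -> rad i <= rad j -> B i `<=` B' j.
Hypotheses (p1 : 1 < p) (K0 : 0 < K) (D0 : 0 < D).
Hypotheses (mv : measurable_fun setT v) (ms : measurable_fun setT s).
Hypotheses (v0 : positive_fun v) (s0 : positive_fun s).
Hypothesis vs : forall x, v x * s x `^ (p - 1) = 1.
Local Open Scope ereal_scope.

Local Lemma mk_v_ge0 x : (0 <= v x)%R. Proof. exact: ltW (v0 x). Qed.
Local Lemma mk_s_ge0 x : (0 <= s x)%R. Proof. exact: ltW (s0 x). Qed.
Local Notation nu := (density_of m mv mk_v_ge0).
Local Notation sg := (density_of m ms mk_s_ge0).

Hypotheses (VB : forall i, nu (B i) < +oo) (SB : forall i, sg (B i) < +oo).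
Hypothesis KB : forall i,
  (fine (nu (B i)) * fine (sg (B i)) `^ (p - 1) <= K * fine (m (B i)) `^ p)%R.
Hypothesis nu_doubling : forall i, nu (B' i) <= D%:E * nu (B i).
Hypothesis sg_doubling : forall i, sg (B' i) <= D%:E * sg (B i).

Local Lemma mk_p10 : (0 < p - 1)%R. Proof. by rewrite subr_gt0. Qed.
Local Lemma mk_p0 : (0 < p)%R. Proof. exact: lt_trans p1. Qed.

Local Lemma mk_nu_gt0 i : 0 < nu (B i).
Proof. exact: integral_gt0_of_pos. Qed.
Local Lemma mk_sg_gt0 i : 0 < sg (B i).
Proof. exact: integral_gt0_of_pos. Qed.

Section pointwise.
Variable g : T -> \bar R.
Hypotheses (mg : measurable_fun setT g) (g0 : forall x, 0 <= g x).

Let h x := g x * ((s x)^-1)%:E.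
Let H x := maxop sg B h x `^ (p - 1) * ((v x)^-1)%:E.

Local Lemma mk_h_ge0 x : 0 <= h x.
Proof. by rewrite mule_ge0 ?g0// lee_fin invr_ge0 mk_s_ge0. Qed.

Local Lemma mk_mh : measurable_fun setT h.
Proof.
apply: emeasurable_funM; first exact: mg.
by apply/measurable_EFinP; exact: measurable_inv_positive.
Qed.

Local Lemma mk_H_ge0 x : 0 <= H x.
Proof. by rewrite mule_ge0 ?poweR_ge0// lee_fin invr_ge0 mk_v_ge0. Qed.

Local Lemma mk_mM : measurable_fun setT (maxop sg B h).
Proof. apply: measurable_maxop; [exact: mB|exact: mk_h_ge0]. Qed.

Local Lemma mk_mH : measurable_fun setT H.
Proof.
apply: emeasurable_funM.
  by apply: measurable_poweR_fun; exact: mk_mM.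
by apply/measurable_EFinP; exact: measurable_inv_positive.
Qed.

(** With h = g / s, the average of g over B is s(B) / m(B) times the s-average of h, which is at
    most the s-maximal function of h at every point of B. The A_p bound turns s(B)^(p-1) into K
    m(B)^p / v(B), and what remains is a v-average of H. *)
Local Lemma mk_average i x : B i x ->
  average m g (B i) `^ (p - 1) <= K%:E * maxop nu B H x.
Proof.
move=> Bx; pose u := average sg h (B i).
have VE : nu (B i) = (fine (nu (B i)))%:E by rewrite fineK// ge0_fin_numE.
have SE : sg (B i) = (fine (sg (B i)))%:E by rewrite fineK// ge0_fin_numE.
have ME : m (B i) = (fine (m (B i)))%:E by rewrite fineK// ge0_fin_numE.
have V0 : (0 < fine (nu (B i)))%R by rewrite -lte_fin -VE mk_nu_gt0.
have S0 : (0 < fine (sg (B i)))%R by rewrite -lte_fin -SE mk_sg_gt0.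
have M0 : (0 < fine (m (B i)))%R by rewrite -lte_fin -ME.
have KBi := KB i.
have u0 : 0 <= u by apply: average_ge0; exact: mk_h_ge0.
set VV := fine (nu (B i)) in VE V0 KBi.
set SS := fine (sg (B i)) in SE S0 KBi.
set M := fine (m (B i)) in ME M0 KBi.
have intgh : \int[m]_(x in B i) g x = \int[sg]_(x in B i) h x.
  rewrite ge0_integral_density_in.
  - apply: eq_integral => y _; rewrite /h -muleA -EFinM mulVf ?mule1//.
    by rewrite gt_eqF// s0.
  - exact: mB.
  - exact: measurable_funTS mk_mh.
  - by move=> y _; exact: mk_h_ge0.
have avgE : average m g (B i) = (SS / M)%:E * u.
  rewrite /u /average intgh -/M -/SS muleA -EFinM; congr (_%:E * _).
  by field; rewrite !gt_eqF.
have uH : u `^ (p - 1) * M%:E <= VV%:E * average nu H (B i).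
  rewrite /average -/VV muleA -EFinM mulfV ?gt_eqF// mul1e.
  rewrite ge0_integral_density_in; last 3 first.
  - exact: mB.
  - exact: measurable_funTS mk_mH.
  - by move=> y _; exact: mk_H_ge0.
  rewrite -ME -integral_cst; last exact: mB.
  apply: ge0_le_integral.
  - exact: mB.
  - by move=> y _; exact: poweR_ge0.
  - exact: measurable_cst.
  - apply: emeasurable_funM; first exact: measurable_funTS mk_mH.
    exact: measurable_EFin_in.
  - move=> y By /=; rewrite /H -muleA -EFinM mulVf ?mule1; last by rewrite gt_eqF// v0.
    by apply: lee_poweR; [exact: ltW mk_p10|exact: u0|exact: le_average_maxop].
rewrite avgE poweRM//; last by rewrite lee_fin divr_ge0 ?(ltW S0) ?(ltW M0).
rewrite poweR_EFin.
have c0 : (0 <= SS `^ (p - 1) / M `^ p)%R by rewrite divr_ge0 ?powR_ge0.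
have -> : ((SS / M) `^ (p - 1))%:E * u `^ (p - 1) =
    (SS `^ (p - 1) / M `^ p)%:E * (u `^ (p - 1) * M%:E).
  rewrite (muleC (u `^ _)) muleA -EFinM; congr (_%:E * _).
  rewrite powRM ?invr_ge0 ?(ltW S0) ?(ltW M0)// powRV ?(ltW M0)// -mulrA; congr (_ * _)%R.
  rewrite -(mulr_powRB1 (ltW M0) mk_p0).
  by field; rewrite !gt_eqF// powR_gt0.
apply: (@le_trans _ _ ((SS `^ (p - 1) / M `^ p)%:E * (VV%:E * average nu H (B i)))).
  by rewrite lee_wpmul2l// lee_fin.
rewrite muleA -EFinM.
have avg0 : 0 <= average nu H (B i) by apply: average_ge0; exact: mk_H_ge0.
apply: (@le_trans _ _ (K%:E * average nu H (B i))).
  rewrite lee_wpmul2r// lee_fin mulrAC ler_pdivrMr ?powR_gt0//.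
  by rewrite mulrC.
rewrite lee_wpmul2l ?lee_fin ?(ltW K0)//.
exact: le_average_maxop.
Qed.

Local Lemma mk_maxop x : maxop m B g x `^ p <=
  (K `^ (p / (p - 1)))%:E * maxop nu B H x `^ (p / (p - 1)).
Proof.
have p10 := mk_p10; have p0 := mk_p0.
have MH0 : 0 <= maxop nu B H x by apply: maxop_ge0; exact: mk_H_ge0.
have KM0 : 0 <= K%:E * maxop nu B H x by rewrite mule_ge0// lee_fin ltW.
have Mg0 : 0 <= maxop m B g x by apply: maxop_ge0.
have le1 : maxop m B g x <= (K%:E * maxop nu B H x) `^ (p - 1)^-1.
  apply: ge_ereal_sup => _ [i _ <-]; rewrite indicE.
  case: (boolP (x \in B i)) => [|_]; last by rewrite mul0e poweR_ge0.
  rewrite inE mul1e => Bx.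
  have avg0 : 0 <= average m g (B i) by exact: average_ge0.
  have -> : average m g (B i) = (average m g (B i) `^ (p - 1)) `^ (p - 1)^-1.
    by rewrite -poweRrM mulfV ?gt_eqF// poweRe1.
  apply: lee_poweR.
  - by rewrite invr_ge0 ltW.
  - exact: poweR_ge0.
  - exact: mk_average.
rewrite -poweR_EFin -poweRM ?lee_fin ?(ltW K0)//.
rewrite (_ : (p / (p - 1) = (p - 1)^-1 * p)%R); last by rewrite mulrC.
by rewrite poweRrM; apply: lee_poweR => //; exact: ltW.
Qed.

(** With p' = p / (p - 1), this identity and the next are v^(1-p') = s and s^(1-p) = v. They turn
    the L^p'(v) norm of H into an L^p(s) norm, and the L^p(s) norm of h into the L^p(v) norm of
    g. *)
Local Lemma mk_H_power x :
  H x `^ (p / (p - 1)) * (v x)%:E = maxop sg B h x `^ p * (s x)%:E.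
Proof.
have p10 := mk_p10; have p0 := mk_p0.
have vx0 := v0 x; have sx0 := s0 x; have dual := vs x.
rewrite /H poweRM ?poweR_ge0 ?lee_fin ?invr_ge0 ?(ltW vx0)//.
rewrite -poweRrM (_ : (p - 1) * (p / (p - 1)) = p)%R; last by field; rewrite gt_eqF.
rewrite -muleA poweR_EFin -EFinM; congr (_ * _%:E).
have vE : v x = (s x `^ (p - 1))^-1%R.
  by apply: (mulIf (lt0r_neq0 (powR_gt0 (p - 1) sx0))); rewrite dual mulVf// gt_eqF// powR_gt0.
rewrite vE invrK -powRrM (_ : (p - 1) * (p / (p - 1)) = p)%R; last first.
  by field; rewrite gt_eqF.
rewrite -(mulr_powRB1 (ltW sx0) p0) -mulrA mulfV ?mulr1// gt_eqF// powR_gt0//.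
Qed.

Local Lemma mk_h_power x : h x `^ p * (s x)%:E = g x `^ p * (v x)%:E.
Proof.
have p10 := mk_p10; have p0 := mk_p0.
have vx0 := v0 x; have sx0 := s0 x; have dual := vs x; have gx0 := g0 x.
rewrite /h poweRM ?lee_fin ?invr_ge0 ?(ltW sx0)//.
rewrite -muleA poweR_EFin -EFinM; congr (_ * _%:E).
have -> : v x = (s x `^ (p - 1))^-1%R.
  by apply: (mulIf (lt0r_neq0 (powR_gt0 (p - 1) sx0))); rewrite dual mulVf// gt_eqF// powR_gt0.
rewrite powRV ?(ltW sx0)// -(mulr_powRB1 (ltW sx0) p0) invfM mulrAC mulVf ?mul1r//.
by rewrite gt_eqF.
Qed.

End pointwise.

(* Lerner's proof: [M g] is pointwise controlled by the composition of the two
   weighted maximal operators, each bounded on its own space with no condition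
   on the weight beyond doubling. *)
Theorem muckenhoupt : exists2 C : R, (0 < C)%R & forall g : T -> \bar R,
  measurable_fun setT g -> (forall x, 0 <= g x) ->
  \int[m]_x (maxop m B g x `^ p * (v x)%:E) <= C%:E * \int[m]_x (g x `^ p * (v x)%:E).
Proof.
have p10 := mk_p10; have p0 := mk_p0.
have p'1 : (1 < p / (p - 1))%R by rewrite ltr_pdivlMr// mul1r; lra.
have [C1 C10 H1] := @maxop_strong_type _ T R nu B B' rad D mB mB' mk_nu_gt0 VB engulf D0
  nu_doubling (p / (p - 1)) p'1.
have [C2 C20 H2] := @maxop_strong_type _ T R sg B B' rad D mB mB' mk_sg_gt0 SB engulf D0
  sg_doubling p p1.
exists (K `^ (p / (p - 1)) * C1 * C2)%R; first by rewrite !mulr_gt0 ?powR_gt0.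
move=> g mg g0.
pose h x := g x * ((s x)^-1)%:E.
pose H x := maxop sg B h x `^ (p - 1) * ((v x)^-1)%:E.
have mM : measurable_fun setT (maxop m B g) by apply: measurable_maxop; [exact: mB|exact: g0].
have mh : measurable_fun setT h by exact: mk_mh.
have h0 : forall x, 0 <= h x by exact: mk_h_ge0.
have mH : measurable_fun setT H by exact: mk_mH.
have H0 : forall x, 0 <= H x by move=> x; exact: mk_H_ge0.
have mMH : measurable_fun setT (maxop nu B H) by apply: measurable_maxop; [exact: mB|exact: H0].
rewrite -(ge0_integral_density m mv mk_v_ge0); last 2 first.
- by apply: measurable_poweR_fun.
- by move=> x; exact: poweR_ge0.
apply: (@le_trans _ _ (\int[nu]_x ((K `^ (p / (p - 1)))%:E * maxop nu B H x `^ (p / (p - 1))))).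
  apply: ge0_le_integral.
  - exact: measurableT.
  - by move=> x _; exact: poweR_ge0.
  - by apply: measurable_poweR_fun.
  - by apply: measurable_funeM; apply: measurable_poweR_fun.
  - by move=> x _; exact: mk_maxop.
rewrite ge0_integralZl_EFin ?powR_ge0//; last 2 first.
- by move=> x _; exact: poweR_ge0.
- by apply: measurable_poweR_fun.
rewrite -mulrA EFinM -muleA lee_wpmul2l ?lee_fin ?powR_ge0//.
apply: (le_trans (H1 H mH H0)).
rewrite EFinM -muleA lee_wpmul2l ?lee_fin ?(ltW C10)//.
rewrite ge0_integral_density; last 2 first.
- by apply: measurable_poweR_fun.
- by move=> x; exact: poweR_ge0.
rewrite (eq_integral (fun x => maxop sg B h x `^ p * (s x)%:E)); last first.
  by move=> x _; exact: mk_H_power.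
rewrite -(ge0_integral_density m ms mk_s_ge0); last 2 first.
- by apply: measurable_poweR_fun; apply: measurable_maxop; [exact: mB|exact: h0].
- by move=> x; exact: poweR_ge0.
apply: (le_trans (H2 h mh h0)).
rewrite lee_wpmul2l ?lee_fin ?(ltW C20)//.
rewrite ge0_integral_density; last 2 first.
- by apply: measurable_poweR_fun.
- by move=> x; exact: poweR_ge0.
rewrite le_eqVlt; apply/orP; left; apply/eqP; apply: eq_integral => x _.
exact: mk_h_power.
Qed.

End muckenhoupt.

(** * A countable family of cubes and the maximal theorem on R^(n+1) *)

Section rational_cubes.
Context (R : realType) (n : nat).
Local Notation E := (Rn R n).
Local Notation mu := (@lebesgue R n).

(* An enumeration of the cubes with rational data: the maximal operator over
   countably many cubes is measurable and comparable with the full one. *)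
Definition qcube (i : nat) : E * R :=
  if unpickle i is Some (a, l) then
    if (0 < l :> rat) then ((map_mx ratr (a : 'rV[rat]_n.+1) : E), ratr l) else (0, 1)
  else (0, 1).

Definition qset (i : nat) : set E := hcube (qcube i).1 (qcube i).2.

Definition qset3 (i : nat) : set E :=
  hcube (\row_j ((qcube i).1 ord0 j - (qcube i).2)) (3 * (qcube i).2).

Lemma qcube_gt0 i : 0 < (qcube i).2.
Proof.
rewrite /qcube; case: (unpickle _) => [[a l]|//=].
by case: ifP => //= l0; rewrite ltr0q.
Qed.

Lemma qset_engulf i j : qset i `&` qset j !=set0 -> (qcube i).2 <= (qcube j).2 ->
  qset i `<=` qset3 j.
Proof.
move=> [y [/hcubeP yi /hcubeP yj]] ij x /hcubeP xi; apply/hcubeP => k.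
rewrite mxE; have /andP[? ?] := yi k; have /andP[? ?] := yj k.
by have /andP[? ?] := xi k; apply/andP; split; lra.
Qed.

Lemma qset_sub3 i : qset i `<=` qset3 i.
Proof.
move=> x xi; apply: (@qset_engulf i i) => //; by exists x.
Qed.

(** A corner at most l / 2 below a and a side between 2 l and 3 l leave room on both ends. The ratio
    3 of the sides is the source of the factor [3 ^+ n.+1] in [maximal_le_maxop]. *)
Lemma exists_qset (a : E) (l : R) : 0 < l ->
  exists i, [/\ cube a l `<=` qset i, l <= (qcube i).2 & (qcube i).2 <= 3 * l].
Proof.
move=> l0.
have /choice[q qP] (k : 'I_n.+1) : exists q : rat, a ord0 k - l / 2 < ratr q < a ord0 k.
  have [|q] := @rat_in_itvoo R (a ord0 k - l / 2) (a ord0 k); first lra.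
  by rewrite in_itv/= => ?; exists q.
have [|r] := @rat_in_itvoo R (2 * l) (3 * l); first lra.
rewrite in_itv/= => /andP[r1 r2].
have r0 : 0 < r by rewrite -(ltr0q R); lra.
exists (pickle ((\row_k q k : 'rV[rat]_n.+1), r)).
have E : qcube (pickle ((\row_k q k : 'rV[rat]_n.+1), r)) =
    ((map_mx ratr (\row_k q k : 'rV[rat]_n.+1) : E), ratr r).
  by rewrite /qcube pickleK r0.
rewrite /qset E/=; split; [|lra|lra].
move=> x xa; apply/hcubeP => k; rewrite !mxE.
by have /andP[? ?] := xa k; have /andP[? ?] := qP k; apply/andP; split; lra.
Qed.

Lemma hcube_sub_cube (a : E) (l : R) : hcube a l `<=` cube a l.
Proof. by move=> x /hcubeP xa i; have /andP[/ltW -> ->] := xa i. Qed.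

Local Open Scope ereal_scope.

Theorem muckenhoupt_Rn (p K : R) (v s : E -> R) : (1 < p)%R -> (0 < K)%R ->
  Ap_pair p K v s ->
  exists2 C : R, (0 < C)%R & forall g : E -> \bar R,
  measurable_fun setT g -> (forall x, 0 <= g x) ->
  \int[mu]_x (maxop mu qset g x `^ p * (v x)%:E) <= C%:E * \int[mu]_x (g x `^ p * (v x)%:E).
Proof.
move=> p1 K0 vs.
have p10 : (0 < p - 1)%R by rewrite subr_gt0.
have K'0 : (0 < K `^ (p - 1)^-1)%R by rewrite powR_gt0.
have p'1 : (1 < p / (p - 1))%R by rewrite ltr_pdivlMr// mul1r; lra.
have sv := Ap_pair_swap p1 (ltW K0) vs.
pose D1 : R := (K * (3 ^+ n.+1) `^ p)%R.
pose D2 : R := (K `^ (p - 1)^-1 * (3 ^+ n.+1) `^ (p / (p - 1)))%R.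
have D10 : (0 < D1)%R by rewrite mulr_gt0// powR_gt0// exprn_gt0.
have D20 : (0 < D2)%R by rewrite mulr_gt0// powR_gt0// exprn_gt0.
have D0 : (0 < D1 + D2)%R by rewrite addr_gt0.
have mB i : measurable (qset i) by exact: measurable_hcube.
have mB' i : measurable (qset3 i) by exact: measurable_hcube.
have q3 i : (0 < 3 * (qcube i).2)%R by rewrite mulr_gt0 ?qcube_gt0.
have q3E i : (3 * (qcube i).2 / (qcube i).2 = 3)%R by rewrite mulfK// gt_eqF// qcube_gt0.
have dbl (w : E -> R) (D : R) : positive_fun w ->
    (forall a l, \int[mu]_(x in hcube a l) (w x)%:E < +oo) ->
    (forall i, fine (\int[mu]_(x in qset3 i) (w x)%:E) <=
       D * fine (\int[mu]_(x in qset i) (w x)%:E))%R -> (D <= D1 + D2)%R ->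
    forall i, \int[mu]_(x in qset3 i) (w x)%:E <=
       (D1 + D2)%:E * \int[mu]_(x in qset i) (w x)%:E.
  move=> w0 wfin wD DD i.
  have I3 : \int[mu]_(x in qset3 i) (w x)%:E = (fine (\int[mu]_(x in qset3 i) (w x)%:E))%:E.
    by rewrite fineK// ge0_fin_numE ?wfin// integral_positive_ge0.
  have I1 : \int[mu]_(x in qset i) (w x)%:E = (fine (\int[mu]_(x in qset i) (w x)%:E))%:E.
    by rewrite fineK// ge0_fin_numE ?wfin// integral_positive_ge0.
  rewrite I3 I1 -EFinM lee_fin (le_trans (wD i))// ler_wpM2r//.
  by rewrite fine_ge0// integral_positive_ge0.
apply: (@muckenhoupt _ E R mu qset qset3 (fun i => (qcube i).2) p K (D1 + D2)%R v s mB mB'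
  (fun i => lebesgue_hcube_gt0 _ (qcube_gt0 i))
  (fun i => lebesgue_hcube_lty _ (qcube_gt0 i))
  qset_engulf p1 K0 D0 (pair_mv vs) (pair_ms vs) (pair_v0 vs) (pair_s0 vs)
  (pair_dual vs)).
- by move=> i; exact: pair_vfin vs _ _.
- by move=> i; exact: pair_sfin vs _ _.
- move=> i.
  have -> : fine ((@lebesgue R n : {measure set E -> \bar R}) (qset i)) = ((qcube i).2 ^+ n.+1)%R.
    have := lebesgue_hcube (qcube i).1 (ltW (qcube_gt0 i)).
    by move=> /(congr1 fine).
  exact: pair_le vs (qcube i).1 (qcube i).2 (qcube_gt0 i).
- apply: (dbl v D1 (pair_v0 vs) (pair_vfin vs)).
    move=> i; have := pair_doubling p1 K0 vs (qcube_gt0 i) (q3 i) (@qset_sub3 i).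
    by rewrite q3E.
  by rewrite lerDl ltW.
- apply: (dbl s D2 (pair_s0 vs) (pair_sfin vs)).
    move=> i; have := pair_doubling p'1 K'0 sv (qcube_gt0 i) (q3 i) (@qset_sub3 i).
    by rewrite q3E.
  by rewrite lerDr ltW.
Qed.

End rational_cubes.

(** Serves to pass from the closed cubes of [Ap_const] to half-open ones; c is the measure of a
    closed cube, which is only known to be at most (2 l)^n. *)
Lemma weight_product_mono (R : realType) (V V' S S' A c l p : R) (n : nat) :
  0 <= p - 1 -> 0 <= A -> 0 <= V -> 0 <= S -> 0 <= c -> 0 <= l ->
  V <= V' -> S <= S' -> V' * S' `^ (p - 1) <= A * c `^ p -> c <= (2 * l) ^+ n ->
  V * S `^ (p - 1) <= A * (2 ^+ n) `^ p * (l ^+ n) `^ p.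
Proof.
move=> p10 A0 V0 S0 c0 l0 VV SS H cl.
apply: (@le_trans _ _ (V' * S' `^ (p - 1))).
  apply: ler_pM => //; first exact: powR_ge0.
  by apply: ge0_ler_powR => //; rewrite nnegrE// (le_trans S0).
apply: (le_trans H); rewrite -mulrA -powRM ?exprn_ge0// -exprMn.
apply: ler_wpM2l => //; apply: ge0_ler_powR; rewrite ?nnegrE//.
  by rewrite -(subrK 1 p) addr_ge0.
by rewrite exprn_ge0// mulr_ge0.
Qed.

Section Ap_weights.
Context (R : realType) (n : nat).
Local Notation E := (Rn R n).
Local Notation mu := (@lebesgue R n).

Lemma cube_compact (a : E) (l : R) : compact (cube a l).
Proof.
have := @rV_compact R n.+1 (fun i => `[a ord0 i, a ord0 i + l]%classic)
  (fun i => @segment_compact _ _ _).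
congr compact; apply/seteqP; split => x xa i; have := xa i; by rewrite /= in_itv.
Qed.

Lemma measurable_cube (a : E) (l : R) : measurable (cube a l).
Proof.
have -> : cube a l = \bigcap_(i in [set: 'I_n.+1])
    ((fun x : E => x ord0 i) @^-1` `[a ord0 i, a ord0 i + l]).
  apply/seteqP; split=> x /=; first by move=> h i _; rewrite /= in_itv/=; exact: h.
  by move=> h i; have := h i I; rewrite /= in_itv.
apply: fin_bigcap_measurable => [|i _]; first exact: finite_finset.
by rewrite -[X in measurable X]setTI; apply: measurable_coord.
Qed.

Lemma cube_sub_hcube (a : E) (l : R) : 0 < l ->
  cube a l `<=` hcube (\row_j (a ord0 j - l)) (2 * l).
Proof.
move=> l0 x xa; apply/hcubeP => k; rewrite mxE.
by have /andP[? ?] := xa k; apply/andP; split; lra.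
Qed.

Local Open Scope ereal_scope.

Lemma lebesgue_cube_bounds (a : E) (l : R) : (0 < l)%R ->
  [/\ mu (cube a l) \is a fin_num, (l ^+ n.+1 <= fine (mu (cube a l)))%R &
      (fine (mu (cube a l)) <= (2 * l) ^+ n.+1)%R].
Proof.
move=> l0.
have h1 : mu (hcube a l) <= mu (cube a l).
  apply: le_measure; rewrite ?inE; [exact: measurable_hcube|exact: measurable_cube|].
  exact: hcube_sub_cube.
have h2 : mu (cube a l) <= mu (hcube (\row_j (a ord0 j - l)%R : E) (2 * l)%R).
  apply: le_measure; rewrite ?inE; [exact: measurable_cube|exact: measurable_hcube|].
  exact: cube_sub_hcube.
rewrite !lebesgue_hcube ?mulr_ge0 ?(ltW l0)// in h1 h2.
have fin : mu (cube a l) \is a fin_num.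
  by rewrite ge0_fin_numE// (le_lt_trans h2)// ltry.
by split => //; rewrite -lee_fin fineK.
Qed.

Lemma ae_eq_integral_mul (A : set E) (v v' : E -> R) (g : E -> \bar R) :
  measurable A -> measurable_fun setT v -> measurable_fun setT v' ->
  measurable_fun setT g -> (forall x, 0 <= v x)%R -> (forall x, 0 <= v' x)%R ->
  (forall x, 0 <= g x) -> {ae mu, forall x, v x = v' x} ->
  \int[mu]_(x in A) (g x * (v x)%:E) = \int[mu]_(x in A) (g x * (v' x)%:E).
Proof.
move=> mA mv mv' mg v0 v'0 g0 vv'.
have mgv (w : E -> R) : measurable_fun setT w -> measurable_fun A (fun x => g x * (w x)%:E).
  by move=> mw; apply: emeasurable_funM; [exact: measurable_funTS|exact: measurable_EFin_in].
apply: ge0_ae_eq_integral.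
- exact: mA.
- exact: mgv.
- exact: mgv.
- by move=> x _; rewrite mule_ge0 ?g0// lee_fin v0.
- by move=> x _; rewrite mule_ge0 ?g0// lee_fin v'0.
- by apply: filterS vv' => x xE _; rewrite xE.
Qed.

(** The weight is given the value 1 on the null set where it vanishes; it and its dual are then
    positive everywhere, and no integral changes. *)
Lemma Ap_weight_pair (p : R) (v : E -> R) : (1 < p)%R -> Ap_weight p v ->
  exists v' s K, [/\ (1 <= K)%R, Ap_pair p K v' s & {ae mu, forall x, v x = v' x}].
Proof.
move=> p1 [[v0 [mv vloc]] vae Apfin].
have p10 : (0 < p - 1)%R by rewrite subr_gt0.
pose v' x := (if 0 < v x then v x else 1)%R.
pose s x := (v' x `^ (- (p - 1)^-1))%R.
have v'0 : positive_fun v' by move=> x; rewrite /v'; case: ifP.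
have s0 : positive_fun s by move=> x; rewrite powR_gt0.
have mv' : measurable_fun setT v'.
  apply: measurable_fun_ifT; [|exact: mv|exact: measurable_cst].
  by apply: measurable_fun_ltr; [exact: measurable_cst|exact: mv].
have ms : measurable_fun setT s by exact: measurable_powR_fun.
have vv' : {ae mu, forall x, v x = v' x} by apply: filterS vae => x vx; rewrite /v' vx.
pose s' x := (v x `^ (- (p - 1)^-1))%R.
have ms' : measurable_fun setT s' by exact: measurable_powR_fun.
have ss' : {ae mu, forall x, s x = s' x} by apply: filterS vv' => x vx; rewrite /s /s' vx.
have ae_int (A : set E) (f g : E -> R) : measurable A -> measurable_fun setT f ->
    measurable_fun setT g -> (forall x, 0 <= f x)%R -> (forall x, 0 <= g x)%R ->
    {ae mu, forall x, f x = g x} ->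
    \int[mu]_(x in A) (f x)%:E = \int[mu]_(x in A) (g x)%:E.
  move=> mA mf mg f0 g0 fg.
  have := ae_eq_integral_mul mA mf mg (@measurable_cst _ _ _ _ setT 1) f0 g0 (fun=> lee01) fg.
  by under eq_integral do rewrite mul1e; under [in RHS]eq_integral do rewrite mul1e.
have v'_ge0 x : (0 <= v' x)%R by exact: ltW.
have s_ge0 x : (0 <= s x)%R by exact: ltW.
have s'_ge0 x : (0 <= s' x)%R by exact: powR_ge0.
have cubeV a l : \int[mu]_(x in cube a l) (v' x)%:E < +oo.
  rewrite -(ae_int _ v)//; last exact: measurable_cube.
  have := vloc _ (cube_compact (a := a) (l := l)).
  by under eq_integral do rewrite ger0_norm//.
have mono (w : E -> R) a l : measurable_fun setT w -> (forall x, 0 <= w x)%R ->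
    \int[mu]_(x in hcube a l) (w x)%:E <= \int[mu]_(x in cube a l) (w x)%:E.
  move=> mw w0; apply: ge0_subset_integral.
  - exact: measurable_hcube.
  - exact: measurable_cube.
  - exact: measurable_EFin_in.
  - by move=> x _; rewrite lee_fin.
  - exact: hcube_sub_cube.
have Apq a l : (0 < l)%R -> emean (cube a l) v * emean (cube a l) s' `^ (p - 1) <= Ap_const p v.
  by move=> l0; apply: ereal_sup_ubound; exists (a, l).
have emeanE (w : E -> R) a l : (0 < l)%R -> emean (cube a l) w =
    ((fine (mu (cube a l)))^-1)%:E * \int[mu]_(x in cube a l) (w x)%:E by [].
have Ifin a l : (0 < l)%R ->
  [/\ \int[mu]_(x in cube a l) (s x)%:E < +oo &
    (fine (\int[mu]_(x in cube a l) (v' x)%:E) * fine (\int[mu]_(x in cube a l) (s x)%:E) `^ (p - 1)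
    <= Num.max 1 (fine (Ap_const p v)) * fine (mu (cube a l)) `^ p)%R].
  move=> l0; have [cfin c1 c2] := lebesgue_cube_bounds a l0.
  have := Apq a l l0; rewrite !emeanE//.
  rewrite (ae_int _ v v')//; last exact: measurable_cube.
  rewrite -(ae_int _ s s')//; last exact: measurable_cube.
  set c := fine (mu _) in c1 c2 *.
  have c0 : (0 < c)%R by rewrite (lt_le_trans _ c1)// exprn_gt0.
  set I := \int[mu]_(x in _) (v' x)%:E; set J := \int[mu]_(x in _) (s x)%:E.
  have I0 : 0 < I.
    apply: integral_gt0_of_pos => //; first exact: measurable_cube.
    have : 0 < mu (cube a l) by rewrite -(fineK cfin) lte_fin.
    by [].
  have IE : I = (fine I)%:E by rewrite fineK// ge0_fin_numE ?(ltW I0)// cubeV.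
  have J0 : 0 <= J by apply: integral_positive_ge0.
  have i0 : (0 < fine I)%R by rewrite -lte_fin -IE.
  (* Local integrability of the dual weight is derived here: v has positive mass on the cube, so an
     infinite dual mass would make [Ap_const] infinite. *)
  have [Joo|Jfin] := eqVneq J +oo.
    rewrite Joo gt0_muley ?lte_fin ?invr_gt0// poweRyr ?gt_eqF//.
    by rewrite IE -EFinM gt0_muley ?lte_fin ?mulr_gt0 ?invr_gt0// leye_eq => /eqP Ay; rewrite Ay ltxx in Apfin.
  have JE : J = (fine J)%:E by rewrite fineK// ge0_fin_numE// ltey.
  move=> H; split; first by rewrite ltey.
  move: H; rewrite IE JE -!EFinM => H.
  have AE : Ap_const p v = (fine (Ap_const p v))%:E.
    rewrite fineK// ge0_fin_numE//; apply: le_trans H.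
    by rewrite lee_fin mulr_ge0 ?powR_ge0// mulr_ge0 ?invr_ge0// ltW.
  move: H; rewrite AE lee_fin powRM ?invr_ge0 ?(ltW c0) ?fine_ge0// powRV ?(ltW c0)// => H.
  have cp : (0 < c `^ p)%R by rewrite powR_gt0.
  apply: (@le_trans _ _ (fine (Ap_const p v) * c `^ p)%R); last first.
    by rewrite ler_wpM2r ?(ltW cp)// le_max lexx orbT.
  rewrite -ler_pdivrMr//; apply: le_trans H; rewrite le_eqVlt; apply/orP; left; apply/eqP.
  have cp1 : (c `^ p = c * c `^ (p - 1))%R by rewrite mulr_powRB1 ?(ltW c0)// (lt_trans _ p1).
  rewrite cp1; field; rewrite !gt_eqF// powR_gt0//.
have hle0 a l (w : E -> R) : (l <= 0)%R -> \int[mu]_(x in hcube a l) (w x)%:E < +oo.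
  move=> l0; rewrite (_ : hcube a l = set0) ?integral_set0 ?ltry//.
  apply/seteqP; split => // x /hcubeP/(_ ord0)/andP[h1 h2].
  by exfalso; move: h1; rewrite ltNge (le_trans h2)// gerDl.
(* The power of 2 pays for bounding the measure of a closed cube by (2 l)^(n+1); the maximum ensures
   K >= 1. *)
pose K := (Num.max 1 (fine (Ap_const p v)) * (2 ^+ n.+1) `^ p)%R.
have K1 : (1 <= K)%R.
  rewrite -[leLHS]mulr1 ler_pM// ?le_max ?lexx//.
  by rewrite -[leLHS](powRr0 (2 ^+ n.+1)) ler_powR ?exprn_ege1 ?ler1n// ltW// (lt_trans _ p1).
exists v', s, K; split => //; split => //.
- by move=> x; rewrite /s -powRrM mulNr mulVf ?gt_eqF// powR_inv1 ?v'_ge0// mulfV// gt_eqF.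
- by move=> a l; apply: le_lt_trans (cubeV a l); exact: mono.
- move=> a l; have [l0|l0] := ltP 0%R l; last exact: hle0.
  by have [h _] := Ifin a l l0; apply: le_lt_trans h; exact: mono.
- move=> a l l0; have [Jfin IJ] := Ifin a l l0.
  have [cfin c1 c2] := lebesgue_cube_bounds a l0.
  have fineLe (w : E -> R) : measurable_fun setT w -> positive_fun w ->
      \int[mu]_(x in cube a l) (w x)%:E < +oo ->
      (fine (\int[mu]_(x in hcube a l) (w x)%:E) <= fine (\int[mu]_(x in cube a l) (w x)%:E))%R.
    move=> mw w0 wfin; have ww := mono w a l mw (fun x => ltW (w0 x)).
    by apply: fine_le => //; rewrite ge0_fin_numE ?integral_positive_ge0// (le_lt_trans ww).
  have hV := fineLe v' mv' v'0 (cubeV a l).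
  have hS := fineLe s ms s0 Jfin.
  have V0 : (0 <= fine (\int[mu]_(x in hcube a l) (v' x)%:E))%R.
    by rewrite fine_ge0// integral_positive_ge0.
  have S0 : (0 <= fine (\int[mu]_(x in hcube a l) (s x)%:E))%R.
    by rewrite fine_ge0// integral_positive_ge0.
  have A1 : (0 <= Num.max 1 (fine (Ap_const p v)))%R by rewrite le_max ler01.
  have c0 : (0 <= fine (mu (cube a l)))%R by rewrite (le_trans _ c1)// exprn_ge0// ltW.
  exact: weight_product_mono (ltW p10) A1 V0 S0 c0 (ltW l0) hV hS IJ c2.
Qed.

End Ap_weights.

(** * Sharp maximal estimates *)

Section dyadic_grid.
Context (R : realType) (n : nat).
Local Notation E := (Rn R n).
Local Notation mu := (@lebesgue R n).
Variables (a : E) (l : R).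
Hypothesis l0 : 0 < l.

Definition gside (k : nat) : R := l / 2 ^+ k.

Definition gcorner (k : nat) (z : 'rV[int]_n.+1) : E :=
  \row_i (a ord0 i + (z ord0 i)%:~R * gside k).

Definition cell (k : nat) (z : 'rV[int]_n.+1) : set E := hcube (gcorner k z) (gside k).

(** The ceiling minus 1, rather than the floor, because cells are open below and closed above. *)
Definition gidx (k : nat) (x : E) : 'rV[int]_n.+1 :=
  \row_i (Num.ceil ((x ord0 i - a ord0 i) / gside k) - 1).

Lemma gside_gt0 k : 0 < gside k.
Proof. by rewrite divr_gt0// exprn_gt0. Qed.

Lemma gsideS k : gside k = 2 * gside k.+1.
Proof. by rewrite /gside exprS; field; rewrite expf_neq0. Qed.

Lemma cellP k z x : cell k z x <->
  forall i, (z ord0 i)%:~R < (x ord0 i - a ord0 i) / gside k <= (z ord0 i)%:~R + 1.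
Proof.
have s0 := gside_gt0 k.
split=> [/hcubeP h i|h]; last apply/hcubeP => i; have := h i; rewrite !mxE.
  by rewrite ltr_pdivlMr// ler_pdivrMr// mulrDl mul1r => /andP[? ?]; apply/andP; split; lra.
by rewrite ltr_pdivlMr// ler_pdivrMr// mulrDl mul1r => /andP[? ?]; apply/andP; split; lra.
Qed.

Lemma cell_gidx k x : cell k (gidx k x) x.
Proof.
apply/cellP => i; rewrite mxE.
have /andP[h1 h2] := ceil_itv ((x ord0 i - a ord0 i) / gside k).
by rewrite h1/= -[1]/(1%:~R) -intrD subrK.
Qed.

Lemma cell_idx k z x : cell k z x -> z = gidx k x.
Proof.
move/cellP => h; apply/rowP => i; rewrite mxE.
have /andP[h1 h2] := h i.
rewrite (@ceil_def _ _ (z ord0 i + 1)) ?addrK//.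
by rewrite h1/= intrD.
Qed.

Lemma measurable_cell k z : measurable (cell k z).
Proof. exact: measurable_hcube. Qed.

Lemma cell_nestedS k x y : gidx k.+1 x = gidx k.+1 y -> gidx k x = gidx k y.
Proof.
move=> xy; apply: (@cell_idx _ _ y); apply/cellP => i.
have /cellP/(_ i)/andP[x1 x2] := cell_gidx k x.
have /cellP/(_ i)/andP[x3 x4] := cell_gidx k.+1 x.
have /cellP/(_ i)/andP[y3 y4] := cell_gidx k.+1 y.
rewrite -xy in y3 y4.
have s0 := gside_gt0 k.+1.
have tE (t : R) : t / gside k.+1 = 2 * (t / gside k).
  by rewrite (gsideS k); field; rewrite gt_eqF.
rewrite !tE in x3 x4 y3 y4.
set z := gidx k x ord0 i in x1 x2 *; set z' := gidx k.+1 x ord0 i in x3 x4 y3 y4.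
(* These are strict inequalities between integers, hence improve by 1; this puts the interval (z',
   z' + 1] of the finer cell inside (2 z, 2 z + 2], with y in it as well as x. *)
have h1 : (2 * z)%:~R < (z' + 1)%:~R :> R by rewrite intrM intrD; lra.
have h2 : z'%:~R < (2 * z + 2)%:~R :> R by rewrite intrD intrM; lra.
rewrite ltr_int in h1; rewrite ltr_int in h2.
have h3 : (2 * z)%:~R <= z'%:~R :> R by rewrite ler_int -ltzD1.
have h4 : (z' + 1)%:~R <= (2 * z + 2)%:~R :> R by rewrite ler_int lezD1.
rewrite intrM in h3; rewrite !intrD intrM in h4.
by apply/andP; split; lra.
Qed.

Lemma cell_nested j k x y : (j <= k)%N -> gidx k x = gidx k y -> gidx j x = gidx j y.
Proof.
move=> jk; rewrite -(subnK jk); elim: (k - j)%N => [//|d IH].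
by rewrite addSn => /cell_nestedS.
Qed.

Lemma cell_sub j k x : (j <= k)%N -> cell k (gidx k x) `<=` cell j (gidx j x).
Proof.
move=> jk y /cell_idx xy; rewrite (cell_nested jk xy); exact: cell_gidx.
Qed.

Lemma cell00 : cell 0 0 = hcube a l.
Proof.
rewrite /cell /gside expr0 divr1; congr hcube.
by apply/rowP => i; rewrite !mxE mul0r addr0.
Qed.

Section maximal_cells.
Variable P : nat -> 'rV[int]_n.+1 -> Prop.

(** The ancestors of a cell are expressed as the coarser cells of its points. *)
Definition maximal_cell k z :=
  P k z /\ forall j x, (j < k)%N -> cell k z x -> ~ P j (gidx j x).

(** With [pickle_inv], which is also a right inverse where it is defined, each cell has exactly one
    index; disjointness over the indices depends on this. *)
Definition cell_seq (i : nat) : set E :=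
  if pickle_inv i is Some (k, z) then
    if `[< maximal_cell k z >] then cell k z else set0
  else set0.

Definition cells_union : set E := [set x | exists k, P k (gidx k x)].

Lemma cell_seqP i : cell_seq i = set0 \/
  exists k z, maximal_cell k z /\ cell_seq i = cell k z.
Proof.
rewrite /cell_seq; case: (pickle_inv i) => [[k z]|]; last by left.
by case: asboolP => h; [right; exists k, z|left].
Qed.

Lemma measurable_cell_seq i : measurable (cell_seq i).
Proof.
by case: (cell_seqP i) => [->|[k [z [_ ->]]]]; [exact: measurable0|exact: measurable_cell].
Qed.

Lemma bigcup_cell_seq : \bigcup_i cell_seq i = cells_union.
Proof.
apply/seteqP; split=> [x [i _]|x [k0 Pk0]].
  case: (cell_seqP i) => [->//|[k [z [[Pkz _] ->]]]] xkz.
  by exists k; rewrite -(cell_idx xkz).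
have ex : exists k, `[< P k (gidx k x) >] by exists k0; exact/asboolP.
case: (ex_minnP ex) => k /asboolP Pk kmin.
exists (pickle (k, gidx k x)) => //; rewrite /cell_seq pickleK_inv.
case: asboolP => [_|[]]; first exact: cell_gidx.
split=> // j y jk /cell_idx xy; rewrite -(cell_nested (ltnW jk) xy) => Pj.
by have := kmin j; rewrite leqNgt jk => /(_ (introT (asboolP _) Pj)).
Qed.

Lemma measurable_cells_union : measurable cells_union.
Proof. by rewrite -bigcup_cell_seq; apply: bigcup_measurable => i _; exact: measurable_cell_seq. Qed.

Lemma trivIset_cell_seq : trivIset setT cell_seq.
Proof.
move=> i j _ _ [x []]; rewrite /cell_seq.
have ei := @pickle_invK (nat * 'rV[int]_n.+1)%type i.
have ej := @pickle_invK (nat * 'rV[int]_n.+1)%type j.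
case: (pickle_inv i) ei => [[k z]|] /= ei; last by [].
case: (pickle_inv j) ej => [[k' z']|] /= ej; last by [].
rewrite -ei -ej {ei ej}.
case: asboolP => // -[Pk mk] xk; case: asboolP => // -[Pk' mk'] xk'.
have kk : k = k'.
  case: (ltngtP k k') => // lt; exfalso.
    by apply: (mk' _ _ lt xk'); rewrite -(cell_idx xk).
  by apply: (mk _ _ lt xk); rewrite -(cell_idx xk').
by rewrite kk (cell_idx xk) (cell_idx xk') kk.
Qed.

Local Open Scope ereal_scope.

(** The maximal cells partition the union, so an estimate proved inside one maximal cell at a time
    can be summed. *)
Lemma cells_union_measure_le (m1 m2 : {measure set E -> \bar R}) (A B : set E) (c : R) :
  (0 <= c)%R -> measurable A -> measurable B ->
  (forall k z, maximal_cell k z -> m1 (A `&` cell k z) <= c%:E * m2 (B `&` cell k z)) ->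
  m1 (A `&` cells_union) <= c%:E * m2 (B `&` cells_union).
Proof.
move=> c0 mA mB H.
have split_ (m : {measure set E -> \bar R}) X : measurable X ->
    m (X `&` cells_union) = \sum_(0 <= i <oo) m (X `&` cell_seq i).
  move=> mX; rewrite -bigcup_cell_seq setI_bigcupr measure_semi_bigcup.
  - by [].
  - by move=> i; apply: measurableI; [exact: mX|exact: measurable_cell_seq].
  - by apply: trivIset_setIl; exact: trivIset_cell_seq.
  - apply: bigcup_measurable => i _.
    by apply: measurableI; [exact: mX|exact: measurable_cell_seq].
rewrite !split_// -nneseriesZl//.
apply: lee_nneseries => [i _ _|i _]; first exact: measure_ge0.
case: (cell_seqP i) => [->|[k [z [mkz ->]]]]; last exact: H.
by rewrite !setI0 !measure0 mule0.
Qed.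

(** Version for an arbitrary set A: subadditivity of the outer measure on the left, additivity over
    the disjoint cells on the right. *)
Lemma cells_union_outer_le (A : set E) (c : R) : (0 <= c)%R ->
  (forall k z, maximal_cell k z -> mu (A `&` cell k z) <= c%:E * mu (cell k z)) ->
  mu (A `&` cells_union) <= c%:E * mu cells_union.
Proof.
move=> c0 H; rewrite -bigcup_cell_seq.
have -> : mu (\bigcup_i cell_seq i) = \sum_(0 <= i <oo) mu (cell_seq i).
  apply: measure_semi_bigcup.
  - exact: measurable_cell_seq.
  - exact: trivIset_cell_seq.
  - by apply: bigcup_measurable => i _; exact: measurable_cell_seq.
rewrite -nneseriesZl//.
apply: (le_trans (outer_measure_bigcup_lim (@lebesgue_outer R n) cell_seq A)).
apply: lee_nneseries => [i _ _|i _]; first exact: outer_measure_ge0.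
case: (cell_seqP i) => [->|[k [z [mkz ->]]]]; last exact: H.
have h0 : mu set0 = 0 by exact: measure0.
rewrite setI0; suff : mu set0 <= c%:E * mu set0 by [].
by rewrite h0 mule0.
Qed.

End maximal_cells.

End dyadic_grid.

Section outer_regularity.
Context (R : realType) (n : nat).
Local Notation E := (Rn R n).
Local Notation mu := (@lebesgue R n).
Local Open Scope ereal_scope.

Lemma lebesgue_outer_regular (N : set E) (e : R) : (0 < e)%R -> mu N < +oo ->
  exists G : set E, [/\ open G, N `<=` G & mu G <= mu N + e%:E].
Proof.
move=> e0 Nfin.
have e20 : (0 < e / 2)%R by rewrite divr_gt0.
have N0 : 0 <= mu N by exact: outer_measure_ge0.
have [F cF FN] : exists2 F, box_cover N F &
    \sum_(0 <= k <oo) (box_vol (F k))%:E <= mu N + (e / 2)%:E.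
  have : mu N < mu N + (e / 2)%:E by rewrite lteDl ?lte_fin// ge0_fin_numE.
  move=> /ereal_inf_lt[_ [F cF <-]] lt; exists F => //; exact: ltW.
have /choice[d dP] (k : nat) : exists d : R, (0 < d /\
    box_vol ((F k).1, \row_i ((F k).2 ord0 i + d)) <= box_vol (F k) + e / 2 / (2 ^ k.+1)%:R)%R.
  by apply: exists_enlarged_box; rewrite divr_gt0// ltr0n expn_gt0.
pose b k := ((F k).1, \row_i ((F k).2 ord0 i + d k)%R).
pose G : set E := \bigcup_k [set x : E | forall i,
  `](F k).1 ord0 i, ((F k).2 ord0 i + d k)%R[%classic (x ord0 i)].
exists G; split.
- apply: bigcup_open => k _; apply: (@open_rV_rect R n (fun i =>
    `](F k).1 ord0 i, ((F k).2 ord0 i + d k)%R[%classic)) => i.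
  exact: interval_open.
- move=> x /cF[k _ Fkx]; exists k => // i; have /andP[h1 h2] := Fkx i.
  rewrite /= in_itv/= h1/=; apply: (le_lt_trans h2).
  by rewrite ltrDl; have [] := dP k.
- have Gb : G `<=` \bigcup_k (box (b k) : set E).
    move=> x [k _ Gx]; exists k => // i; have := Gx i.
    by rewrite /= in_itv/= mxE => /andP[-> /ltW ->].
  apply: (@le_trans _ _ (\sum_(0 <= k <oo) mu (box (b k)))).
    apply: le_trans (outer_measure_sigma_subadditive (@lebesgue_outer R n) (fun k => box (b k))).
    exact: le_outer_measure.
  apply: (@le_trans _ _ (\sum_(0 <= k <oo) ((box_vol (F k))%:E + (e / 2 / (2 ^ k.+1)%:R)%:E))).
    apply: lee_nneseries => [k _ _|k _]; first exact: outer_measure_ge0.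
    by rewrite lebesgue_box -EFinD lee_fin; have [] := dP k.
  apply: le_trans (epsilon_trick predT _ (ltW e20)) _.
    by move=> k; rewrite lee_fin box_vol_ge0.
  rewrite [in leRHS](splitr e) EFinD addeA leeD2r//.
Qed.

Lemma outer_null_measurable (N : set E) : mu N = 0 -> measurable N.
Proof.
move=> N0; suff : caratheodory_measurable (@lebesgue_outer R n) N by [].
apply: le_caratheodory_measurable => X.
have h1 : mu (X `&` N) <= 0 by rewrite -N0; apply: le_outer_measure; exact: subIsetr.
have h2 : mu (X `&` ~` N) <= mu X by apply: le_outer_measure; exact: subIsetl.
by have := leeD h1 h2; rewrite add0e.
Qed.

End outer_regularity.

(** * Local oscillation and good-lambda inequality on dyadic cells *)

Section oscillation.
Context (R : realType) (n : nat).
Local Notation E := (Rn R n).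
Local Notation mu := (@lebesgue R n).
Local Open Scope ereal_scope.

(** Doubling the side multiplies the measure by 2^(n+1). As lam (1 + 2^(n+1)) <= 1/2, the bad sets
    of a cube and of a cube containing it with at most twice its side cannot together cover the
    smaller one. The 4 gives lam <= 1/4 for the density arguments. *)
Definition lam : R := ((4 * 2 ^+ n.+1)^-1)%R.

Definition oscillation_bad (F : E -> R) (c o : E -> R -> R) (a : E) (l : R) : set E :=
  hcube a l `&` [set x | (o a l < `|F x - c a l|)%R].

(* Stromberg's local form: outside a small portion of each cube Q(a, l), the
   function F is within o(a, l) of the constant c(a, l). *)
Definition small_oscillation (F : E -> R) (c o : E -> R -> R) := forall a l, (0 < l)%R ->
  mu (oscillation_bad F c o a l) <= lam%:E * mu (hcube a l).

Lemma lam_gt0 : (0 < lam)%R.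
Proof. by rewrite invr_gt0 mulr_gt0// exprn_gt0. Qed.

Lemma lam_le : (lam * (1 + 2 ^+ n.+1) <= 2^-1)%R.
Proof.
rewrite mulrC ler_pdivrMr ?mulr_gt0 ?exprn_gt0//.
have : (1 <= 2 ^+ n.+1 :> R)%R by rewrite exprn_ege1// ler1n.
by lra.
Qed.

Lemma lam_le4 : (lam <= 4^-1)%R.
Proof.
rewrite /lam invfM ler_piMr// invf_le1 ?exprn_gt0//.
by rewrite exprn_ege1// ler1n.
Qed.

Variables (F : E -> R) (c o : E -> R -> R).
Hypothesis mF : measurable_fun setT F.
Hypothesis hosc : small_oscillation F c o.

Lemma measurable_bad a l : measurable (oscillation_bad F c o a l).
Proof.
apply: measurableI; first exact: measurable_hcube.
have mf : measurable_fun setT (fun x : E => `|F x - c a l|)%R.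
  apply: (measurableT_comp (@normr_measurable R setT)).
  by apply: measurable_funB; [exact: mF|exact: measurable_cst].
have := mf measurableT _ (measurable_itv `]o a l, +oo[); rewrite setTI.
by congr measurable; apply/seteqP; split => x /=; rewrite in_itv/= andbT.
Qed.

(** Otherwise every point of the smaller cube would be bad for one of the two cubes, against
    [lam_le]. *)
Lemma oscillation_compare (a a' : E) (l l' : R) : (0 < l)%R -> (l' <= 2 * l)%R ->
  hcube a l `<=` hcube a' l' -> (`|c a l - c a' l'| <= o a l + o a' l')%R.
Proof.
move=> l0 l'l sub; rewrite leNgt; apply/negP => lt.
have l'0 : (0 < l')%R.
  have [x xa] : hcube a l !=set0.
    apply/set0P/eqP => h; have := lebesgue_hcube_gt0 a l0.
    rewrite h; have h0 : mu set0 = 0 by exact: measure0.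
    by rewrite h0 ltxx.
  have /hcubeP/(_ ord0)/andP[h1 h2] := sub x xa.
  by have := lt_le_trans h1 h2; rewrite ltrDl.
have cov : hcube a l `<=` oscillation_bad F c o a l `|` oscillation_bad F c o a' l'.
  move=> x xa.
  have [h|h] := ltP (o a l) `|F x - c a l|%R; first by left.
  right; split; [exact: sub|rewrite /= ltNge; apply/negP => h'].
  move: lt; rewrite ltNge => /negP; apply.
  have -> : (c a l - c a' l' = (F x - c a' l') - (F x - c a l))%R by ring.
  by rewrite (le_trans (ler_normB _ _))// addrC lerD.
have : mu (hcube a l) <= lam%:E * mu (hcube a l) + lam%:E * mu (hcube a' l').
  apply: (@le_trans _ _ (mu (oscillation_bad F c o a l) + mu (oscillation_bad F c o a' l'))).
    apply: (@le_trans _ _ (mu (oscillation_bad F c o a l `|` oscillation_bad F c o a' l'))).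
      exact: le_outer_measure.
    by apply: measureU2; exact: measurable_bad.
  by apply: leeD; exact: hosc.
rewrite !lebesgue_hcube ?(ltW l0) ?(ltW l'0)// -!EFinM -EFinD lee_fin.
have h1 : (l' ^+ n.+1 <= 2 ^+ n.+1 * l ^+ n.+1)%R.
  by rewrite -exprMn lerXn2r ?nnegrE ?mulr_ge0 ?(ltW l0) ?(ltW l'0).
have h2 : (0 < l ^+ n.+1)%R by rewrite exprn_gt0.
have := lam_le; have := lam_gt0.
move: (lam) (l ^+ n.+1)%R (l' ^+ n.+1)%R (2 ^+ n.+1)%R h1 h2 => L x y t h1 h2 L0 Lt h3.
have h4 : (L * y <= L * (t * x))%R by rewrite ler_wpM2l// ltW.
have h5 : (L * (1 + t) * x <= 2^-1 * x)%R by rewrite ler_wpM2r// ltW.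
lra.
Qed.

Variables (a : E) (l : R).
Hypothesis l0 : (0 < l)%R.
Local Notation cell := (cell a l).
Local Notation gidx := (gidx a l).
Local Notation cc k z := (c (gcorner a l k z) (gside l k)).
Local Notation oo k z := (o (gcorner a l k z) (gside l k)).
Local Notation badc k z := (oscillation_bad F c o (gcorner a l k z) (gside l k)).

Lemma bad_cell_le k z : mu (badc k z) <= lam%:E * mu (cell k z).
Proof. by apply: hosc; exact: gside_gt0. Qed.

Local Lemma mu_cell k z : mu (cell k z) = (gside l k ^+ n.+1)%:E.
Proof. by rewrite lebesgue_hcube// ltW// gside_gt0. Qed.

(* The constants of the subcells of a cell P that drift far from that of P
   cover at most half of P. *)
Lemma drift_half (k : nat) (z : 'rV[int]_n.+1) (t : R) : (0 < t)%R -> (oo k z <= t)%R ->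
  exists U : set E, [/\ measurable U, U `<=` cell k z,
    mu U <= (2^-1)%:E * mu (cell k z) &
    forall x j, cell k z x -> (k <= j)%N -> (oo j (gidx j x) <= t)%R ->
      (3 * t < `|cc j (gidx j x) - cc k z|)%R -> U x].
Proof.
move=> t0 okz.
pose P j z' := [/\ cell j z' `<=` cell k z, (oo j z' <= t)%R & (3 * t < `|cc j z' - cc k z|)%R].
have Usub : cells_union a l P `<=` cell k z.
  by move=> x [j [sub _ _]]; apply: sub; exact: cell_gidx.
exists (cells_union a l P); split.
- exact: measurable_cells_union.
- exact: Usub.
- have L4 := lam_le4; have L0 := lam_gt0.
  (* Let j be a cell whose constant has drifted by more than 3 t. Outside its bad set F is within t
     of its constant, hence more than 2 t away from that of the cell k, and such points are bad for
     k. So the bad set of k fills at least the proportion 1 - lam of the cell j, and its total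
     measure is at most lam |cell k|. *)
  have H : mu (setT `&` cells_union a l P) <= 2%:E * mu (badc k z `&` cells_union a l P).
    apply: (@cells_union_measure_le R n a l l0 P mu mu setT (badc k z) 2 _ measurableT
      (measurable_bad _ _)) => //.
    move=> j z' [[sub oj cj] _]; rewrite setTI.
    have cov : cell j z' `<=` (badc k z `&` cell j z') `|` badc j z'.
      move=> x xj.
      have [h|h] := ltP (oo j z') `|F x - cc j z'|%R; first by right.
      left; split => //; split; first exact: sub.
      rewrite /=.
      have tri : (`|cc j z' - cc k z| <= `|F x - cc k z| + `|F x - cc j z'|)%R.
        have -> : (cc j z' - cc k z = (F x - cc k z) - (F x - cc j z'))%R by ring.
        exact: ler_normB.
      by lra.
    have mJ : measurable (badc k z `&` cell j z').
      by apply: measurableI; [exact: measurable_bad|exact: measurable_cell].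
    have : mu (cell j z') <= mu (badc k z `&` cell j z') + lam%:E * mu (cell j z').
      apply: (@le_trans _ _ (mu ((badc k z `&` cell j z') `|` badc j z'))).
        exact: le_outer_measure.
      apply: (@le_trans _ _ (mu (badc k z `&` cell j z') + mu (badc j z'))).
        by apply: measureU2; [exact: mJ|exact: measurable_bad].
      by rewrite leeD2l// bad_cell_le.
    have cellfin : mu (cell j z') = (fine (mu (cell j z')))%:E by rewrite mu_cell.
    have Jfin : mu (badc k z `&` cell j z') = (fine (mu (badc k z `&` cell j z')))%:E.
      rewrite fineK// ge0_fin_numE; last exact: outer_measure_ge0.
      apply: (@le_lt_trans _ _ (mu (cell j z'))); last by rewrite mu_cell ltry.
      by apply: le_outer_measure; exact: subIsetr.
    have c0 : (0 <= fine (mu (cell j z')))%R by rewrite fine_ge0//; exact: outer_measure_ge0.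
    suff K : mu (cell j z') <= mu (badc k z `&` cell j z') + lam%:E * mu (cell j z') ->
        mu (cell j z') <= 2%:E * mu (badc k z `&` cell j z') by exact: K.
    rewrite cellfin Jfin -!EFinM -EFinD !lee_fin.
    move: (fine _) c0 => x x0; move: (fine _) => y.
    have : (lam * x <= 4^-1 * x)%R by rewrite ler_wpM2r.
    by lra.
  have H2 : mu (cells_union a l P) <= 2%:E * mu (badc k z).
    have -> : cells_union a l P = setT `&` cells_union a l P by rewrite setTI.
    apply: (le_trans H); rewrite lee_wpmul2l//.
    by apply: le_outer_measure; exact: subIsetl.
  apply: (le_trans H2); apply: (@le_trans _ _ (2%:E * (lam%:E * mu (cell k z)))).
    by rewrite lee_wpmul2l// bad_cell_le.
  rewrite mu_cell -!EFinM lee_fin.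
  have : (0 < gside l k ^+ n.+1)%R by rewrite exprn_gt0// gside_gt0.
  move: (_ ^+ _)%R => x x0.
  have : (lam * x <= 4^-1 * x)%R by rewrite ler_wpM2r// ltW.
  by lra.
- move=> x j xk kj oj cj; exists j; split => //.
  rewrite (cell_idx l0 xk); exact: cell_sub.
Qed.

End oscillation.

(** Summing the recursion with weights (s r^k)^p brings the same sum back on the right with the
    factor r^p be <= q < 1, and it is absorbed because only finitely many levels are summed. The
    term with V is that of the level k = 0. *)
Lemma good_lambda_sum (R : realType) (al b : nat -> R) (s r p be V J q : R) (M : nat) :
  0 < s -> 1 < r -> 0 < p -> 0 <= be -> (forall k, 0 <= al k) -> al 0%N <= V ->
  (forall k, al k.+1 <= be * al k + b k) -> r `^ p * be <= q -> q < 1 ->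
  (forall k, 0 <= b k) ->
  \sum_(k < M) (s * r ^+ k) `^ p * b k <= J ->
  \sum_(k < M) (s * r ^+ k) `^ p * al k <= (s `^ p * V + r `^ p * J) / (1 - q).
Proof.
move=> s0 r1 p0 be0 al0 alV rec qle q1 b0 HJ.
have r0 : 0 < r by rewrite (lt_trans _ r1).
have tS k : (s * r ^+ k.+1) `^ p = r `^ p * (s * r ^+ k) `^ p.
  rewrite -powRM ?(ltW r0)//; last by rewrite mulr_ge0 ?exprn_ge0// ltW.
  by rewrite exprS; congr (_ `^ _); ring.
have V0 : 0 <= V by rewrite (le_trans (al0 0%N)).
have q0 : 0 <= q by rewrite (le_trans _ qle) ?mulr_ge0 ?powR_ge0.
have J0 : 0 <= J by apply: le_trans HJ; apply: sumr_ge0 => k _; rewrite mulr_ge0 ?powR_ge0.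
rewrite ler_pdivlMr ?subr_gt0//.
case: M HJ => [|M] HJ.
  by rewrite big_ord0 mul0r addr_ge0 ?mulr_ge0 ?powR_ge0.
set X := \sum_(k < M.+1) _.
suff : X <= s `^ p * V + q * X + r `^ p * J by lra.
rewrite {1}/X.
rewrite big_ord_recl /= expr0 mulr1 -addrA lerD//.
  by rewrite ler_wpM2l ?powR_ge0.
apply: (@le_trans _ _ (\sum_(k < M) (r `^ p * be * ((s * r ^+ k) `^ p * al k)
    + r `^ p * ((s * r ^+ k) `^ p * b k)))).
  apply: ler_sum => k _; rewrite /bump/= add1n tS.
  apply: (@le_trans _ _ (r `^ p * (s * r ^+ k) `^ p * (be * al k + b k))).
    by rewrite ler_wpM2l// mulr_ge0 ?powR_ge0.
  by rewrite le_eqVlt; apply/orP; left; apply/eqP; ring.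
rewrite big_split/= -!mulr_sumr; apply: lerD.
  apply: (@le_trans _ _ (q * \sum_(k < M) (s * r ^+ k) `^ p * al k)).
    by rewrite ler_wpM2r//; apply: sumr_ge0 => k _; rewrite mulr_ge0 ?powR_ge0.
  rewrite ler_wpM2l//.
  by rewrite /X big_ord_recr/= lerDl mulr_ge0 ?powR_ge0.
rewrite ler_wpM2l ?powR_ge0// (le_trans _ HJ)// big_ord_recr/= lerDl.
by rewrite mulr_ge0 ?powR_ge0.
Qed.

Lemma exists_cell_in_open (R : realType) (n : nat) (a : Rn R n) (l : R)
    (G : set (Rn R n)) (x : Rn R n) : 0 < l -> open G -> G x ->
  exists k, cell a l k (gidx a l k x) `<=` G.
Proof.
move=> l0; rewrite openE => oG Gx.
have : nbhs (x : 'rV[R]_n.+1) (G : set 'rV[R]_n.+1) by exact: oG Gx.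
move=> /nbhs_ballP[e /= e0 eG].
pose k := (Num.truncn (l / e)).+1.
exists k => y /hcubeP yk; apply: eG; split=> // i j; rewrite (ord1 i).
have /hcubeP xk := cell_gidx a l0 k x.
have side : gside l k < e.
  rewrite /gside ltr_pdivrMr ?exprn_gt0// mulrC -ltr_pdivrMr//.
  apply: (lt_trans (truncnS_gt _)).
  by rewrite -natrX ltr_nat ltn_expl.
rewrite /ball/= ltr_norml.
by have /andP[? ?] := xk j; have /andP[? ?] := yk j; apply/andP; split; lra.
Qed.

Section good_lambda.
Context (R : realType) (n : nat).
Local Notation E := (Rn R n).
Local Notation mu := (@lebesgue R n).
Local Open Scope ereal_scope.
Variables (p K : R) (v w : E -> R).
Hypotheses (p1 : (1 < p)%R) (K1 : (1 <= K)%R) (vs : Ap_pair p K v w).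
Variables (F : E -> R) (c o : E -> R -> R) (g : E -> \bar R).
Hypothesis mF : measurable_fun setT F.
Hypothesis hosc : small_oscillation F c o.
Hypothesis mg : measurable_fun setT g.
Hypothesis og : forall a l x, (0 < l)%R -> hcube a l x -> (o a l)%:E <= g x.
Variables (a : E) (l : R).
Hypothesis l0 : (0 < l)%R.

Local Notation cell := (cell a l).
Local Notation gidx := (gidx a l).
Local Notation cc k z := (c (gcorner a l k z) (gside l k)).
Local Notation oo k z := (o (gcorner a l k z) (gside l k)).
Local Notation badc k z := (oscillation_bad F c o (gcorner a l k z) (gside l k)).
Local Notation Q0 := (hcube a l).

Local Notation nu := (density_of mu (pair_mv vs) (pair_v_ge0 vs)).

Local Lemma gl_K0 : (0 < K)%R. Proof. exact: lt_le_trans K1. Qed.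
Local Lemma gl_p0 : (0 < p)%R. Proof. exact: lt_trans p1. Qed.

(** The largest share of the v-mass of a cube that, by [weight_half_le], a subset of at most half
    its measure can carry. *)
Definition beta : R := (1 - (2^-1) `^ p / K)%R.

Local Lemma gl_beta : (0 <= beta < 1)%R.
Proof.
have K0 := gl_K0; have h0 : (0 < 2^-1 `^ p :> R)%R by rewrite powR_gt0.
have h1 : (2^-1 `^ p <= 1 :> R)%R.
  rewrite powRV// invf_le1 ?powR_gt0// ltW// powR_gt1 ?ltr1n//; exact: gl_p0.
rewrite /beta subr_ge0 ler_pdivrMr// mul1r (le_trans h1)//= ltrBlDr ltrDl.
by rewrite divr_gt0.
Qed.

Local Lemma gl_cell_sub k x : Q0 x -> cell k (gidx k x) `<=` Q0.
Proof.
move=> Qx; rewrite -cell00; rewrite -cell00 in Qx.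
by have := @cell_sub R n a l l0 0 k x (leq0n k); rewrite -(cell_idx l0 Qx).
Qed.

(** Cell (0, 0) is the cube [Q0] itself. The far cells stay inside it, so the measures compared in
    the good-lambda inequality are finite from the outset. *)
Definition far_cells (t : R) (k : nat) (z : 'rV[int]_n.+1) : Prop :=
  cell k z `<=` Q0 /\ (t < `|cc k z - cc 0%N 0|)%R.

Local Notation A t := (cells_union a l (far_cells t)).

Local Lemma gl_mA t : measurable (A t).
Proof. exact: measurable_cells_union. Qed.

Local Lemma gl_mlevel (t : R) : measurable [set x | g x <= t%:E].
Proof.
rewrite (_ : [set x | g x <= t%:E] = ~` [set x | t%:E < g x]); last first.
  by apply/seteqP; split => x /=; rewrite leNgt => /negP.
by apply: measurableC; exact: measurable_super_level.
Qed.

Local Lemma gl_nu_half k z (U : set E) : measurable U -> U `<=` cell k z ->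
  mu U <= (2^-1)%:E * mu (cell k z) -> nu U <= beta%:E * nu (cell k z).
Proof.
move=> mU Usub Uh.
have h := pair_half_le p1 gl_K0 vs (gside_gt0 l0 k) mU Usub Uh.
have cfin := pair_vfin vs (gcorner a l k z) (gside l k).
have c0 := integral_positive_ge0 (cell k z) (pair_v0 vs).
have u0 := integral_positive_ge0 U (pair_v0 vs).
have ufin : nu U < +oo.
  apply: le_lt_trans cfin; apply: (@ge0_subset_integral _ E R mu).
  - exact: mU.
  - exact: measurable_cell.
  - exact: measurable_EFin_in (pair_mv vs).
  - by move=> x _; rewrite lee_fin (pair_v_ge0 vs).
  - exact: Usub.
have UE : nu U = (fine (nu U))%:E by rewrite fineK// ge0_fin_numE.
have cE : nu (cell k z) = (fine (nu (cell k z)))%:E by rewrite fineK// ge0_fin_numE.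
by rewrite UE cE -EFinM lee_fin.
Qed.

(** In a maximal far cell that contains a point with g <= ga t, the constant is within t + 2 ga t of
    the reference, as its parent is not far. Smaller cells that are far at the level (1 + 5 ga) t
    have then drifted by more than 3 ga t from it, and [drift_half] confines them to half of the
    cell. *)
Lemma good_lambda (t ga : R) : (0 < t)%R -> (0 < ga)%R ->
  nu (A ((1 + 5 * ga) * t)%R `&` [set x | g x <= (ga * t)%:E]) <= beta%:E * nu (A t).
Proof.
move=> t0 ga0; set r := (1 + 5 * ga)%R.
have gt0 : (0 < ga * t)%R by rewrite mulr_gt0.
have rt : (t <= r * t)%R by rewrite ler_peMl ?(ltW t0)// lerDl; lra.
have ArA : A (r * t)%R `<=` A t.
  by move=> x [k [sub h]]; exists k; split => //; exact: le_lt_trans h.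
have /andP[be0 be1] := gl_beta.
have -> : A (r * t)%R `&` [set x | g x <= (ga * t)%:E] =
    (A (r * t)%R `&` [set x | g x <= (ga * t)%:E]) `&` A t.
  by apply/seteqP; split => [x [Ax gx]|x []//]; split => //; exact: ArA.
have -> : nu (A t) = nu (setT `&` A t) by rewrite setTI.
apply: (@cells_union_measure_le R n a l l0 (far_cells t) nu nu
  (A (r * t)%R `&` [set x | g x <= (ga * t)%:E]) setT beta be0 _ measurableT).
  by apply: measurableI; [exact: gl_mA|exact: gl_mlevel].
move=> k z [[sub far] maxl]; rewrite setTI.
have [->|/set0P[y [[Ay gy] yk]]] :=
    eqVneq ((A (r * t)%R `&` [set x | g x <= (ga * t)%:E]) `&` cell k z) set0.
  by rewrite measure0 mule_ge0 ?lee_fin.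
have oy k' : (oo k' (gidx k' y) <= ga * t)%R.
  rewrite -lee_fin (le_trans _ gy)//; apply: og; first exact: gside_gt0.
  exact: cell_gidx.
have zE := cell_idx l0 yk.
have Qy : Q0 y by exact: sub.
(* The top cell is never far, its constant being the reference itself; any other maximal cell has a
   parent, which is within t of the reference. *)
have cz : (`|cc k z - cc 0%N 0| <= t + 2 * (ga * t))%R.
  case: k zE sub far maxl yk => [|k] zE sub far maxl yk.
    have z0 : z = 0%R by rewrite zE; rewrite -cell00 in Qy; rewrite -(cell_idx l0 Qy).
    by move: far; rewrite z0 subrr normr0 ltNge (ltW t0).
  have nfar : (`|cc k (gidx k y) - cc 0%N 0| <= t)%R.
    rewrite leNgt; apply/negP => h.
    by apply: (maxl k y (ltnSn k) yk); split => //; exact: gl_cell_sub.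
  have cmp : (`|cc k.+1 z - cc k (gidx k y)| <= oo k.+1 z + oo k (gidx k y))%R.
    apply: (oscillation_compare mF hosc).
    - exact: gside_gt0.
    - by rewrite (gsideS l k).
    - by rewrite zE; apply: (cell_sub _ (leqnSn k)).
  have o1 := oy k; have o2 := oy k.+1; rewrite -zE in o2.
  have -> : (cc k.+1 z - cc 0%N 0 =
    (cc k.+1 z - cc k (gidx k y)) + (cc k (gidx k y) - cc 0%N 0))%R by ring.
  apply: (le_trans (ler_normD _ _)); lra.
have ok : (oo k z <= ga * t)%R by rewrite zE.
have [U [mU Usub Uh HU]] := drift_half mF hosc l0 gt0 ok.
apply: (@le_trans _ _ (nu U)); last exact: gl_nu_half.
apply: le_measure; rewrite ?inE.
- apply: measurableI; last exact: measurable_cell.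
  by apply: measurableI; [exact: gl_mA|exact: gl_mlevel].
- exact: mU.
- move=> x [[[j [jsub jfar]] gx] xk].
  have kj : (k <= j)%N.
    rewrite leqNgt; apply/negP => jk.
    by apply: (maxl j x jk xk); split => //; exact: le_lt_trans jfar.
  apply: (HU x j xk kj).
    rewrite -lee_fin (le_trans _ gx)//; apply: og; first exact: gside_gt0.
    exact: cell_gidx.
  have tri : (`|cc j (gidx j x) - cc 0%N 0| <=
      `|cc j (gidx j x) - cc k z| + `|cc k z - cc 0%N 0|)%R.
    have -> : (cc j (gidx j x) - cc 0%N 0 =
      (cc j (gidx j x) - cc k z) + (cc k z - cc 0%N 0))%R by ring.
    exact: ler_normD.
  by move: jfar tri cz; rewrite /r; lra.
Qed.

(* A point at which F stays away from the constants of all its cells lies in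
   the bad set of each of them, and no set of positive outer measure has density
   at most lam in every cell. *)
Lemma never_close_null :
  mu [set x | Q0 x /\ forall k, g x < `|F x - cc k (gidx k x)|%:E] = 0.
Proof.
set N := [set x | _].
have N0 : 0 <= mu N by exact: outer_measure_ge0.
have Nfin : mu N < +oo.
  apply: (@le_lt_trans _ _ (mu Q0)); last exact: lebesgue_hcube_lty.
  by apply: le_outer_measure => x [].
apply/eqP; rewrite eq_le N0 andbT.
have NE : mu N = (fine (mu N))%:E by rewrite fineK// ge0_fin_numE.
have step (e : R) : (0 < e)%R -> (fine (mu N) <= lam R n * (fine (mu N) + e))%R.
  move=> e0; have [G [oG NG Ge]] := lebesgue_outer_regular e0 Nfin.
  pose P k z := cell k z `<=` G.
  have NU : N `<=` cells_union a l P by move=> x /NG Gx; exact: exists_cell_in_open.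
  have NUE : N `&` cells_union a l P = N by apply/setIidPl.
  have L0 : (0 <= lam R n)%R by rewrite ltW// lam_gt0.
  have H : mu (N `&` cells_union a l P) <= (lam R n)%:E * mu (cells_union a l P).
    apply: (cells_union_outer_le l0 L0) => k z _.
    apply: (@le_trans _ _ (mu (badc k z))); last exact: (bad_cell_le hosc a l0).
    apply: le_outer_measure => x [[Qx Nx] xk]; split; first exact: xk.
    have := Nx k; rewrite -(cell_idx l0 xk); rewrite /= -lte_fin.
    by apply: le_lt_trans; apply: og xk; exact: gside_gt0.
  have Gsub : mu (cells_union a l P) <= mu N + e%:E.
    apply: le_trans Ge; apply: le_outer_measure => x [k sub].
    by apply: sub; exact: cell_gidx.
  rewrite NUE in H; rewrite -lee_fin EFinM EFinD -NE; apply: (le_trans H).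
  by apply: lee_wpmul2l; rewrite ?lee_fin.
rewrite NE lee_fin leNgt.
(* The choice e = mu N gives mu N <= 2 lam mu N <= mu N / 2. *)
apply/negP => N_gt0; have := step _ N_gt0; have := lam_le4 R n.
move: (lam R n) (fine (mu N)) N_gt0 => L x x0 L4 h.
have : (L * (x + x) <= 4^-1 * (x + x))%R by rewrite ler_wpM2r// addr_ge0// ltW.
by lra.
Qed.

Local Lemma gl_null_weight (N : set E) : mu N = 0 -> nu N = 0.
Proof.
move=> N0; have mN := outer_null_measurable N0.
have : \int[mu]_(x in N) `|(v x)%:E| = 0.
  apply: (integral_abs_eq0 mN) => //.
  exact: measurable_EFin_in (pair_mv vs).
move=> h; rewrite -[RHS]h; apply: eq_integral => x _.
by rewrite gee0_abs// lee_fin (pair_v_ge0 vs).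
Qed.

(** Away from a null set some cell of x has its constant within g(x) of F(x). If g(x) <= t and F(x)
    is more than 2 t from the constant of [Q0], that cell is far at the level t. *)
Lemma far_level_le (t : R) : (0 < t)%R ->
  nu (Q0 `&` [set x | (2 * t < `|F x - cc 0%N 0|)%R])
   <= nu (A t) + nu (Q0 `&` [set x | t%:E < g x]).
Proof.
move=> t0; set N := [set x | Q0 x /\ forall k, g x < `|F x - cc k (gidx k x)|%:E].
have N0 : nu N = 0 by apply: gl_null_weight; exact: never_close_null.
have mN : measurable N by apply: outer_null_measurable; exact: never_close_null.
have mG : measurable (Q0 `&` [set x | t%:E < g x]).
  by apply: measurableI; [exact: measurable_hcube|exact: measurable_super_level].
have mL : measurable (Q0 `&` [set x | (2 * t < `|F x - cc 0%N 0|)%R]).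
  apply: measurableI; first exact: measurable_hcube.
  have mf : measurable_fun setT (fun x : E => `|F x - cc 0%N 0|)%R.
    apply: (measurableT_comp (@normr_measurable R setT)).
    by apply: measurable_funB; [exact: mF|exact: measurable_cst].
  have := mf measurableT _ (measurable_itv `]2 * t, +oo[%R); rewrite setTI.
  by congr measurable; apply/seteqP; split => x /=; rewrite in_itv/= andbT.
have sub : Q0 `&` [set x | (2 * t < `|F x - cc 0%N 0|)%R] `<=`
    A t `|` (Q0 `&` [set x | t%:E < g x]) `|` N.
  move=> x [Qx /= Fx].
  have [gx|gx] := ltP t%:E (g x); first by left; right.
  have [Nx|] := pselect (forall k, g x < `|F x - cc k (gidx k x)|%:E); first by right.
  move=> /existsNP[k /negP]; rewrite -leNgt => h; left; left.
  have {}h : (`|F x - cc k (gidx k x)| <= t)%R by rewrite -lee_fin (le_trans h).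
  exists k; split; first exact: gl_cell_sub.
  have tri : (`|F x - cc 0%N 0| <=
      `|F x - cc k (gidx k x)| + `|cc k (gidx k x) - cc 0%N 0|)%R.
    have -> : (F x - cc 0%N 0 =
      (F x - cc k (gidx k x)) + (cc k (gidx k x) - cc 0%N 0))%R by ring.
    exact: ler_normD.
  by lra.
have mAG : measurable (A t `|` (Q0 `&` [set x | t%:E < g x])).
  by apply: measurableU; [exact: gl_mA|exact: mG].
apply: (@le_trans _ _ (nu (A t `|` (Q0 `&` [set x | t%:E < g x]) `|` N))).
  by apply: le_measure; rewrite ?inE//; exact: measurableU.
apply: (@le_trans _ _ (nu (A t `|` (Q0 `&` [set x | t%:E < g x])) + nu N)).
  exact: measureU2.
by rewrite N0 adde0; apply: measureU2; [exact: gl_mA|exact: mG].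
Qed.

End good_lambda.

Section restricted_levels.
Context d (T : measurableType d) (R : realType).
Local Open Scope ereal_scope.

Lemma restrict_level (h : T -> \bar R) (Q : set T) (t : R) : (0 <= t)%R ->
  [set x | t%:E < (h \_ Q) x] = Q `&` [set x | t%:E < h x].
Proof.
move=> t0; apply/seteqP; split => [x /=|x [Qx /= tx]].
  rewrite patchE; case: ifPn => [/[!inE] Qx tx|_]; first by split.
  by rewrite lte_fin ltNge t0.
by rewrite patchE mem_set.
Qed.

Lemma restrict_ge0 (h : T -> \bar R) (Q : set T) :
  (forall x, 0 <= h x) -> forall x, 0 <= (h \_ Q) x.
Proof. by move=> h0 x; rewrite patchE; case: ifP. Qed.

Lemma integral_restrict_poweR (m : {measure set T -> \bar R}) (h : T -> \bar R)
    (Q : set T) (p : R) : (0 < p)%R ->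
  \int[m]_x ((h \_ Q) x `^ p) = \int[m]_(x in Q) (h x `^ p).
Proof.
move=> p0; rewrite [RHS]integral_mkcond; apply: eq_integral => x _.
by rewrite !patchE; case: ifP => // _; rewrite poweR0r// gt_eqF.
Qed.

End restricted_levels.

Section local_sharp.
Context (R : realType) (n : nat).
Local Notation E := (Rn R n).
Local Notation mu := (@lebesgue R n).
Local Open Scope ereal_scope.
Variables (p K : R) (v w : E -> R).
Hypotheses (p1 : (1 < p)%R) (K1 : (1 <= K)%R) (vs : Ap_pair p K v w).

Local Notation nu := (density_of mu (pair_mv vs) (pair_v_ge0 vs)).

Theorem local_sharp_estimate : exists2 C : R, (0 < C)%R &
  forall (F : E -> R) (c o : E -> R -> R) (g : E -> \bar R),
  measurable_fun setT F -> small_oscillation F c o ->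
  measurable_fun setT g -> (forall x, 0 <= g x) ->
  (forall a l x, (0 < l)%R -> hcube a l x -> (o a l)%:E <= g x) ->
  forall a l, (0 < l)%R ->
  \int[mu]_(x in hcube a l) ((`|F x - c a l| `^ p)%:E * (v x)%:E)
   <= C%:E * \int[mu]_(x in hcube a l) (g x `^ p * (v x)%:E).
Proof.
have p0 : (0 < p)%R by exact: lt_trans p1.
have K0 : (0 < K)%R by exact: lt_le_trans K1.
have /andP[be0 be1] : (0 <= beta p K < 1)%R.
  have h0 : (0 < 2^-1 `^ p :> R)%R by rewrite powR_gt0.
  have h1 : (2^-1 `^ p < 1 :> R)%R by rewrite powRV// invf_lt1 ?powR_gt0// powR_gt1// ltr1n.
  rewrite /beta subr_ge0 ler_pdivrMr// mul1r ltrBlDr ltrDl divr_gt0//.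
  by rewrite (le_trans (ltW h1)).
pose q : R := ((1 + beta p K) / 2)%R.
have q1 : (q < 1)%R by rewrite /q; lra.
have bq : (beta p K < q)%R by rewrite /q; lra.
have q0 : (0 < q)%R by rewrite /q; lra.
(* The ratio of consecutive levels: r > 1 and still r^p beta <= q < 1, so that the recursion can be
   absorbed. The maximum with q / 2 keeps the denominator positive should beta be 0. *)
pose r : R := ((q / Num.max (beta p K) (q / 2)) `^ p^-1)%R.
pose be' := Num.max (beta p K) (q / 2)%R.
have be'q : (be' < q)%R by rewrite /be' gt_max bq ltr_pdivrMr//; lra.
have be'0 : (0 < be')%R by rewrite /be' lt_max divr_gt0 ?orbT.
have r1 : (1 < r)%R by rewrite powR_gt1 ?invr_gt0// ltr_pdivlMr// mul1r.
have rp : (r `^ p = q / be')%R by rewrite -powRrM mulVf ?gt_eqF// powRr1// divr_ge0 ?ltW.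
have rbeq : (r `^ p * beta p K <= q)%R.
  rewrite rp mulrAC ler_pdivrMr// ler_wpM2l ?(ltW q0)//.
  by rewrite /be' le_max lexx.
(* Makes the factor 1 + 5 ga of [good_lambda] equal to r. *)
pose ga : R := ((r - 1) / 5)%R.
have ga0 : (0 < ga)%R by rewrite divr_gt0// subr_gt0.
have gaE : (1 + 5 * ga = r)%R by rewrite /ga; lra.
pose L : R := ((1 - (r `^ p)^-1)^-1)%R.
have L0 : (0 < L)%R.
  have rp1 : (1 < r `^ p)%R by exact: powR_gt1.
  by rewrite invr_gt0 subr_gt0 invf_lt1// (lt_trans _ rp1).
(* Level sets of g occur at the height ga t in the recursion and at the height t in [far_level_le];
   both lie in the one at ga1 t. *)
pose ga1 := Num.min ga 1%R.
have ga10 : (0 < ga1)%R by rewrite /ga1 lt_min ga0 ltr01.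
pose J1 : R := (L * (ga1^-1) `^ p)%R.
have J10 : (0 < J1)%R by apply: mulr_gt0 => //; rewrite powR_gt0// invr_gt0.
have rp0 : (0 < r `^ p)%R by rewrite powR_gt0// (lt_trans _ r1).
pose C1 : R := (r `^ p * ((r `^ p * J1) / (1 - q) + J1))%R.
have q10 : (0 < 1 - q)%R by rewrite subr_gt0.
have C10 : (0 < C1)%R.
  apply: mulr_gt0 => //; apply: addr_gt0 => //; apply: divr_gt0 => //.
  exact: mulr_gt0.
exists (2 `^ p * C1)%R; first by rewrite mulr_gt0// powR_gt0.
move=> F c o g mF hosc mg g0 og a l l0.
set Q0 := hcube a l.
have mQ : measurable Q0 by exact: measurable_hcube.
pose c0 := c (gcorner a l 0%N 0%R) (gside l 0%N).
have c0E : c a l = c0.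
  rewrite /c0 /gside expr0 divr1; congr (c _ l).
  by apply/rowP => i; rewrite !mxE mul0r addr0.
pose A t := cells_union a l (far_cells c a l t).
have mA t : measurable (A t) by exact: measurable_cells_union.
have AQ t : A t `<=` Q0 by move=> x [k [sub _]]; apply: sub; exact: cell_gidx.
have nuQ : nu Q0 < +oo by exact: pair_vfin vs a l.
have nufin B : measurable B -> B `<=` Q0 -> nu B = (fine (nu B))%:E.
  move=> mB BQ; rewrite fineK// ge0_fin_numE//.
  by apply: le_lt_trans nuQ; apply: le_measure; rewrite ?inE.
pose I := \int[nu]_(x in Q0) (g x `^ p).
have I0 : 0 <= I by apply: integral_ge0 => x _; exact: poweR_ge0.
have mgp : measurable_fun setT (fun x => g x `^ p) by exact: measurable_poweR_fun.
have IE : \int[mu]_(x in Q0) (g x `^ p * (v x)%:E) = I.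
  rewrite /I ge0_integral_density_in; [by []|exact: mQ|exact: measurable_funTS mgp|].
  by move=> x _; exact: poweR_ge0.
rewrite IE.
have [Ioo|Ifin] := eqVneq I +oo.
  by rewrite Ioo gt0_muley ?leey// lte_fin mulr_gt0// powR_gt0.
have IfE : I = (fine I)%:E by rewrite fineK// ge0_fin_numE// ltey.
have iI0 : (0 <= fine I)%R by rewrite fine_ge0.
pose h1 x : \bar R := (ga1^-1)%:E * g x.
have h10 x : 0 <= h1 x by rewrite mule_ge0 ?g0// lee_fin invr_ge0 ltW.
have mh1 : measurable_fun setT h1 by apply: measurable_funeM.
pose G1 : E -> \bar R := h1 \_ Q0.
have mG1 : measurable_fun setT G1.
  by apply/(measurable_restrictT _ mQ).1; exact: measurable_funTS mh1.
have G10 : forall x, 0 <= G1 x by exact: restrict_ge0.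
have IG1 : \int[nu]_x (G1 x `^ p) = ((ga1^-1) `^ p)%:E * I.
  rewrite (integral_restrict_poweR _ _ _ p0) -ge0_integralZl_EFin; last 4 first.
  - exact: mQ.
  - by move=> x _; exact: poweR_ge0.
  - exact: measurable_funTS mgp.
  - exact: powR_ge0.
  - apply: eq_integral => x _; rewrite poweRM ?g0// ?lee_fin ?invr_ge0 ?(ltW ga10)//.
have level1 (t : R) : (0 < t)%R ->
    [set x | t%:E < G1 x] = Q0 `&` [set x | (ga1 * t)%:E < g x].
  move=> t0; rewrite restrict_level ?(ltW t0)//; congr (_ `&` _).
  apply/seteqP; split => x /=; rewrite /h1 lte_pdivlMl//.
pose b t := fine (nu [set x | t%:E < G1 x]).
have bE t : (0 < t)%R -> nu [set x | t%:E < G1 x] = (b t)%:E.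
  move=> t0; apply: nufin; first exact: measurable_super_level.
  by rewrite level1//; exact: subIsetl.
have b0 t : (0 <= b t)%R by rewrite fine_ge0.
have gb (t ga2 : R) : (0 < t)%R -> (ga1 <= ga2)%R ->
    nu (Q0 `&` [set x | (ga2 * t)%:E < g x]) <= (b t)%:E.
  move=> t0 gg; rewrite -bE// level1//; apply: le_measure; rewrite ?inE.
  - by apply: measurableI; [exact: mQ|exact: measurable_super_level].
  - by apply: measurableI; [exact: mQ|exact: measurable_super_level].
  - move=> x [Qx /= h]; split => //=; apply: le_lt_trans h.
    by rewrite lee_fin ler_wpM2r// ltW.
pose al t := fine (nu (A t)).
have alE t : nu (A t) = (al t)%:E by exact: nufin.
have al0 t : (0 <= al t)%R by rewrite fine_ge0.
have alV t : (al t <= fine (nu Q0))%R.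
  rewrite -lee_fin -alE -(nufin Q0)//.
  by apply: le_measure; rewrite ?inE.
have rec t : (0 < t)%R -> (al (r * t) <= beta p K * al t + b t)%R.
  move=> t0; rewrite -lee_fin EFinD EFinM -!alE.
  have GL := good_lambda p1 K1 vs mF hosc mg og a l0 t0 ga0; rewrite gaE in GL.
  have mAg : measurable (A (r * t)%R `&` [set x | g x <= (ga * t)%:E]).
    apply: measurableI; first exact: mA.
    rewrite (_ : [set x | g x <= (ga * t)%:E] = ~` [set x | (ga * t)%:E < g x]); last first.
      by apply/seteqP; split => x /=; rewrite leNgt => /negP.
    by apply: measurableC; exact: measurable_super_level.
  have mQg : measurable (Q0 `&` [set x | (ga * t)%:E < g x]).
    by apply: measurableI; [exact: mQ|exact: measurable_super_level].
  apply: (@le_trans _ _ (nu (A (r * t)%R `&` [set x | g x <= (ga * t)%:E]) +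
      nu (Q0 `&` [set x | (ga * t)%:E < g x]))).
    apply: (@le_trans _ _ (nu ((A (r * t)%R `&` [set x | g x <= (ga * t)%:E]) `|`
      (Q0 `&` [set x | (ga * t)%:E < g x])))); last exact: measureU2.
    apply: le_measure; rewrite ?inE; [exact: mA|exact: measurableU|].
    move=> x Ax; have [h|h] := leP (g x) (ga * t)%:E; first by left.
    by right; split => //; exact: AQ Ax.
  apply: leeD; first exact: GL.
  by apply: gb => //; rewrite /ga1 ge_min lexx.
have HJ s M : (0 < s)%R ->
    (\sum_(k < M) (s * r ^+ k) `^ p * b (s * r ^+ k) <= J1 * fine I)%R.
  move=> s0; have := @series_level_le R p r p0 r1 _ E nu G1 mG1 G10 s s0.
  rewrite -/L IG1 muleA -EFinM -/J1 IfE -EFinM.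
  have sr k : (0 < s * r ^+ k)%R by rewrite mulr_gt0// exprn_gt0// (lt_trans _ r1).
  have ge0 k : 0 <= ((s * r ^+ k) `^ p)%:E * nu [set x | (s * r ^+ k)%:E < G1 x].
    by rewrite mule_ge0 ?lee_fin ?powR_ge0.
  move=> H; rewrite -lee_fin -sumEFin; apply: le_trans H.
  apply: le_trans (nneseries_lim_ge M _); last by move=> k _ _; exact: ge0.
  rewrite big_mkord le_eqVlt; apply/orP; left; apply/eqP.
  by apply: eq_bigr => k _; rewrite EFinM; congr (_ * _); apply: esym; apply: bE; exact: sr.
(* The factor 1/2 matches the height 2 t of [far_level_le] and reappears as 2^p in the constant. *)
pose h2 x : \bar R := (2^-1 * `|F x - c0|)%:E.
have h20 x : 0 <= h2 x by rewrite lee_fin mulr_ge0.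
have mFc : measurable_fun setT (fun x : E => `|F x - c0|)%R.
  apply: (measurableT_comp (@normr_measurable R setT)).
  by apply: measurable_funB; [exact: mF|exact: measurable_cst].
have mh2 : measurable_fun setT h2.
  by apply/measurable_EFinP; apply: measurable_funM; [exact: measurable_cst|exact: mFc].
pose G2 : E -> \bar R := h2 \_ Q0.
have mG2 : measurable_fun setT G2.
  by apply/(measurable_restrictT _ mQ).1; exact: measurable_funTS mh2.
have G20 : forall x, 0 <= G2 x by exact: restrict_ge0.
have level2 (t : R) : (0 < t)%R -> nu [set x | t%:E < G2 x] <= (al t + b t)%:E.
  move=> t0; rewrite restrict_level ?(ltW t0)//.
  have -> : [set x | t%:E < h2 x] = [set x | (2 * t < `|F x - c0|)%R].
    by apply/seteqP; split => x /=; rewrite /h2 lte_fin => h; lra.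
  have FL := far_level_le vs mF hosc mg og a l0 t0.
  apply: (le_trans FL); rewrite EFinD; apply: leeD; first by rewrite -alE.
  by have := gb t 1%R t0; rewrite mul1r; apply; rewrite /ga1 ge_min lexx orbT.
have main : \int[nu]_x (G2 x `^ p) <= (C1 * fine I)%:E.
  (* The initial term of the recursion, at most v(Q0), contributes a multiple of s^p, which is the
     remainder allowed by the layer cake. *)
  apply: (@integral_poweR_le_level R p r p0 r1 _ E nu G2 mG2 G20 _
    (r `^ p * (fine (nu Q0) / (1 - q)))%R) => s s0.
  have sr k : (0 < s * r ^+ k)%R by rewrite mulr_gt0// exprn_gt0// (lt_trans _ r1).
  apply: lime_le.
    apply: is_cvg_ereal_nneg_natsum => k _.
    by rewrite mule_ge0 ?lee_fin ?powR_ge0.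
  apply: nearW => M; rewrite big_mkord.
  apply: (@le_trans _ _ (\sum_(k < M) ((r `^ p * ((s * r ^+ k) `^ p * al (s * r ^+ k)
     + (s * r ^+ k) `^ p * b (s * r ^+ k)))%R)%:E)).
    apply: lee_sum => k _.
    apply: (@le_trans _ _ (((s * r ^+ k.+1) `^ p)%:E * (al (s * r ^+ k) + b (s * r ^+ k))%:E)).
      by rewrite lee_wpmul2l ?lee_fin ?powR_ge0// level2.
    rewrite -EFinM lee_fin -mulrDr mulrA.
    rewrite -powRM ?(ltW (sr k))//; last by rewrite ltW// (lt_trans _ r1).
    by rewrite exprS mulrCA.
  rewrite sumEFin lee_fin -mulr_sumr big_split/=.
  have rec' k : (al (s * r ^+ k.+1) <= beta p K * al (s * r ^+ k) + b (s * r ^+ k))%R.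
    have -> : (s * r ^+ k.+1 = r * (s * r ^+ k))%R by rewrite exprS mulrCA.
    exact: rec.
  have GS := @good_lambda_sum R (fun k => al (s * r ^+ k)%R) (fun k => b (s * r ^+ k)%R)
    s r p (beta p K) (fine (nu Q0)) (J1 * fine I)%R q M s0 r1 p0 be0
    (fun k => al0 _) (alV _) rec' rbeq q1 (fun k => b0 _) (HJ s M s0).
  apply: (@le_trans _ _ (r `^ p * ((s `^ p * fine (nu Q0) + r `^ p * (J1 * fine I)) / (1 - q)
     + J1 * fine I))%R).
    rewrite ler_wpM2l ?(ltW rp0)//; apply: lerD; last exact: HJ.
    exact: GS.
  rewrite le_eqVlt; apply/orP; left; apply/eqP; rewrite /C1; field.
  by rewrite gt_eqF.
have -> : \int[mu]_(x in Q0) ((`|F x - c a l| `^ p)%:E * (v x)%:E) =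
    (2 `^ p)%:E * \int[nu]_x (G2 x `^ p).
  rewrite (integral_restrict_poweR _ _ _ p0) -ge0_integralZl_EFin; last 4 first.
  - exact: mQ.
  - by move=> x _; exact: poweR_ge0.
  - by apply: measurable_funTS; exact: measurable_poweR_fun.
  - exact: powR_ge0.
  rewrite ge0_integral_density_in; last 3 first.
  - exact: mQ.
  - by apply: measurable_funeM; apply: measurable_funTS; exact: measurable_poweR_fun.
  - by move=> x _; rewrite mule_ge0 ?poweR_ge0// lee_fin powR_ge0.
  apply: eq_integral => x _; congr (_ * _); rewrite -EFinM; congr (_%:E).
  by rewrite -powRM ?mulr_ge0// mulrA mulfV ?mul1r ?c0E.
by rewrite EFinM -muleA lee_wpmul2l ?lee_fin ?powR_ge0// IfE -EFinM.
Qed.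

End local_sharp.

Lemma powR_add_le (R : realType) (x y p : R) : 0 <= x -> 0 <= y -> 0 <= p ->
  (x + y) `^ p <= 2 `^ p * (x `^ p + y `^ p).
Proof.
move=> x0 y0 p0.
have H (a b : R) : 0 <= a -> a <= b -> (a + b) `^ p <= 2 `^ p * (a `^ p + b `^ p).
  move=> a0 ab; have b0 : 0 <= b by exact: le_trans ab.
  apply: (@le_trans _ _ ((2 * b) `^ p)).
    by apply: ge0_ler_powR; rewrite ?nnegrE ?addr_ge0 ?mulr_ge0//; lra.
  by rewrite powRM// ler_wpM2l ?powR_ge0// lerDr powR_ge0.
have [xy|yx] := leP x y; first exact: H.
by rewrite (addrC x) (addrC (x `^ p)); apply: H => //; exact: ltW.
Qed.

(** * From one cube to the whole space along the centred cubes *)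

Section global_sharp.
Context (R : realType) (n : nat).
Local Notation E := (Rn R n).
Local Notation mu := (@lebesgue R n).
Local Open Scope ereal_scope.

Definition bcorner (j : nat) : E := (const_mx (- 2 ^+ j)%R : 'rV[R]_n.+1).
Definition bside (j : nat) : R := (2 ^+ j.+1)%R.
Definition bcube (j : nat) : set E := hcube (bcorner j) (bside j).

Lemma bside_gt0 j : (0 < bside j)%R.
Proof. by rewrite exprn_gt0. Qed.

Lemma bcubeP j x : bcube j x <-> forall i, (- 2 ^+ j < x ord0 i <= 2 ^+ j)%R.
Proof.
split=> [/hcubeP h i|h]; last apply/hcubeP => i; have := h i; rewrite mxE /bside exprS.
  by move=> /andP[? ?]; apply/andP; split; lra.
by move=> /andP[? ?]; apply/andP; split; lra.
Qed.

Lemma measurable_bcube j : measurable (bcube j).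
Proof. exact: measurable_hcube. Qed.

Lemma bcube_sub i j : (i <= j)%N -> bcube i `<=` bcube j.
Proof.
move=> ij x /bcubeP xi; apply/bcubeP => k; have /andP[h1 h2] := xi k.
have h : (2 ^+ i <= 2 ^+ j :> R)%R by apply: ler_weXn2l; [rewrite ler1n|exact: ij].
by apply/andP; split; lra.
Qed.

Lemma bcube_cover : \bigcup_j bcube j = [set: E].
Proof.
apply/seteqP; split => // x _.
pose M := (\sum_i `|x ord0 i|)%R.
exists (Num.truncn M).+1 => //; apply/bcubeP => i.
have xM : (`|x ord0 i| <= M)%R.
  by rewrite /M (bigD1 i)//= lerDl sumr_ge0.
have M2 : (M < 2 ^+ (Num.truncn M).+1)%R.
  apply: (lt_trans (truncnS_gt _)); by rewrite -natrX ltr_nat ltn_expl.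
have := le_lt_trans xM M2; rewrite ltr_norml => /andP[-> /ltW ->].
by [].
Qed.

Variables (p K : R) (v w : E -> R).
Hypotheses (p1 : (1 < p)%R) (K1 : (1 <= K)%R) (vs : Ap_pair p K v w).
Local Notation nu := (density_of mu (pair_mv vs) (pair_v_ge0 vs)).

Definition bweight j : R := fine (\int[mu]_(x in bcube j) (v x)%:E).

Lemma bweight_gt0 j : (0 < bweight j)%R.
Proof. exact: pair_hcube_gt0 vs (bside_gt0 j). Qed.

Lemma bweightE j : nu (bcube j) = (bweight j)%:E.
Proof.
rewrite fineK// ge0_fin_numE; first exact: pair_vfin vs _ _.
exact: integral_positive_ge0 (pair_v0 vs).
Qed.

(** A centred cube fills at most half of the next one; hence their v-measures grow at least
    geometrically. *)
Lemma bweightS j : (bweight j <= beta p K * bweight j.+1)%R.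
Proof.
apply: (pair_half_le p1 _ vs (bside_gt0 j.+1) (measurable_bcube j)).
- exact: lt_le_trans K1.
- exact: bcube_sub.
- rewrite !lebesgue_hcube ?(ltW (bside_gt0 _))// -EFinM lee_fin.
  have -> : bside j.+1 = (2 * bside j)%R by rewrite /bside exprS.
  rewrite exprMn mulrA ler_peMl ?exprn_ge0 ?(ltW (bside_gt0 _))//.
  by rewrite exprS mulrA mulVf// mul1r exprn_ege1// ler1n.
Qed.

Lemma beta_gt0 : (0 < beta p K)%R.
Proof.
have h := bweightS 0; have h0 := bweight_gt0 0; have h1 := bweight_gt0 1.
by rewrite -(pmulr_lgt0 _ h1) (lt_le_trans h0).
Qed.

Lemma beta_lt1 : (beta p K < 1)%R.
Proof.
rewrite /beta ltrBlDr ltrDl divr_gt0// ?powR_gt0//.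
exact: lt_le_trans K1.
Qed.

Lemma bweight_growth j d : (bweight j <= beta p K ^+ d * bweight (j + d))%R.
Proof.
elim: d => [|d IH]; first by rewrite expr0 mul1r addn0.
rewrite exprSr -mulrA addnS (le_trans IH)// ler_wpM2l ?exprn_ge0 ?(ltW beta_gt0)//.
exact: bweightS.
Qed.

(** Consecutive constants differ by at most a multiple of (I / v(Q_j))^(1/p), where I is the
    integral of g^p v. By the growth of v(Q_j) these bounds decay with ratio th = beta^(1/p), so the
    telescoping sum is comparable with its first term: |c_j|^p v(Q_j) <= C I. The constants can thus
    be removed from the local estimate uniformly in j. *)
Theorem global_sharp_estimate : exists2 C : R, (0 < C)%R &
  forall (F : E -> R) (c o : E -> R -> R) (g : E -> \bar R),
  measurable_fun setT F -> small_oscillation F c o ->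
  measurable_fun setT g -> (forall x, 0 <= g x) ->
  (forall a l x, (0 < l)%R -> hcube a l x -> (o a l)%:E <= g x) ->
  (forall (e : R) N, (0 < e)%R -> exists2 j, (N <= j)%N & (`|c (bcorner j) (bside j)| <= e)%R) ->
  \int[mu]_x ((`|F x| `^ p)%:E * (v x)%:E) <= C%:E * \int[mu]_x (g x `^ p * (v x)%:E).
Proof.
have p0 : (0 < p)%R by exact: lt_trans p1.
have [Cl Cl0 Hl] := local_sharp_estimate p1 K1 vs.
pose th := (beta p K `^ p^-1)%R.
have th0 : (0 < th)%R by rewrite powR_gt0 ?beta_gt0.
have th1 : (th < 1)%R.
  have := beta_lt1 => /(gt0_ltr_powR (r := p^-1)).
  rewrite invr_gt0 powR1 => /(_ p0); apply; rewrite nnegrE ?ler01//.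
  exact: ltW beta_gt0.
have thp : (th `^ p = beta p K)%R.
  by rewrite -powRrM mulVf ?gt_eqF// powRr1// ltW// beta_gt0.
pose C2 := ((2 / (1 - th)) `^ p)%R.
exists (2 `^ p * (Cl + C2))%R.
  by rewrite mulr_gt0 ?powR_gt0// addr_gt0// powR_gt0// divr_gt0// subr_gt0.
move=> F c o g mF hosc mg g0 og lim0.
set I := \int[mu]_x (g x `^ p * (v x)%:E).
have mgp : measurable_fun setT (fun x => g x `^ p) by exact: measurable_poweR_fun.
have mgv : measurable_fun setT (fun x => g x `^ p * (v x)%:E).
  by apply: emeasurable_funM; [exact: mgp|exact: measurable_EFin_in (pair_mv vs)].
have gv0 x : 0 <= g x `^ p * (v x)%:E.
  by rewrite mule_ge0 ?poweR_ge0// lee_fin (pair_v_ge0 vs).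
have I0 : 0 <= I by apply: integral_ge0 => x _; exact: gv0.
have CC0 : (0 < 2 `^ p * (Cl + C2))%R.
  by rewrite mulr_gt0 ?powR_gt0// addr_gt0// powR_gt0// divr_gt0// subr_gt0.
have [Ioo|Ifin] := eqVneq I +oo.
  by rewrite Ioo gt0_muley ?leey// lte_fin.
have IfE : I = (fine I)%:E by rewrite fineK// ge0_fin_numE// ltey.
have iI0 : (0 <= fine I)%R by rewrite fine_ge0.
have Iin j : \int[mu]_(x in bcube j) (g x `^ p * (v x)%:E) <= I.
  apply: ge0_subset_integral.
  - exact: measurable_bcube.
  - exact: measurableT.
  - exact: mgv.
  - by move=> x _; exact: gv0.
  - exact: subsetT.
pose cj j := c (bcorner j) (bside j).
(* The difference of the two constants is at most 2 g at every point of Q_j; integrate its p-th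
   power over Q_j against v. *)
have diff j : (`|cj j - cj j.+1| <= 2 * (fine I / bweight j) `^ p^-1)%R.
  have V0 := bweight_gt0 j.
  set d := (`|_|)%R.
  have dg x : bcube j x -> d%:E <= 2%:E * g x.
    move=> xj; have x1 : bcube j.+1 x by apply: bcube_sub xj.
    have o1 := og _ _ _ (bside_gt0 j) xj; have o2 := og _ _ _ (bside_gt0 j.+1) x1.
    apply: (@le_trans _ _ (o (bcorner j) (bside j) + o (bcorner j.+1) (bside j.+1))%:E).
      rewrite lee_fin; apply: (oscillation_compare mF hosc (bside_gt0 j)).
        by rewrite /bside !exprS.
      exact: bcube_sub.
    rewrite EFinD (_ : 2%:E = (1 + 1)%:E)//.
    have -> : (1 + 1)%:E * g x = g x + g x.
      by rewrite EFinD ge0_muleDl ?lee_fin// !mul1e.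
    exact: leeD.
  have int_le : (d `^ p)%:E * nu (bcube j) <= (2 `^ p)%:E * I.
    apply: (@le_trans _ _ ((2 `^ p)%:E * \int[mu]_(x in bcube j) (g x `^ p * (v x)%:E))).
      rewrite -(ge0_integral_density_in mu (pair_mv vs) (pair_v_ge0 vs)); last 3 first.
      - exact: measurable_bcube.
      - exact: measurable_funTS mgp.
      - by move=> x _; exact: poweR_ge0.
      rewrite -[leRHS]ge0_integralZl_EFin; last 4 first.
      - exact: measurable_bcube.
      - by move=> x _; exact: poweR_ge0.
      - exact: measurable_funTS mgp.
      - exact: powR_ge0.
      rewrite -integral_cst; last exact: measurable_bcube.
      apply: ge0_le_integral.
      - exact: measurable_bcube.
      - by move=> x _; rewrite lee_fin powR_ge0.
      - exact: measurable_cst.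
      - by apply: measurable_funeM; exact: measurable_funTS mgp.
      - move=> x xj /=; rewrite -!poweR_EFin -poweRM ?lee_fin//.
        by apply: lee_poweR; [exact: ltW|rewrite lee_fin normr_ge0|exact: dg].
    by rewrite lee_wpmul2l// lee_fin powR_ge0.
  rewrite bweightE IfE -!EFinM lee_fin in int_le.
  have d0 : (0 <= d)%R by exact: normr_ge0.
  have : ((d `^ p) `^ p^-1 <= (2 `^ p * (fine I / bweight j)) `^ p^-1)%R.
    apply: ge0_ler_powR; rewrite ?nnegrE ?invr_ge0 ?(ltW p0) ?powR_ge0//.
      by rewrite mulr_ge0 ?powR_ge0// divr_ge0// ltW.
    by rewrite mulrA ler_pdivlMr.
  rewrite powRM ?powR_ge0//; last by rewrite divr_ge0// ltW.
  by rewrite -!powRrM mulfV ?gt_eqF// !powRr1.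
have gr j i : ((fine I / bweight (j + i)) `^ p^-1 <= th ^+ i * (fine I / bweight j) `^ p^-1)%R.
  have Vj := bweight_gt0 j; have Vji := bweight_gt0 (j + i).
  have -> : (th ^+ i = (beta p K ^+ i) `^ p^-1)%R.
    rewrite /th -powR_mulrn ?powR_ge0// -powRrM mulrC powRrM powR_mulrn//.
    exact: ltW beta_gt0.
  rewrite -powRM ?exprn_ge0 ?(ltW beta_gt0) ?divr_ge0 ?(ltW Vj)//.
  apply: ge0_ler_powR; rewrite ?nnegrE ?invr_ge0 ?(ltW p0)//.
  - by rewrite divr_ge0// ltW.
  - by rewrite mulr_ge0 ?exprn_ge0 ?(ltW beta_gt0)// divr_ge0// ltW.
  - rewrite mulrCA ler_wpM2l// ler_pdivlMr// mulrC ler_pdivrMr//.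
    exact: bweight_growth.
have tele j d : (`|cj j| <= 2 * (fine I / bweight j) `^ p^-1 * (\sum_(i < d) th ^+ i)
    + `|cj (j + d)%N|)%R.
  elim: d => [|d IH]; first by rewrite big_ord0 mulr0 add0r addn0.
  apply: (le_trans IH); rewrite big_ord_recr/= mulrDr -addrA lerD2l addnS.
  have tri : (`|cj (j + d)%N| <= `|cj (j + d)%N - cj (j + d).+1| + `|cj (j + d).+1|)%R.
    by rewrite -{1}(subrK (cj (j + d).+1) (cj (j + d)%N)) ler_normD.
  apply: (le_trans tri); rewrite lerD2r (le_trans (diff _))//.
  rewrite -mulrA ler_wpM2l// (le_trans (gr j d))// mulrC//.
have geom d : (\sum_(i < d) th ^+ i <= (1 - th)^-1)%R.
  rewrite -(mul1r (1 - th)^-1)%R ler_pdivlMr ?subr_gt0//.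
  have := subrX1 th d; set S := (\sum_(i < d) _)%R => h.
  have : (0 <= th ^+ d)%R by rewrite exprn_ge0// ltW.
  by move: h; lra.
have cbound j : (`|cj j| <= 2 / (1 - th) * (fine I / bweight j) `^ p^-1)%R.
  apply/ler_addgt0Pr => e e0.
  (* The telescoping sum is stopped at one index where the constant is at most e. *)
  have [J jJ cJ] := lim0 e j e0.
  have := tele j (J - j)%N; rewrite subnKC// => h; apply: (le_trans h).
  apply: lerD; last exact: cJ.
  rewrite mulrAC; apply: ler_wpM2r; first exact: powR_ge0.
  by rewrite ler_wpM2l.
have cI j : ((`|cj j| `^ p)%:E * nu (bcube j) <= C2%:E * I).
  rewrite bweightE IfE -!EFinM lee_fin.
  have V0 := bweight_gt0 j.
  have a0 : (0 <= 2 / (1 - th))%R by rewrite divr_ge0// subr_ge0 ltW.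
  have : (`|cj j| `^ p <= (2 / (1 - th) * (fine I / bweight j) `^ p^-1) `^ p)%R.
    apply: ge0_ler_powR; last exact: cbound.
    - exact: ltW.
    - by rewrite nnegrE.
    - by rewrite nnegrE mulr_ge0// powR_ge0.
  rewrite powRM ?powR_ge0// -powRrM mulVf ?gt_eqF// powRr1; last first.
    by rewrite divr_ge0// ltW.
  by rewrite mulrA ler_pdivlMr.
have bI j : \int[mu]_(x in bcube j) ((`|F x| `^ p)%:E * (v x)%:E)
    <= (2 `^ p * (Cl + C2))%:E * I.
  have mQ := measurable_bcube j.
  have mFc : measurable_fun setT (fun x => (`|F x - cj j| `^ p)%:E).
    apply/measurable_EFinP; apply: measurable_powR_fun.
    apply: (measurableT_comp (@normr_measurable R setT)).
    by apply: measurable_funB; [exact: mF|exact: measurable_cst].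
  have mvQ : measurable_fun setT (fun x => (v x)%:E) by exact: measurable_EFin_in (pair_mv vs).
  have mFcv : measurable_fun (bcube j) (fun x => (`|F x - cj j| `^ p)%:E * (v x)%:E).
    by apply: measurable_funTS; exact: emeasurable_funM.
  have mcv : measurable_fun (bcube j) (fun x => (`|cj j| `^ p)%:E * (v x)%:E).
    by apply: measurable_funTS; exact: measurable_funeM.
  have Fcv0 x : 0 <= (`|F x - cj j| `^ p)%:E * (v x)%:E.
    by rewrite -EFinM lee_fin mulr_ge0 ?powR_ge0// (pair_v_ge0 vs).
  have cv0 x : 0 <= (`|cj j| `^ p)%:E * (v x)%:E.
    by rewrite -EFinM lee_fin mulr_ge0 ?powR_ge0// (pair_v_ge0 vs).
  apply: (@le_trans _ _ (\int[mu]_(x in bcube j) ((2 `^ p)%:E *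
     ((`|F x - cj j| `^ p)%:E * (v x)%:E + (`|cj j| `^ p)%:E * (v x)%:E)))).
    apply: ge0_le_integral.
    - exact: mQ.
    - by move=> x _; rewrite -EFinM lee_fin mulr_ge0 ?powR_ge0// (pair_v_ge0 vs).
    - apply: measurable_funTS; apply: emeasurable_funM; last exact: mvQ.
      apply/measurable_EFinP; apply: measurable_powR_fun.
      exact: (measurableT_comp (@normr_measurable R setT) mF).
    - by apply: measurable_funeM; apply: emeasurable_funD; [exact: mFcv|exact: mcv].
    - move=> x _ /=; rewrite -!EFinM lee_fin -mulrDl mulrA.
      rewrite ler_wpM2r ?(pair_v_ge0 vs)//.
      apply: (le_trans _ (powR_add_le (normr_ge0 _) (normr_ge0 _) (ltW p0))).
      apply: ge0_ler_powR; rewrite ?nnegrE ?(ltW p0) ?addr_ge0//.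
      by rewrite -{1}(subrK (cj j) (F x)) ler_normD.
  rewrite ge0_integralZl_EFin; last 4 first.
  - exact: mQ.
  - by move=> x _; rewrite adde_ge0.
  - by apply: emeasurable_funD; [exact: mFcv|exact: mcv].
  - exact: powR_ge0.
  rewrite EFinM -muleA; apply: lee_wpmul2l; first by rewrite lee_fin powR_ge0.
  rewrite ge0_integralD; last 5 first.
  - exact: mQ.
  - by move=> x _; exact: Fcv0.
  - exact: mFcv.
  - by move=> x _; exact: cv0.
  - exact: mcv.
  rewrite EFinD ge0_muleDl; last 2 first.
  - by rewrite lee_fin ltW.
  - by rewrite lee_fin powR_ge0.
  apply: leeD.
    apply: (le_trans (Hl _ _ _ _ mF hosc mg g0 og _ _ (bside_gt0 j))).
    by apply: lee_wpmul2l; [rewrite lee_fin ltW|exact: Iin].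
  rewrite ge0_integralZl_EFin; last 4 first.
  - exact: mQ.
  - by move=> x _; rewrite lee_fin (pair_v_ge0 vs).
  - exact: measurable_funTS mvQ.
  - exact: powR_ge0.
  exact: cI.
rewrite -bcube_cover.
have mFv : measurable_fun (\bigcup_j bcube j) (fun x => (`|F x| `^ p)%:E * (v x)%:E).
  apply: measurable_funTS; apply: emeasurable_funM.
    apply/measurable_EFinP; apply: measurable_powR_fun.
    exact: (measurableT_comp (@normr_measurable R setT) mF).
  exact: measurable_EFin_in (pair_mv vs).
have nd : nondecreasing_seq bcube by move=> i j ij; apply/subsetPset; exact: bcube_sub.
have : \int[mu]_(x in bcube i) ((`|F x| `^ p)%:E * (v x)%:E) @[i --> \oo]
    --> \int[mu]_(x in \bigcup_j bcube j) ((`|F x| `^ p)%:E * (v x)%:E).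
  apply: (@ge0_nondecreasing_set_cvg_integral _ E R bcube _ mu nd (fun i => measurable_bcube i)).
  - move=> i; apply: (measurable_funS _ _ mFv); last exact: bigcup_sup.
    by apply: bigcup_measurable => j _; exact: measurable_bcube.
  - move=> i x _; rewrite -EFinM lee_fin mulr_ge0 ?powR_ge0//.
    exact: (pair_v_ge0 vs).
by apply: cvge_le; near=> j; exact: bI.
Unshelve. all: by end_near.
Qed.

End global_sharp.

(** * A_1 majorants *)

Section rubio_de_francia.
Local Open Scope ereal_scope.

Lemma half_series_le (R : realType) (u : nat -> \bar R) (L : \bar R) :
  (forall k, 0 <= u k <= L) ->
  \sum_(0 <= k <oo) (((2^-1)%R ^+ k)%:E * u k) <= 2%:E * L.
Proof.
move=> uL; have L0 : 0 <= L by have /andP[h] := uL 0%N; exact: le_trans h.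
have u0 k : 0 <= ((2^-1)%R ^+ k)%:E * u k.
  by have /andP[h _] := uL k; rewrite mule_ge0// lee_fin exprn_ge0.
have [->|Ly] := eqVneq L +oo; first by rewrite gt0_muley ?leey// lte_fin.
have LE : L = (fine L)%:E by rewrite fineK// ge0_fin_numE// ltey.
have fL : (0 <= fine L)%R by rewrite fine_ge0.
apply: lime_le; first by apply: is_cvg_nneseries => k _ _; exact: u0.
apply: nearW => N; rewrite big_mkord.
apply: (@le_trans _ _ (\sum_(k < N) ((2^-1) ^+ k * fine L)%:E)).
  apply: lee_sum => k _; have /andP[_ h] := uL k.
  by rewrite EFinM -LE lee_wpmul2l// lee_fin exprn_ge0.
rewrite LE -EFinM sumEFin lee_fin -mulr_suml ler_wpM2r//.
have := subrX1 (2^-1 : R)%R N; set S := (\sum_(i < N) _)%R => h.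
have : (0 <= (2^-1 : R)%R ^+ N)%R by rewrite exprn_ge0.
by move: h; lra.
Qed.

Context d (T : measurableType d) (R : realType) (m : {measure set T -> \bar R}).
Variable (B : nat -> set T).
Hypotheses (mB : forall i, measurable (B i)).
Hypothesis (m_gt0 : forall i, (0 < m (B i))%E).
Hypothesis (m_fin : forall i, (m (B i) < +oo)%E).
Local Notation M := (maxop m B).

Lemma maxop_le (g : T -> \bar R) x L : 0 <= L ->
  (forall i, B i x -> average m g (B i) <= L) -> M g x <= L.
Proof.
move=> L0 h; apply: ge_ereal_sup => _ [i _ <-]; rewrite indicE.
case: (boolP (x \in B i)) => [|_]; last by rewrite mul0e.
by rewrite inE mul1e; exact: h.
Qed.

Lemma maxop_le_cst (g : T -> \bar R) (L : R) x : (0 <= L)%R ->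
  measurable_fun setT g -> (forall x, 0 <= g x <= L%:E) -> M g x <= L%:E.
Proof.
move=> L0 mg gL; apply: maxop_le => // i _.
have mi := m_gt0 i; have fi : m (B i) \is a fin_num by rewrite ge0_fin_numE.
have fi0 : (0 < fine (m (B i)))%R by rewrite fine_gt0// mi m_fin.
apply: (@le_trans _ _ ((fine (m (B i)))^-1%:E * (L%:E * m (B i)))).
  rewrite lee_wpmul2l ?lee_fin ?invr_ge0 ?(ltW fi0)// -integral_cst//.
  apply: ge0_le_integral => //.
  - by move=> x0 _; have /andP[] := gL x0.
  - exact: measurable_funTS mg.
  - by move=> x0 _; have /andP[] := gL x0.
by rewrite -(fineK fi) -!EFinM lee_fin mulrCA mulVf ?gt_eqF// mulr1.
Qed.

Lemma maxopZ (c : R) (g : T -> \bar R) x : (0 <= c)%R ->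
  measurable_fun setT g -> (forall x, 0 <= g x) ->
  M (fun y => c%:E * g y) x <= c%:E * M g x.
Proof.
move=> c0 mg g0; apply: maxop_le => [|i Bx].
  by rewrite mule_ge0 ?lee_fin// maxop_ge0.
rewrite /average ge0_integralZl_EFin//; last exact: measurable_funTS mg.
by rewrite muleCA lee_wpmul2l ?lee_fin//; exact: le_average_maxop.
Qed.

Lemma maxop_series (a : nat -> T -> \bar R) x :
  (forall k, measurable_fun setT (a k)) -> (forall k y, 0 <= a k y) ->
  M (fun y => \sum_(0 <= k <oo) a k y) x <= \sum_(0 <= k <oo) M (a k) x.
Proof.
move=> ma a0; apply: maxop_le => [|i Bx].
  by apply: nneseries_ge0 => k _ _; rewrite maxop_ge0.
rewrite /average integral_nneseries//; last by move=> k; exact: measurable_funTS.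
rewrite -nneseriesZl; last by move=> k _; exact: integral_ge0.
apply: lee_nneseries => [k _ _|k _]; last exact: le_average_maxop.
by rewrite (average_ge0 m (B i) (a0 k)).
Qed.

Variables (p : R) (v : T -> R) (C : R).
Hypotheses (p0 : (0 < p)%R) (mv : measurable_fun setT v) (v0 : forall x, (0 <= v x)%R).
Hypothesis C1 : (1 <= C)%R.
Hypothesis strong : forall g : T -> \bar R,
  measurable_fun setT g -> (forall x, 0 <= g x) ->
  \int[m]_x (M g x `^ p * (v x)%:E) <= C%:E * \int[m]_x (g x `^ p * (v x)%:E).

(* The constant makes the L^p(v) norms of the terms of the Rubio de Francia
   series sum_k K^-k M^k h decay like 2^-k. *)
Definition rdf_const : R := (2 * (2 * C) `^ p^-1)%R.
Definition rdf_iter (h : T -> \bar R) k := iter k M h.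
Definition rdf_weight (h : T -> \bar R) (x : T) : \bar R :=
  \sum_(0 <= k <oo) ((rdf_const^-1 ^+ k)%:E * rdf_iter h k x).

Lemma rdf_const_ge2 : (2 <= rdf_const)%R.
Proof.
rewrite /rdf_const ler_peMr//.
have h1 : (1 `^ p^-1 = 1 :> R)%R by rewrite powR1.
rewrite -[leLHS]h1.
have c1 := C1; apply: ge0_ler_powR; rewrite ?nnegrE ?invr_ge0 ?(ltW p0)//; lra.
Qed.

Lemma rdf_const_powR : ((2 / rdf_const) `^ p * C <= 2^-1)%R.
Proof.
have C0 : (0 < 2 * C)%R by have := C1; lra.
rewrite /rdf_const invfM mulrA mulfV// mul1r.
rewrite powRV ?powR_ge0// -powRrM mulVf ?gt_eqF// powRr1 ?(ltW C0)//.
rewrite invfM -mulrA mulVf ?mulr1//.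
by rewrite gt_eqF// (lt_le_trans _ C1).
Qed.

Section iterates.
Variables (h : T -> \bar R) (L : R).
Hypotheses (mh : measurable_fun setT h) (L0 : (0 <= L)%R).
Hypothesis hL : forall x, 0 <= h x <= L%:E.

Lemma rdf_iter_bounds k : measurable_fun setT (rdf_iter h k) /\
  forall x, 0 <= rdf_iter h k x <= L%:E.
Proof.
elim: k => [//|k [mk hk]]; rewrite /rdf_iter iterS.
have h0 x : 0 <= rdf_iter h k x by have /andP[] := hk x.
split=> [|x]; first exact: measurable_maxop.
by rewrite maxop_ge0//= maxop_le_cst.
Qed.

Let mI k : measurable_fun setT (rdf_iter h k).
Proof. exact: (rdf_iter_bounds k).1. Qed.

Let I0 k x : 0 <= rdf_iter h k x.
Proof. by have /andP[] := (rdf_iter_bounds k).2 x. Qed.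

Let K0 : (0 < rdf_const)%R.
Proof. exact: lt_le_trans rdf_const_ge2. Qed.

Let Kk0 k : (0 <= rdf_const^-1 ^+ k)%R.
Proof. by rewrite exprn_ge0// invr_ge0 ltW. Qed.

Lemma rdf_measurable : measurable_fun setT (rdf_weight h).
Proof.
apply: measurable_nneseries => [k x _|k]; first by rewrite mule_ge0 ?lee_fin.
exact: measurable_funeM.
Qed.

Lemma rdf_ge_term k x : (rdf_const^-1 ^+ k)%:E * rdf_iter h k x <= rdf_weight h x.
Proof.
rewrite /rdf_weight (nneseriesD1 (n := k))//=; last by move=> i _; rewrite mule_ge0 ?lee_fin.
by rewrite leeDl// nneseries_ge0// => i _ _; rewrite mule_ge0 ?lee_fin.
Qed.

Lemma rdf_le x : rdf_weight h x <= (2 * L)%:E.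
Proof.
rewrite EFinM; apply: (le_trans _ (half_series_le (fun k => (rdf_iter_bounds k).2 x))).
apply: lee_nneseries => [k _ _|k _]; first by rewrite mule_ge0 ?lee_fin.
rewrite lee_wpmul2r// lee_fin lerXn2r ?nnegrE ?invr_ge0 ?(ltW K0)//.
by rewrite lef_pV2 ?posrE// rdf_const_ge2.
Qed.

(** Applying M to the k-th term gives rdf_const times the term k + 1, so M of the series is at most
    rdf_const times its tail. *)
Lemma rdf_A1 x : M (rdf_weight h) x <= rdf_const%:E * rdf_weight h x.
Proof.
have a0 k y : 0 <= (rdf_const^-1 ^+ k)%:E * rdf_iter h k y by rewrite mule_ge0 ?lee_fin.
apply: (le_trans (maxop_series _ (fun k => measurable_funeM _ (mI k)) a0)).
rewrite /rdf_weight -nneseriesZl; last by move=> k _; exact: a0.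
have b0 k : 0 <= rdf_const%:E * ((rdf_const^-1 ^+ k)%:E * rdf_iter h k x).
  by rewrite mule_ge0// lee_fin ltW.
rewrite [leRHS](nneseries_split 0 1)// add0n -[X in _ + X]nneseries_addn//.
apply: (le_trans _ (leeDr _ _)); last by rewrite sume_ge0// => k _; exact: b0.
apply: lee_nneseries => [k _ _|k _]; first exact: maxop_ge0.
apply: (le_trans (maxopZ _ _ _ _)) => //.
by rewrite addn1 muleA -EFinM exprS mulrA mulfV ?gt_eqF// mul1r.
Qed.

Lemma integral_rdf_iter k : \int[m]_x (rdf_iter h k x `^ p * (v x)%:E)
  <= (C ^+ k)%:E * \int[m]_x (h x `^ p * (v x)%:E).
Proof.
elim: k => [|k IH]; first by rewrite expr0 mul1e.
apply: (le_trans (strong (mI k) (I0 k))).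
by rewrite exprS EFinM -muleA lee_wpmul2l// lee_fin (le_trans _ C1).
Qed.

(** A pointwise bound takes the place of the triangle inequality in L^p. With t_k = rho^k M^k h the
    series is the sum of 2^-k t_k, hence at most 2 sup t_k <= 2 S^(1/p), where S is the sum of the
    t_k^p. The integral of S against v is a geometric series of ratio rho^p C <= 1/2. *)
Lemma integral_rdf : \int[m]_x (rdf_weight h x `^ p * (v x)%:E)
  <= (2 * 2 `^ p)%:E * \int[m]_x (h x `^ p * (v x)%:E).
Proof.
set rho := (2 / rdf_const)%R.
have rho0 : (0 <= rho)%R by rewrite divr_ge0// ltW.
pose b k x := ((rho ^+ k) `^ p)%:E * rdf_iter h k x `^ p.
have b0 k x : 0 <= b k x by rewrite mule_ge0 ?lee_fin ?powR_ge0 ?poweR_ge0.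
have mb k : measurable_fun setT (b k).
  by apply: measurable_funeM; exact: (measurable_poweR_fun p (mI k)).
pose S x := \sum_(0 <= k <oo) b k x.
have S0 x : 0 <= S x by apply: nneseries_ge0 => k _ _; exact: b0.
have wS x : rdf_weight h x `^ p <= (2 `^ p)%:E * S x.
  have -> : S x = (S x `^ p^-1) `^ p by rewrite -poweRrM mulVf ?gt_eqF// poweRe1.
  rewrite -poweR_EFin -poweRM ?poweR_ge0 ?lee_fin//.
  apply: lee_poweR; first exact: ltW.
    by apply: nneseries_ge0 => k _ _; rewrite mule_ge0 ?lee_fin.
  apply: (le_trans _ (@half_series_le _ (fun k => (rho ^+ k)%:E * rdf_iter h k x) _ _)).
    apply: lee_nneseries => [k _ _|k _]; first by rewrite mule_ge0 ?lee_fin.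
    by rewrite muleA -EFinM -exprMn /rho mulrA mulVf// mul1r.
  move=> k; have t0 : 0 <= (rho ^+ k)%:E * rdf_iter h k x.
    by rewrite mule_ge0// lee_fin exprn_ge0.
  rewrite t0/=.
  have -> : (rho ^+ k)%:E * rdf_iter h k x = (((rho ^+ k)%:E * rdf_iter h k x) `^ p) `^ p^-1.
    by rewrite -poweRrM mulfV ?gt_eqF// poweRe1.
  apply: lee_poweR; rewrite ?invr_ge0 ?(ltW p0) ?poweR_ge0//.
  rewrite poweRM ?lee_fin ?exprn_ge0// poweR_EFin -/(b k x).
  rewrite /S (nneseriesD1 (n := k))//= leeDl// nneseries_ge0// => i _ _; exact: b0.
have mS : measurable_fun setT S by apply: measurable_nneseries.
have mvE : measurable_fun setT (fun x => (v x)%:E) by exact/measurable_EFinP.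
have vE0 x : 0 <= (v x)%:E by rewrite lee_fin.
apply: (@le_trans _ _ (\int[m]_x ((2 `^ p)%:E * (S x * (v x)%:E)))).
  apply: ge0_le_integral.
  - exact: measurableT.
  - by move=> x _; rewrite mule_ge0// poweR_ge0.
  - by apply: emeasurable_funM => //; exact: (measurable_poweR_fun p rdf_measurable).
  - by apply: measurable_funeM; exact: emeasurable_funM.
  - by move=> x _; rewrite muleA lee_wpmul2r.
rewrite ge0_integralZl_EFin; last 4 first.
- exact: measurableT.
- by move=> x _; rewrite mule_ge0.
- exact: emeasurable_funM.
- exact: powR_ge0.
rewrite (mulrC 2)%R EFinM -muleA lee_wpmul2l ?lee_fin ?powR_ge0//.
have -> : \int[m]_x (S x * (v x)%:E) = \sum_(0 <= k <oo) \int[m]_x (b k x * (v x)%:E).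
  rewrite -integral_nneseries//; last 2 first.
  - by move=> k; exact: emeasurable_funM.
  - by move=> k x _; rewrite mule_ge0.
  by apply: eq_integral => x _; rewrite [LHS]muleC /S -nneseriesZl//; apply: eq_eseriesr => k _; rewrite muleC.
set I := \int[m]_x _.
have I00 : 0 <= I by apply: integral_ge0 => x _; rewrite mule_ge0// poweR_ge0.
apply: (le_trans _ (@half_series_le _ (fun k => I) I _)); last by move=> k; rewrite I00 lexx.
apply: lee_nneseries => [k _ _|k _]; first by apply: integral_ge0 => x _; rewrite mule_ge0.
under eq_integral do rewrite /b -muleA.
rewrite ge0_integralZl_EFin; last 4 first.
- exact: measurableT.
- by move=> x _; rewrite mule_ge0// poweR_ge0.
- by apply: emeasurable_funM => //; exact: (measurable_poweR_fun p (mI k)).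
- exact: powR_ge0.
apply: (@le_trans _ _ (((rho ^+ k) `^ p)%:E * ((C ^+ k)%:E * I))).
  by rewrite lee_wpmul2l ?lee_fin ?powR_ge0//; exact: integral_rdf_iter.
rewrite muleA -EFinM lee_wpmul2r// lee_fin.
have -> : ((rho ^+ k) `^ p = (rho `^ p) ^+ k)%R.
  by rewrite -(powR_mulrn k rho0) -powRrM mulrC powRrM powR_mulrn ?powR_ge0.
rewrite -exprMn lerXn2r ?nnegrE ?mulr_ge0 ?powR_ge0 ?invr_ge0//; last exact: rdf_const_powR.
exact: le_trans C1.
Qed.

End iterates.
End rubio_de_francia.

Section A1_constant.
Context (R : realType) (n : nat).
Local Notation E := (Rn R n).
Local Notation mu := (@lebesgue R n).
Local Open Scope ereal_scope.

Lemma compact_sub_bcube (A : set E) : compact A -> exists j, A `<=` @bcube R n j.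
Proof.
move=> /(@compact_bounded R 'rV[R]_n.+1) [M [Mr HM]].
pose M' := (Num.max M 0 + 1)%R.
have MM' : (M < M')%R by rewrite ltr_pwDr// le_max lexx.
exists (Num.truncn M').+1 => x Ax; apply/bcubeP => i.
have := HM _ MM' x Ax => /=; rewrite [`|x|%R]/Num.norm/= mx_normrE => xM.
have xi : (`|x ord0 i| <= M')%R.
  by apply: le_trans xM; exact: (le_bigmax _ (fun ij : 'I_1 * 'I_n.+1 => `|x ij.1 ij.2|%R) (ord0, i)).
have M2 : (M' < 2 ^+ (Num.truncn M').+1)%R.
  by apply: (lt_trans (truncnS_gt _)); rewrite -natrX ltr_nat ltn_expl.
by have := le_lt_trans xi M2; rewrite ltr_norml => /andP[-> /ltW ->].
Qed.

Lemma locally_integrable_bounded (w : E -> R) (L : R) : measurable_fun setT w ->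
  (forall x, `|w x| <= L)%R -> locally_integrable_Rn w.
Proof.
move=> mw wL; split => // A cA.
have L0 : (0 <= L)%R by exact: le_trans (wL (const_mx 0%R)).
have mA : measurable A.
  rewrite -(setCK A); apply: measurableC; apply: open_measurable_Rn.
  by apply: closed_openC; apply: compact_closed cA; exact: norm_hausdorff.
have mnw : measurable_fun setT (fun x => `|w x|%:E).
  by apply/measurable_EFinP; exact: (measurableT_comp (@normr_measurable R setT) mw).
have [j Aj] := compact_sub_bcube cA.
apply: (@le_lt_trans _ _ (\int[mu]_(x in @bcube R n j) L%:E)).
  apply: (@le_trans _ _ (\int[mu]_(x in @bcube R n j) `|w x|%:E)).
    apply: ge0_subset_integral.
    - exact: mA.
    - exact: measurable_bcube.
    - exact: measurable_funTS.
    - by move=> x _; rewrite lee_fin.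
    - exact: Aj.
  apply: ge0_le_integral.
  - exact: measurable_bcube.
  - by move=> x _; rewrite lee_fin.
  - exact: measurable_funTS.
  - exact: measurable_cst.
  - by move=> x _; rewrite lee_fin.
rewrite integral_cst; last exact: measurable_bcube.
have := lebesgue_hcube (bcorner R n j) (ltW (bside_gt0 R j)) => h.
by rewrite [X in _ * X]h -EFinM ltry.
Qed.

Lemma emean_ge0 (A : set E) (f : E -> R) : (forall x, 0 <= f x)%R -> 0 <= emean A f.
Proof.
move=> f0; rewrite mule_ge0 ?lee_fin ?invr_ge0 ?fine_ge0//.
by apply: integral_ge0 => x _; rewrite lee_fin.
Qed.

Lemma maximal_ge0 (f : E -> R) x : 0 <= maximal f x.
Proof.
apply: (@le_trans _ _ (emean (cube x 1%R) (fun y => `|f y|%R))).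
  by apply: emean_ge0.
apply: ereal_sup_ubound; exists (x, 1%R); last by [].
by split => /= [|i]; [exact: ltr01|rewrite lexx lerDl ler01].
Qed.

Lemma le_emean_maximal (f : E -> R) a l x : (0 < l)%R -> cube a l x ->
  emean (cube a l) (fun y => `|f y|%R) <= maximal f x.
Proof. by move=> l0 ax; apply: ereal_sup_ubound; exists (a, l). Qed.

Lemma maximal_le_maxop (f : E -> R) x : measurable_fun setT f ->
  maximal f x <= (3 ^+ n.+1)%:E * maxop mu (@qset R n) (fun y => `|f y|%:E) x.
Proof.
move=> mf; apply: ge_ereal_sup => _ [[a l] /= [l0 ax] <-].
have [i [ai li il]] := exists_qset a l0.
have [cf cl cu] := lebesgue_cube_bounds a l0.
have mnf : measurable_fun setT (fun y => `|f y|%:E).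
  by apply/measurable_EFinP; exact: (measurableT_comp (@normr_measurable R setT) mf).
have h := @le_average_maxop _ _ _ mu (@qset R n) (fun y => `|f y|%:E) i x (ai _ ax).
apply: (@le_trans _ _ ((3 ^+ n.+1)%:E * average mu (fun y => `|f y|%:E) (qset i))); last first.
  by rewrite lee_wpmul2l// lee_fin exprn_ge0.
have q0 := qcube_gt0 R n i.
rewrite /average /emean (_ : fine (mu (qset i)) = (qcube R n i).2 ^+ n.+1)%R; last first.
  by have := lebesgue_hcube (qcube R n i).1 (ltW q0) => /(congr1 fine).
rewrite muleA -EFinM; apply: lee_pmul.
- by rewrite lee_fin invr_ge0 (le_trans _ cl)// exprn_ge0// ltW.
- by apply: integral_ge0 => y _; rewrite lee_fin.
- rewrite lee_fin -exprVn -exprMn -[leRHS]invrK -exprVn.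
  have l00 : (0 < l ^+ n.+1)%R by rewrite exprn_gt0.
  rewrite lef_pV2 ?posrE ?(lt_le_trans l00 cl)//; last first.
    by rewrite exprn_gt0// invr_gt0 mulr_gt0// invr_gt0.
  apply: le_trans cl; rewrite lerXn2r ?nnegrE ?(ltW l0)//.
    by rewrite invr_ge0 mulr_ge0// invr_ge0 ltW.
  by rewrite invfM invrK ler_pdivrMl.
- apply: ge0_subset_integral.
  + exact: measurable_cube.
  + exact: measurable_hcube.
  + exact: measurable_funTS.
  + by move=> y _; rewrite lee_fin.
  + exact: ai.
Qed.

Lemma emeanZ (A : set E) (f : E -> R) (c : R) : measurable A -> measurable_fun setT f ->
  (forall x, 0 <= f x)%R -> (0 <= c)%R ->
  emean A (fun x => c * f x)%R = c%:E * emean A f.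
Proof.
move=> mA mf f0 c0; rewrite /emean muleCA; congr (_ * _).
under eq_integral do rewrite EFinM.
rewrite ge0_integralZl_EFin; first by [].
- exact: mA.
- by move=> x _; rewrite lee_fin.
- by apply/measurable_EFinP; exact: measurable_funTS.
- exact: c0.
Qed.

Lemma le_emean (A : set E) (f g : E -> R) : measurable A -> measurable_fun setT f ->
  measurable_fun setT g ->
  (forall x, 0 <= f x)%R -> (forall x, f x <= g x)%R -> emean A f <= emean A g.
Proof.
move=> mA mf mg f0 fg; rewrite lee_wpmul2l ?lee_fin ?invr_ge0 ?fine_ge0//.
apply: ge0_le_integral.
- exact: mA.
- by move=> x _; rewrite lee_fin.
- by apply/measurable_EFinP; exact: measurable_funTS.
- by apply/measurable_EFinP; exact: measurable_funTS.
- by move=> x _; rewrite lee_fin.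
Qed.

Lemma maximal_comparable (u u' : E -> R) (a : R) x : measurable_fun setT u ->
  measurable_fun setT u' -> positive_fun u -> positive_fun u' -> (0 <= a)%R ->
  (forall y, u y <= a * u' y)%R -> maximal u x <= a%:E * maximal u' x.
Proof.
move=> mu_ mu' u0 u'0 a0 uu; apply: ge_ereal_sup => _ [[c l] /= [l0 cx] <-].
apply: (@le_trans _ _ (a%:E * emean (cube c l) (fun y => `|u' y|%R))); last first.
  by rewrite lee_wpmul2l ?lee_fin//; exact: le_emean_maximal.
have mnu : measurable_fun setT (fun y => `|u y|%R).
  exact: (measurableT_comp (@normr_measurable R setT) mu_).
have mnu' : measurable_fun setT (fun y => `|u' y|%R).
  exact: (measurableT_comp (@normr_measurable R setT) mu').
rewrite -emeanZ; last 4 first.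
- exact: measurable_cube.
- exact: mnu'.
- by move=> y; exact: normr_ge0.
- exact: a0.
apply: le_emean.
- exact: measurable_cube.
- exact: mnu.
- by apply: measurable_funM; [exact: measurable_cst|exact: mnu'].
- by move=> y; exact: normr_ge0.
- by move=> y; rewrite !gtr0_norm.
Qed.

Lemma lebesgue_setT_gt0 : 0 < mu [set: E].
Proof.
have h1 : mu (hcube (const_mx 0%R : E) 1%R) <= mu [set: E].
  by apply: le_outer_measure.
exact: lt_le_trans (lebesgue_hcube_gt0 _ ltr01) h1.
Qed.

Lemma A1_constE (u : E -> R) : positive_fun u ->
  A1_const u = ess_sup mu (fun x => maximal u x * ((u x)^-1)%:E).
Proof.
move=> u0; rewrite /A1_const unlock lebesgue_setT_gt0.
apply: eq_ess_sup; apply: nearW => x /=; rewrite gee0_abs// mule_ge0 ?maximal_ge0// lee_fin invr_ge0 ltW//.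
Qed.

Lemma A1_const_le (u : E -> R) (a : R) : positive_fun u ->
  (forall x, maximal u x <= a%:E * (u x)%:E) -> A1_const u <= a%:E.
Proof.
move=> u0 ua; rewrite A1_constE//; apply/ess_supP; apply: nearW => x.
by rewrite lee_pdivrMr.
Qed.

Lemma A1_const_ge0 (u : E -> R) : 0 <= A1_const u.
Proof. exact: Lnorm_ge0. Qed.

Lemma A1_const_comparable (u u' : E -> R) (a b : R) : measurable_fun setT u ->
  measurable_fun setT u' -> positive_fun u -> positive_fun u' ->
  (0 < a)%R -> (0 < b)%R ->
  (forall y, u y <= a * u' y)%R -> (forall y, u' y <= b * u y)%R ->
  A1_const u <= (a * b)%:E * A1_const u'.
Proof.
move=> mu_ mu' u0 u'0 a0 b0 uu u'u; rewrite !A1_constE//.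
rewrite -ess_sup_pZl ?mulr_gt0//; apply: le_ess_sup; apply: nearW => x /=.
rewrite EFinM muleACA; apply: lee_pmul.
- exact: maximal_ge0.
- by rewrite lee_fin invr_ge0 ltW.
- by apply: maximal_comparable => //; exact: ltW.
- have h := u0 x; have h' := u'0 x.
  by rewrite -EFinM lee_fin ler_pdivlMr// mulrC ler_pdivrMr// mulrC.
Qed.

(** Two disjoint cells of one cube of side 2: the weight is scaled on the first one, while the
    second keeps its mass visible to the maximal function at points of the first. *)
Definition unit_cell : set E := hcube (const_mx 0%R : E) 1%R.
Definition next_cell : set E := hcube (const_mx 1%R : E) 1%R.

Lemma unit_cell_sub : unit_cell `<=` cube (const_mx 0%R : E) 2%R.
Proof.
by move=> x /hcubeP h i; have := h i; rewrite mxE => /andP[? ?]; apply/andP; split; lra.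
Qed.

Lemma next_cell_sub : next_cell `<=` cube (const_mx 0%R : E) 2%R.
Proof.
by move=> x /hcubeP h i; have := h i; rewrite !mxE => /andP[? ?]; apply/andP; split; lra.
Qed.

Lemma next_cell_off x : next_cell x -> ~ unit_cell x.
Proof.
move=> /hcubeP h /hcubeP h'; have := h ord0; have := h' ord0.
by rewrite !mxE => /andP[? ?] /andP[? ?]; lra.
Qed.

Lemma lebesgue_unit (a : E) : mu (hcube a 1%R) = 1.
Proof. by rewrite lebesgue_hcube ?ler01// expr1n. Qed.

Lemma maximal_ge_integral (u : E -> R) (A : set E) x : measurable_fun setT u ->
  positive_fun u -> measurable A -> A `<=` cube (const_mx 0%R : E) 2%R ->
  cube (const_mx 0%R : E) 2%R x ->
  ((4 ^+ n.+1)^-1)%:E * \int[mu]_(y in A) (u y)%:E <= maximal u x.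
Proof.
move=> mu_ u0 mA A2 x2.
apply: le_trans (le_emean_maximal _ _ x2); last by [].
have [cf cl cu] := lebesgue_cube_bounds (const_mx 0%R : E) (ltr0Sn R 1).
apply: lee_pmul.
- by rewrite lee_fin invr_ge0 exprn_ge0.
- exact: integral_positive_ge0.
- have c0 : (0 < fine (mu (cube (const_mx 0%R : E) 2%R)))%R.
    by apply: lt_le_trans cl; rewrite exprn_gt0.
  rewrite lee_fin lef_pV2 ?posrE ?exprn_gt0//; apply: (le_trans cu).
  by rewrite -natrM.
- under [leRHS]eq_integral => y _ do rewrite gtr0_norm ?u0//.
  apply: ge0_subset_integral.
  + exact: mA.
  + exact: measurable_cube.
  + exact: measurable_EFin_in.
  + by move=> y _; rewrite lee_fin ltW// u0.
  + exact: A2.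
Qed.

End A1_constant.

(* A one-sided log-Lipschitz bound replaces continuity: f takes the value t0 at
   the supremum of {t0 <= f}. *)
Lemma hits_value (R : realType) (f : R -> R) (a t0 : R) : 0 < a <= 1 -> 0 < t0 ->
  (forall s t, a <= s -> s <= t -> t <= 1 -> f s <= t / s * f t) ->
  t0 <= f a -> f 1 < t0 -> exists2 s, a <= s <= 1 & f s = t0.
Proof.
move=> /andP[a0 a1] t00 H fa f1.
pose S := [set t | a <= t <= 1 /\ t0 <= f t].
have Sa : S a by split => //; rewrite lexx a1.
have hS : has_sup S by split; [exists a|exists 1 => t [/andP[]]].
set s := sup S.
have as_ : a <= s by exact: ub_le_sup hS.2 _ Sa.
have s1 : s <= 1 by apply: ge_sup; [exists a|move=> t [/andP[]]].
have s0 : 0 < s by exact: lt_le_trans as_.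
exists s; first by rewrite as_.
apply/eqP; rewrite eq_le; apply/andP; split; rewrite leNgt; apply/negP => fs.
  have sl1 : s < 1.
    by rewrite lt_neqAle s1 andbT; apply/eqP => s1E; move: fs; rewrite s1E ltNge ltW.
  (* If f(s) > t0, the bound f(s) <= t / s f(t) keeps f at least t0 up to t = s f(s) / t0 > s,
     against the choice of s. *)
  pose t := Num.min 1 (s * f s / t0).
  have st : s < t.
    by rewrite lt_min sl1/= ltr_pdivlMr// ltr_pM2l.
  have t1 : t <= 1 by rewrite ge_min lexx.
  have t_0 : 0 < t by exact: lt_trans st.
  have := H _ _ as_ (ltW st) t1.
  rewrite mulrAC ler_pdivlMr// => h.
  have St : S t.
    split; first by rewrite t1 (le_trans as_ (ltW st)).
    have tle : t * t0 <= s * f s by rewrite -ler_pdivlMr// ge_min lexx orbT.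
    rewrite -(ler_pM2l t_0); lra.
  by have := ub_le_sup hS.2 St; rewrite leNgt st.
(* If f(s) < t0, a point t of S close enough to s violates f(t) <= s / t f(s). *)
have [t [/andP[ta t1] tf] st] : exists2 t, S t & s - s * (1 - f s / t0) < t.
  apply: sup_adherent hS; rewrite mulr_gt0// subr_gt0 ltr_pdivrMr//; lra.
have ts : t <= s by apply: ub_le_sup hS.2 _ _; split => //; rewrite ta.
have t_0 : 0 < t by exact: lt_le_trans ta.
have := H _ _ ta ts s1; rewrite mulrAC ler_pdivlMr// => h.
have e : (s - s * (1 - f s / t0)) * t0 = s * f s by field; rewrite gt_eqF.
have : s * f s < t * t0 by rewrite -e ltr_pM2r.
have : t0 * t <= f t * t by rewrite ler_pM2r.
lra.
Qed.

(** Arithmetic for [A1_scaled_min]: x and y are the integrals of w over the unit cell and the next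
    cell, q is 4^(n+1), Q is 16^(n+1), and t is the prescribed A_1 constant. *)
Lemma scaling_contradiction (R : realType) (q Q K t x y : R) : 0 < q -> 0 < K -> 0 < t ->
  Q = q * q -> q^-1 * y <= t * (2 * Q * K * t)^-1 * x -> q^-1 * x <= K * y -> 0 < y -> False.
Proof.
move=> q0 k0 t0 ->; rewrite ler_pdivrMl// => h1; rewrite ler_pdivrMl// => h2 y0.
have e : q * (t * (2 * (q * q) * K * t)^-1 * x) = x / (2 * q * K).
  by field; rewrite !gt_eqF.
move: h1; rewrite e ler_pdivlMr ?mulr_gt0// => h1.
have h3 : 0 < q * (K * y) by rewrite !mulr_gt0.
have e2 : y * (2 * q * K) = 2 * (q * (K * y)) by ring.
by move: h1; rewrite e2; lra.
Qed.

(** * Prescribing the value of the A_1 constant by scaling on one cell *)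

Section exact_A1_constant.
Context (R : realType) (n : nat).
Local Notation E := (Rn R n).
Local Notation mu := (@lebesgue R n).
Local Open Scope ereal_scope.
Variables (K1 : R).
Hypothesis K11 : (1 <= K1)%R.

(** A value strictly above the A_1 constant of the unscaled weight, so that it is attained between
    the scalings 1 and [min_scaling]. *)
Definition target_A1 : R := (K1 + 1)%R.
(** At this scaling the A_1 constant exceeds the target. Each comparison of the two cells through
    the cube of side 2 costs 4^(n+1); two of them are made, whence 16^(n+1), and the 2 makes the
    contradiction strict. *)
Definition min_scaling : R := ((2 * 16 ^+ n.+1 * K1 * target_A1)^-1)%R.

Definition scaled (w : E -> R) (t : R) (x : E) : R :=
  (w x * (1 - (1 - t) * \1_(@unit_cell R n) x))%R.

Lemma scaled_in w t x : @unit_cell R n x -> scaled w t x = (t * w x)%R.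
Proof. by move=> xU; rewrite /scaled indicE mem_set//=; ring. Qed.

Lemma scaled_off w t x : ~ @unit_cell R n x -> scaled w t x = w x.
Proof. by move=> xU; rewrite /scaled indicE memNset//=; ring. Qed.

Lemma measurable_scaled w t : measurable_fun setT w -> measurable_fun setT (scaled w t).
Proof.
move=> mw; apply: measurable_funM; first exact: mw.
apply: measurable_funB; first exact: measurable_cst.
apply: measurable_funM; first exact: measurable_cst.
by apply: measurable_indic; exact: measurable_hcube.
Qed.

Lemma target_A1_gt0 : (0 < target_A1)%R.
Proof. by have := K11; rewrite /target_A1; lra. Qed.

Lemma min_scaling_gt0 : (0 < min_scaling)%R.
Proof.
have t0 := target_A1_gt0; have k1 : (0 < K1)%R by exact: lt_le_trans K11.
by rewrite invr_gt0 !mulr_gt0 ?exprn_gt0.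
Qed.

Lemma min_scaling_le1 : (min_scaling <= 1)%R.
Proof.
have t0 := target_A1_gt0; have k1 : (0 < K1)%R by exact: lt_le_trans K11.
rewrite invf_le1 ?mulr_gt0 ?exprn_gt0//.
rewrite !mulr_ege1 ?exprn_ege1 ?ler1n//.
by rewrite /target_A1 lerDr ltW.
Qed.

Variables (w : E -> R).
Hypotheses (mw : measurable_fun setT w) (w0 : positive_fun w).
Hypothesis (wL : \int[mu]_(x in @next_cell R n) (w x)%:E < +oo).
Hypothesis (wA1 : forall x, maximal w x <= K1%:E * (w x)%:E).

Lemma scaled_gt0 t : (0 < t)%R -> positive_fun (scaled w t).
Proof.
move=> t0 x; have w1 := w0 x; have [xU|xU] := pselect (@unit_cell R n x).
  by rewrite scaled_in// mulr_gt0.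
by rewrite scaled_off.
Qed.

Lemma scaled_mono s t x : (0 < s)%R -> (s <= t)%R -> (scaled w s x <= scaled w t x)%R.
Proof.
move=> s0 st; have w1 := w0 x; have [xU|xU] := pselect (@unit_cell R n x).
  by rewrite !scaled_in// ler_wpM2r// ltW.
by rewrite !scaled_off.
Qed.

Lemma scaled_ratio s t x : (0 < s)%R -> (s <= t)%R ->
  (scaled w t x <= t / s * scaled w s x)%R.
Proof.
move=> s0 st; have w1 := w0 x; have [xU|xU] := pselect (@unit_cell R n x).
  by rewrite !scaled_in// mulrA divfK// gt_eqF.
by rewrite !scaled_off// ler_peMl ?(ltW w1)// ler_pdivlMr// mul1r.
Qed.

Lemma A1_scaled1 : A1_const (scaled w 1%R) <= K1%:E.
Proof.
rewrite (_ : scaled w 1%R = w); first exact: A1_const_le.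
by apply/funext => x; rewrite /scaled subrr mul0r subr0 mulr1.
Qed.

Lemma A1_scaled_le s t : (0 < s)%R -> (s <= t)%R ->
  A1_const (scaled w s) <= (t / s)%:E * A1_const (scaled w t).
Proof.
move=> s0 st; have t0 : (0 < t)%R by exact: lt_le_trans st.
rewrite -(mul1r (t / s)%R); apply: A1_const_comparable.
- exact: measurable_scaled.
- exact: measurable_scaled.
- exact: scaled_gt0.
- exact: scaled_gt0.
- exact: ltr01.
- by rewrite divr_gt0.
- by move=> y; rewrite mul1r; exact: scaled_mono.
- by move=> y; exact: scaled_ratio.
Qed.

Lemma A1_scaled_fin s : (0 < s <= 1)%R -> A1_const (scaled w s) < +oo.
Proof.
move=> /andP[s0 s1]; apply: (le_lt_trans (A1_scaled_le s0 s1)).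
apply: (@le_lt_trans _ _ ((1 / s)%:E * K1%:E)); last by rewrite -EFinM ltry.
rewrite lee_wpmul2l ?lee_fin; [by []|by rewrite divr_ge0// ltW|exact: A1_scaled1].
Qed.

Let mU : measurable (@unit_cell R n). Proof. exact: measurable_hcube. Qed.
Let mN : measurable (@next_cell R n). Proof. exact: measurable_hcube. Qed.
Let mwA (A : set E) : measurable_fun A (fun x => (w x)%:E).
Proof. exact: measurable_EFin_in. Qed.

Let X := \int[mu]_(y in @unit_cell R n) (w y)%:E.
Let Y := \int[mu]_(y in @next_cell R n) (w y)%:E.

(** The A_1 condition at the points of the next cell, whose maximal function sees the unit cell. It
    also shows that X is finite, since Y is. *)
Let XY : ((4 ^+ n.+1)^-1)%:E * X <= K1%:E * Y.
Proof.
have K10 : (0 <= K1)%R by exact: le_trans ler01 K11.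
rewrite /Y -[leRHS]ge0_integralZl_EFin; last 4 first.
- exact: mN.
- by move=> y _; rewrite lee_fin ltW// w0.
- exact: mwA.
- exact: K10.
have h : \int[mu]_(y in @next_cell R n) (((4 ^+ n.+1)^-1)%:E * X) = ((4 ^+ n.+1)^-1)%:E * X.
  rewrite integral_cst; last exact: mN.
  by rewrite [X in _ * X]lebesgue_unit mule1.
rewrite -[leLHS]h; apply: ge0_le_integral.
- exact: mN.
- move=> y _; rewrite mule_ge0 ?lee_fin ?invr_ge0 ?exprn_ge0//.
  exact: integral_positive_ge0.
- exact: measurable_cst.
- by apply: measurable_funeM; exact: mwA.
- move=> y yN; apply: le_trans (wA1 y).
  apply: maximal_ge_integral => //; first exact: unit_cell_sub.
  exact: next_cell_sub.
Qed.

(* On the unit cell the scaled weight is small while its maximal function still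
   sees the mass of w on the next cell. *)
Lemma A1_scaled_min : target_A1%:E < A1_const (scaled w min_scaling).
Proof.
rewrite ltNge; apply/negP.
have ms0 := min_scaling_gt0; have us := scaled_gt0 ms0.
have mus := measurable_scaled min_scaling mw.
rewrite A1_constE// => /ess_supP hae.
have Y0 : 0 < Y.
  apply: integral_gt0_of_pos => //.
  by rewrite [X in _ < X]lebesgue_unit lte01.
have YE : Y = (fine Y)%:E by rewrite fineK// ge0_fin_numE ?(ltW Y0).
have uY : \int[mu]_(y in @next_cell R n) (scaled w min_scaling y)%:E = Y.
  apply: eq_integral => y; rewrite inE => yN; rewrite scaled_off//.
  exact: next_cell_off.
have c40 : (0 <= (4 ^+ n.+1)^-1 :> R)%R by rewrite invr_ge0 exprn_ge0.
have t0 := target_A1_gt0.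
have step : ((4 ^+ n.+1)^-1)%:E * Y <= (target_A1 * min_scaling)%:E * X.
  rewrite /X -[leRHS]ge0_integralZl_EFin; last 4 first.
  - exact: mU.
  - by move=> y _; rewrite lee_fin ltW// w0.
  - exact: mwA.
  - by rewrite mulr_ge0// ltW.
  have h : \int[mu]_(y in @unit_cell R n) (((4 ^+ n.+1)^-1)%:E * Y) = ((4 ^+ n.+1)^-1)%:E * Y.
    rewrite integral_cst; last exact: mU.
    by rewrite [X in _ * X]lebesgue_unit mule1.
  rewrite -[leLHS]h; apply: ae_ge0_le_integral.
  - exact: mU.
  - by move=> y _; rewrite mule_ge0// ltW.
  - exact: measurable_cst.
  - by move=> y _; rewrite -EFinM lee_fin !mulr_ge0 ?(ltW t0) ?(ltW ms0)// ltW// w0.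
  - by apply: measurable_funeM; exact: mwA.
  - apply: filterS hae => y h1 yU.
    have h2 := maximal_ge_integral mus us mN (@next_cell_sub R n) (@unit_cell_sub R n y yU).
    rewrite uY in h2; apply: (le_trans h2).
    move: h1; rewrite lee_pdivrMr; last exact: us.
    by rewrite scaled_in// -EFinM mulrA.
have [x xE] : exists x, X = x%:E.
  exists (fine X); rewrite fineK// ge0_fin_numE; last exact: integral_positive_ge0.
  rewrite ltey; apply/eqP => Xoo.
  by move: XY; rewrite Xoo gt0_muley ?lte_fin ?invr_gt0 ?exprn_gt0// YE -EFinM leye_eq.
have [y yE] : exists y, Y = y%:E by exists (fine Y).
have h1 := step; have h2 := XY; have h3 := Y0.
rewrite xE yE -!EFinM !lee_fin in h1 h2; rewrite yE lte_fin in h3.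
apply: scaling_contradiction h1 h2 h3.
- by rewrite exprn_gt0.
- exact: lt_le_trans K11.
- exact: t0.
- by rewrite -exprMn -natrM.
Qed.

Theorem exact_A1_const : exists s : R, [/\ (min_scaling <= s <= 1)%R,
  A1_const (scaled w s) < +oo & fine (A1_const (scaled w s)) = target_A1].
Proof.
have ms0 := min_scaling_gt0; have ms1 := min_scaling_le1.
have fE s : (min_scaling <= s)%R -> (s <= 1)%R ->
    A1_const (scaled w s) = (fine (A1_const (scaled w s)))%:E.
  move=> ms s1; rewrite fineK// ge0_fin_numE ?A1_const_ge0// A1_scaled_fin//.
  by rewrite s1 (lt_le_trans ms0).
have [s s01 fs] : exists2 s, (min_scaling <= s <= 1)%R &
    fine (A1_const (scaled w s)) = target_A1.
  apply: hits_value.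
  - by rewrite ms0.
  - exact: target_A1_gt0.
  - move=> s t ms st t1; have s0 : (0 < s)%R by exact: lt_le_trans ms.
    have := A1_scaled_le s0 st; rewrite fE//; last exact: le_trans t1.
    by rewrite (fE t)//; exact: le_trans st.
  - by have := ltW A1_scaled_min; rewrite fE.
  - have := A1_scaled1; rewrite fE// lee_fin => h; apply: (le_lt_trans h).
    by rewrite /target_A1 ltrDl.
exists s; split => //; apply: A1_scaled_fin.
by have /andP[h ->] := s01; rewrite (lt_le_trans ms0 h).
Qed.

End exact_A1_constant.

Section A1_majorant.
Context (R : realType) (n : nat).
Local Notation E := (Rn R n).
Local Notation mu := (@lebesgue R n).
Local Notation M := (maxop mu (@qset R n)).
Local Open Scope ereal_scope.

(** Every point lies in a rational cube that contains the unit cell as well. *)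
Lemma maxop_unit_gt0 (h : E -> \bar R) (e : R) x : (0 < e)%R ->
  measurable_fun setT h -> (forall y, 0 <= h y) ->
  (forall y, @unit_cell R n y -> e%:E <= h y) -> 0 < M h x.
Proof.
move=> e0 mh h0 eh.
have [j _ xj] : (\bigcup_j @bcube R n j) x by rewrite bcube_cover.
have [i [ji _ _]] := exists_qset (bcorner R n j) (bside_gt0 R j).
have jQ : @bcube R n j `<=` qset i.
  by move=> y /hcube_sub_cube; exact: ji.
have UQ : @unit_cell R n `<=` qset i.
  move=> y yU; apply: jQ; apply: (@bcube_sub R n 0 j) => //; apply/bcubeP => k.
  by move: yU => /hcubeP /(_ k); rewrite mxE expr0 => /andP[? ?]; apply/andP; split; lra.
apply: (lt_le_trans _ (le_average_maxop _ _ (jQ _ xj))).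
have q0 := qcube_gt0 R n i.
rewrite /average mule_gt0 ?lte_fin ?invr_gt0//.
  rewrite fine_gt0// (lebesgue_hcube_gt0 _ q0)//=.
  exact: lebesgue_hcube_lty q0.
apply: (@lt_le_trans _ _ (\int[mu]_(y in @unit_cell R n) e%:E)).
  rewrite integral_cst; last exact: measurable_hcube.
  by rewrite [X in _ * X]lebesgue_unit mule1 lte_fin.
apply: (@le_trans _ _ (\int[mu]_(y in @unit_cell R n) h y)).
  apply: ge0_le_integral.
  - exact: measurable_hcube.
  - by move=> y _; rewrite lee_fin ltW.
  - exact: measurable_cst.
  - exact: measurable_funTS mh.
  - exact: eh.
apply: ge0_subset_integral.
- exact: measurable_hcube.
- exact: measurable_hcube.
- exact: measurable_funTS mh.
- by move=> y _; exact: h0.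
- exact: UQ.
Qed.

(** The Rubio de Francia weight of |f| plus a small bump on the unit cell. Boundedness of f keeps
    the series finite everywhere; the bump makes it positive at every point even for f = 0, as the
    scaling of the A_1 constant requires, and costs the error e. *)
Theorem exists_A1_majorant (p K : R) (v s : E -> R) : (1 < p)%R -> (1 <= K)%R ->
  Ap_pair p K v s -> exists K1 C : R, [/\ (1 <= K1)%R, (0 < C)%R &
  forall (f : E -> R) (L e : R), measurable_fun setT f -> (forall x, `|f x| <= L)%R ->
  (0 < e)%R -> exists w : E -> R,
  [/\ measurable_fun setT w /\ positive_fun w, (forall x, `|f x| <= w x)%R,
    exists L', (forall x, w x <= L')%R,
    forall x, maximal w x <= K1%:E * (w x)%:E &
    \int[mu]_x ((w x `^ p)%:E * (v x)%:E) <=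
      C%:E * (\int[mu]_x ((`|f x| `^ p)%:E * (v x)%:E) + e%:E)]].
Proof.
move=> p1 K11 vs; have p0 : (0 < p)%R by exact: lt_trans p1.
have K0 : (0 < K)%R by exact: lt_le_trans K11.
have [C' C'0 HC'] := muckenhoupt_Rn p1 K0 vs.
pose C := Num.max C' 1%R; have C1 : (1 <= C)%R by rewrite le_max lexx orbT.
have mv := pair_mv vs; have v0 := pair_v_ge0 vs.
have strong (g : E -> \bar R) : measurable_fun setT g -> (forall x, 0 <= g x) ->
    \int[mu]_x (M g x `^ p * (v x)%:E) <= C%:E * \int[mu]_x (g x `^ p * (v x)%:E).
  move=> mg g0; apply: (le_trans (HC' g mg g0)); apply: lee_wpmul2r.
    by apply: integral_ge0 => x _; rewrite mule_ge0 ?poweR_ge0// lee_fin v0.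
  by rewrite lee_fin le_max lexx.
have rc2 := rdf_const_ge2 p0 C1.
pose rc := rdf_const p C; rewrite -/rc in rc2.
have rc0 : (0 < rc)%R by exact: lt_le_trans rc2.
exists (3 ^+ n.+1 * rc)%R, (2 * 2 `^ p * 2 `^ p)%R; split.
- by rewrite mulr_ege1// ?exprn_ege1// ?ler1n//; lra.
- by rewrite !mulr_gt0// powR_gt0.
move=> f L e mf fL e0.
have L0 : (0 <= L)%R by exact: le_trans (fL (const_mx 0%R)).
have mU : measurable (@unit_cell R n) by exact: measurable_hcube.
pose VU := fine (\int[mu]_(x in @unit_cell R n) (v x)%:E).
have VU0 : (0 < VU)%R by exact: pair_hcube_gt0 vs ltr01.
have VUE : \int[mu]_(x in @unit_cell R n) (v x)%:E = VU%:E.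
  rewrite fineK// ge0_fin_numE; first exact: pair_vfin vs _ _.
  exact: integral_positive_ge0 (pair_v0 vs).
(* The height of a bump on the unit cell whose p-th power has v-integral e. *)
pose eta := ((e / VU) `^ p^-1)%R.
have eta0 : (0 < eta)%R by apply: powR_gt0; exact: divr_gt0.
have etap : (eta `^ p * VU = e)%R.
  by rewrite -powRrM mulVf ?gt_eqF// powRr1 ?divr_ge0 ?(ltW e0) ?(ltW VU0)// divfK// gt_eqF.
pose hr x := (`|f x| + eta * \1_(@unit_cell R n) x)%R.
have hr0 x : (0 <= hr x)%R by rewrite addr_ge0// mulr_ge0 ?(ltW eta0)// indicE.
have mnf : measurable_fun setT (fun x => `|f x|%R).
  exact: (measurableT_comp (@normr_measurable R setT) mf).
have mind : measurable_fun setT (fun x => eta * \1_(@unit_cell R n) x)%R.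
  by apply: measurable_funM; [exact: measurable_cst|exact: measurable_indic].
have mhr : measurable_fun setT hr by apply: measurable_funD; [exact: mnf|exact: mind].
pose h x := (hr x)%:E.
have mh : measurable_fun setT h by exact/measurable_EFinP.
have hL x : 0 <= h x <= (L + eta)%:E.
  rewrite !lee_fin hr0/=; apply: lerD; first exact: fL.
  by rewrite ler_piMr ?(ltW eta0)// indicE; case: (_ \in _).
have Le0 : (0 <= L + eta)%R by rewrite addr_ge0// ltW.
pose W := rdf_weight mu (@qset R n) p C h.
have mq i : measurable (@qset R n i) by exact: measurable_hcube.
have q0 i : 0 < mu (@qset R n i) by exact: lebesgue_hcube_gt0 (qcube_gt0 R n i).
have qy i : mu (@qset R n i) < +oo by exact: lebesgue_hcube_lty (qcube_gt0 R n i).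
have mW : measurable_fun setT W by exact: (rdf_measurable mq q0 qy p0 C1 mh Le0 hL).
have hW x : h x <= W x.
  have := rdf_ge_term mq q0 qy p0 C1 mh Le0 hL 0 x.
  by rewrite expr0 mul1e.
have Wpos x : 0 < W x.
  apply: (lt_le_trans _ (rdf_ge_term mq q0 qy p0 C1 mh Le0 hL 1 x)).
  rewrite mule_gt0//; first by rewrite lte_fin expr1 invr_gt0.
  apply: (maxop_unit_gt0 _ eta0 mh) => [y|y yU]; first by have /andP[] := hL y.
  by rewrite lee_fin /hr indicE mem_set// mulr1 lerDr.
have WL x : W x <= (2 * (L + eta))%:E by exact: (rdf_le mq q0 qy p0 C1 mh Le0 hL x).
have WA x : M W x <= rc%:E * W x by exact: (rdf_A1 mq q0 qy p0 C1 mh Le0 hL x).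
have Wint := integral_rdf mq q0 qy p0 mv v0 C1 strong mh Le0 hL.
pose w x := fine (W x).
have wE x : (w x)%:E = W x.
  by rewrite fineK// ge0_fin_numE ?(ltW (Wpos x))// (le_lt_trans (WL x))// ltry.
have w0 : positive_fun w by move=> x; rewrite -lte_fin wE.
have mw : measurable_fun setT w.
  by apply/measurable_EFinP; rewrite (_ : EFin \o w = W)//; apply/funext => x /=; rewrite wE.
exists w; split.
- by split.
- move=> x; rewrite -lee_fin wE; apply: le_trans (hW x).
  by rewrite lee_fin lerDl mulr_ge0 ?(ltW eta0)// indicE.
- by exists (2 * (L + eta))%R => x; rewrite -lee_fin wE.
- move=> x; apply: (le_trans (maximal_le_maxop x mw)).
  rewrite EFinM -muleA; apply: lee_wpmul2l; first by rewrite lee_fin exprn_ge0.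
  rewrite (_ : (fun y => _) = W); last first.
    by apply/funext => y; rewrite gtr0_norm ?wE//; exact: w0.
  by rewrite wE.
- apply: (@le_trans _ _ (\int[mu]_x (W x `^ p * (v x)%:E))).
    apply: (eq_ind _ (fun z => z <= _) (lexx _)); apply: eq_integral => x _.
    by rewrite -wE poweR_EFin.
  apply: (le_trans Wint); rewrite (EFinM (2 * 2 `^ p)%R (2 `^ p)%R) -muleA.
  apply: lee_wpmul2l; first by rewrite lee_fin mulr_ge0// powR_ge0.
  have mvE : measurable_fun setT (fun x => (v x)%:E) by exact: measurable_EFin_in mv.
  have mfp : measurable_fun setT (fun x => (`|f x| `^ p)%:E).
    by apply/measurable_EFinP; exact: measurable_powR_fun.
  have mfpv : measurable_fun setT (fun x => (`|f x| `^ p)%:E * (v x)%:E).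
    exact: emeasurable_funM.
  have fpv0 x : 0 <= (`|f x| `^ p)%:E * (v x)%:E.
    by rewrite -EFinM lee_fin mulr_ge0 ?powR_ge0// v0.
  pose k x := (eta `^ p)%:E * ((v x)%:E * (\1_(@unit_cell R n) x)%:E).
  have mk : measurable_fun setT (fun x => (v x)%:E * (\1_(@unit_cell R n) x)%:E).
    by apply: emeasurable_funM; [exact: mvE|apply/measurable_EFinP; exact: measurable_indic].
  have k0 x : 0 <= (v x)%:E * (\1_(@unit_cell R n) x)%:E.
    by rewrite -EFinM lee_fin mulr_ge0 ?v0// indicE.
  have kI : \int[mu]_x k x = e%:E.
    rewrite ge0_integralZl_EFin; last 4 first.
    - exact: measurableT.
    - by move=> x _; exact: k0.
    - exact: mk.
    - exact: powR_ge0.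
    rewrite -etap EFinM -VUE; congr (_ * _).
    by rewrite [RHS]integral_mkcond; apply: eq_integral => x _; rewrite /= patchE indicE; case: ifP => _; rewrite ?mule1 ?mule0.
  apply: (@le_trans _ _ (\int[mu]_x ((2 `^ p)%:E * ((`|f x| `^ p)%:E * (v x)%:E + k x)))).
    apply: ge0_le_integral.
    - exact: measurableT.
    - by move=> x _; rewrite mule_ge0 ?poweR_ge0// lee_fin v0.
    - by apply: emeasurable_funM; [exact: (measurable_poweR_fun p mh)|exact: mvE].
    - apply: measurable_funeM; apply: emeasurable_funD; first exact: mfpv.
      exact: measurable_funeM.
    - move=> x _; rewrite /h poweR_EFin /k -!EFinM lee_fin /hr.
      rewrite [leLHS]mulrC [leRHS](_ : _ = v x *
        (2 `^ p * (`|f x| `^ p + eta `^ p * \1_(@unit_cell R n) x)))%R; last by ring.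
      apply: ler_wpM2l; first exact: v0.
      have ind0 : (0 <= eta * \1_(@unit_cell R n) x)%R by rewrite mulr_ge0 ?(ltW eta0)// indicE.
      apply: (le_trans (powR_add_le (normr_ge0 _) ind0 (ltW p0))).
      apply: ler_wpM2l; first exact: powR_ge0.
      rewrite lerD2l indicE; case: (_ \in _); rewrite /= ?mulr1//.
      by rewrite !mulr0 powR0// gt_eqF.
  rewrite ge0_integralZl_EFin; last 4 first.
  - exact: measurableT.
  - by move=> x _; rewrite adde_ge0// mule_ge0// lee_fin powR_ge0.
  - by apply: emeasurable_funD; [exact: mfpv|exact: measurable_funeM].
  - exact: powR_ge0.
  rewrite ge0_integralD; last 5 first.
  - exact: measurableT.
  - by move=> x _; exact: fpv0.
  - exact: mfpv.
  - by move=> x _; rewrite mule_ge0// lee_fin powR_ge0.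
  - exact: measurable_funeM.
  by rewrite kI.
Qed.

End A1_majorant.

(** * Oscillation on balls and the commutator *)

Section balls.
Context (R : realType) (n : nat).
Local Notation E := (Rn R n).
Local Notation mu := (@lebesgue R n).

Definition sqdist (c x : E) : R := \sum_(i < n.+1) (x ord0 i - c ord0 i) ^+ 2.

Lemma eballP (c : E) (r : R) x : 0 < r -> eball c r x <-> sqdist c x < r ^+ 2.
Proof.
move=> r0; rewrite /eball/= -/(sqdist c x).
rewrite -[r in Num.sqrt _ < r]ger0_norm ?(ltW r0)// -sqrtr_sqr.
by rewrite ltr_sqrt// exprn_gt0.
Qed.

Lemma eball_coord (c : E) (r : R) x i : 0 < r -> eball c r x -> `|x ord0 i - c ord0 i| < r.
Proof.
move=> r0 /eballP-/(_ r0) xr.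
rewrite -(ltr_pXn2r (n := 2))// ?nnegrE ?(ltW r0)// real_normK ?num_real//.
apply: le_lt_trans xr; rewrite /sqdist (bigD1 i)//= lerDl.
by apply: sumr_ge0 => k _; exact: sqr_ge0.
Qed.

Lemma eball_sub_cube (c : E) (r : R) : 0 < r ->
  eball c r `<=` cube (\row_j (c ord0 j - r) : E) (2 * r).
Proof.
move=> r0 x xr i; rewrite mxE; have := eball_coord i r0 xr.
by rewrite ltr_norml => /andP[? ?]; apply/andP; split; lra.
Qed.

Definition ccenter (a : E) (l : R) : E := \row_j (a ord0 j + l / 2).

(** The half diagonal is l sqrt(n+1) / 2; the cruder radius l (n+1) avoids square roots. *)
Lemma hcube_sub_eball (a : E) (l : R) : 0 < l -> hcube a l `<=` eball (ccenter a l) (l * n.+1%:R).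
Proof.
move=> l0 x /hcubeP xa; have n0 : (0 : R) < n.+1%:R by rewrite ltr0n.
apply/eballP; first by rewrite mulr_gt0.
apply: (@le_lt_trans _ _ (\sum_(i < n.+1) l ^+ 2 / 4)).
  apply: ler_sum => i _; rewrite mxE; have /andP[h1 h2] := xa i.
  have -> : l ^+ 2 / 4 = (l / 2) ^+ 2 by field.
  rewrite -[leLHS]real_normK ?num_real// lerXn2r ?nnegrE ?divr_ge0 ?(ltW l0)//.
  by rewrite ler_norml; apply/andP; split; lra.
rewrite sumr_const card_ord exprMn -[_ *+ n.+1]mulr_natr.
rewrite -mulrA ltr_pM2l ?exprn_gt0//.
have n1 : (1 : R) <= n.+1%:R by rewrite ler1n.
by rewrite expr2; apply: (@lt_le_trans _ _ (1 * n.+1%:R)); rewrite ?ltr_pM2r ?ler_pM2r//; lra.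
Qed.

Lemma open_eball (c : E) r : open (eball c r).
Proof.
have -> : eball c r = (fun x : E => Num.sqrt (sqdist c x)) @^-1` [set y | y < r] by [].
apply: open_comp; last exact: open_lt.
move=> x _; apply: continuous_comp; last exact: sqrt_continuous.
apply: (continuous_big (op := +%R)) => [|i _ y]; first exact: add_continuous.
apply: (@continuous_comp E R R (fun x => x ord0 i - c ord0 i) (fun t => t ^+ 2) y).
  have hF := @nbhs_filter E y.
  have h : continuous_at y (fun x : E => x ord0 i) by exact: (@coord_continuous R 1 n.+1).
  exact: (@cvgB _ R^o _ _ hF _ _ _ _ h (cvg_cst _)).
exact: exprn_continuous.
Qed.

Lemma measurable_eball (c : E) r : measurable (eball c r).
Proof. by apply: open_measurable_Rn; exact: open_eball. Qed.

Local Open Scope ereal_scope.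

(** Bounds the measure of the ball of radius l (n+1) over that of the cube of side l: a ball of
    radius r lies in a closed cube of side 2 r, whose measure is estimated by (4 r)^(n+1). *)
Definition ball_ratio : R := ((4 * n.+1%:R) ^+ n.+1)%R.

Lemma lebesgue_eball_bounds (c : E) (r : R) : (0 < r)%R ->
  [/\ mu (eball c r) \is a fin_num, ((r / n.+1%:R) ^+ n.+1 <= fine (mu (eball c r)))%R &
      (fine (mu (eball c r)) <= (4 * r) ^+ n.+1)%R].
Proof.
move=> r0; have n0 : (0 < n.+1%:R :> R)%R by rewrite ltr0n.
have r20 : (0 < 2 * r)%R by rewrite mulr_gt0.
have [cf _ cu] := lebesgue_cube_bounds (\row_j (c ord0 j - r)%R : E) r20.
have h1 : mu (eball c r) <= mu (cube (\row_j (c ord0 j - r)%R : E) (2 * r)%R).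
  by apply: le_outer_measure; exact: eball_sub_cube.
have e0 : 0 <= mu (eball c r) by exact: outer_measure_ge0.
have ef : mu (eball c r) \is a fin_num.
  by rewrite ge0_fin_numE// (le_lt_trans h1)// -ge0_fin_numE// (le_trans e0).
pose l := (r / n.+1%:R)%R; have l0 : (0 < l)%R by rewrite divr_gt0.
pose a : E := \row_j (c ord0 j - l / 2)%R.
have h2 : mu (hcube a l) <= mu (eball c r).
  apply: le_outer_measure.
  have := @hcube_sub_eball a l l0.
  have -> : ccenter a l = c by apply/rowP => j; rewrite !mxE; ring.
  by rewrite divfK// gt_eqF.
split => //.
- by move: h2; rewrite lebesgue_hcube ?(ltW l0)// -(fineK ef) lee_fin.
- apply: le_trans (le_trans _ cu) _; first exact: fine_le h1.
  by rewrite mulrA -natrM.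
Qed.

Lemma lebesgue_eball_hcube (a : E) (l : R) : (0 < l)%R ->
  mu (eball (ccenter a l) (l * n.+1%:R)%R) <= ball_ratio%:E * mu (hcube a l).
Proof.
move=> l0; have n0 : (0 < n.+1%:R :> R)%R by rewrite ltr0n.
have [ef _ eu] := lebesgue_eball_bounds (ccenter a l) (mulr_gt0 l0 n0).
rewrite lebesgue_hcube ?(ltW l0)// -(fineK ef) -EFinM lee_fin (le_trans eu)//.
by rewrite /ball_ratio -exprMn mulrCA mulrC.
Qed.

Lemma emean_eball_le_maximal (w : E -> R) c r x : measurable_fun setT w ->
  positive_fun w -> (0 < r)%R -> eball c r x ->
  emean (eball c r) w <= ball_ratio%:E * maximal w x.
Proof.
move=> mw w0 r0 xr; have r20 : (0 < 2 * r)%R by rewrite mulr_gt0.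
have n0 : (0 < n.+1%:R :> R)%R by rewrite ltr0n.
pose a : E := \row_j (c ord0 j - r)%R.
have [cf cl cu] := lebesgue_cube_bounds a r20.
have [ef el _] := lebesgue_eball_bounds c r0.
have sub := eball_sub_cube (c := c) r0.
apply: (@le_trans _ _ (ball_ratio%:E * emean (cube a (2 * r)%R) (fun y => `|w y|%R))); last first.
  rewrite lee_wpmul2l ?lee_fin ?exprn_ge0 ?mulr_ge0//.
  by apply: le_emean_maximal => //; exact: sub.
rewrite /emean muleA -EFinM.
under [X in _ <= _ * X]eq_integral => y _ do rewrite gtr0_norm ?w0//.
have c0 : (0 < fine (mu (cube a (2 * r)%R)))%R by apply: lt_le_trans cl; rewrite exprn_gt0.
have rn0 : (0 < (r / n.+1%:R) ^+ n.+1)%R by rewrite exprn_gt0// divr_gt0.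
have e0 : (0 < fine (mu (eball c r)))%R by apply: lt_le_trans el.
apply: lee_pmul.
- by rewrite lee_fin invr_ge0 ltW.
- exact: integral_positive_ge0.
- rewrite lee_fin ler_pdivlMr// mulrC ler_pdivrMr//; apply: (le_trans cu).
  apply: (@le_trans _ _ (ball_ratio * (r / n.+1%:R) ^+ n.+1)%R); last first.
    by rewrite ler_wpM2l// exprn_ge0// mulr_ge0.
  rewrite -exprMn; apply: lerXn2r; rewrite ?nnegrE ?mulr_ge0 ?invr_ge0 ?(ltW r0) ?(ltW n0)//.
  have -> : (4 * n.+1%:R * (r / n.+1%:R) = 2 * (2 * r))%R by field; rewrite gt_eqF.
  by [].
- apply: ge0_subset_integral.
  + exact: measurable_eball.
  + exact: measurable_cube.
  + exact: measurable_EFin_in.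
  + by move=> y _; rewrite lee_fin ltW// w0.
  + exact: sub.
Qed.

Lemma chebyshev (A : set E) (u : E -> R) (s : R) : measurable A -> measurable_fun setT u ->
  (0 <= s)%R -> (forall x, 0 <= u x)%R ->
  s%:E * mu (A `&` [set x | s < u x]%R) <= \int[mu]_(x in A) (u x)%:E.
Proof.
move=> mA mu_ s0 u0.
have ms : measurable (A `&` [set x | s < u x]%R).
  apply: measurableI; first exact: mA.
  rewrite (_ : [set x | _] = [set: E] `&` u @^-1` `]s, +oo[%classic).
    by apply: mu_ => //; exact: measurable_itv.
  by rewrite setTI; apply/seteqP; split => x /=; rewrite in_itv/= andbT.
have h : s%:E * mu (A `&` [set x | s < u x]%R) = \int[mu]_(x in A `&` [set x | s < u x]%R) s%:E.
  by rewrite integral_cst.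
rewrite h; apply: (@le_trans _ _ (\int[mu]_(x in A `&` [set x | s < u x]%R) (u x)%:E)).
  apply: ge0_le_integral.
  - exact: ms.
  - by move=> x _; rewrite lee_fin.
  - exact: measurable_cst.
  - exact: measurable_EFin_in.
  - by move=> x [_ /= /ltW]; rewrite lee_fin.
apply: ge0_subset_integral.
- exact: ms.
- exact: mA.
- exact: measurable_EFin_in.
- by move=> x _; rewrite lee_fin.
- by move=> x [].
Qed.

Lemma ess_sup_on_ge (A : set E) (f : E -> \bar R) :
  \forall x \ae mu, A x -> f x <= ess_sup_on A f.
Proof.
pose f' x := if x \in A then f x else -oo.
have e : ess_sup_on A f = ess_sup mu f'.
  congr ereal_inf; apply/seteqP; split => y /=; apply: filterS => x.
    by rewrite /f'; case: ifPn => [|_ _]; rewrite ?leNye// inE => Ax; exact.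
  by rewrite /f' => h Ax; rewrite mem_set in h.
rewrite e; have := ess_sup_ge mu f'; apply: filterS => x h Ax.
by rewrite /f' mem_set in h.
Qed.

Lemma ess_sup_on_ge0 (A : set E) (f : E -> \bar R) : measurable A -> 0 < mu A ->
  (forall x, 0 <= f x) -> 0 <= ess_sup_on A f.
Proof.
move=> mA A0 f0; apply: le_ereal_inf_tmp => y /= [N [mN N0 AN]].
have [x [Ax Nx]] : exists x, A x /\ ~ N x.
  apply: contrapT => h; have : mu A <= mu N.
    by apply: le_outer_measure => x Ax; apply: contrapT => Nx; apply: h; exists x.
  by rewrite N0 leNgt A0.
have : A x -> f x <= y by apply: contrapT => h; apply: Nx; exact: AN.
by move=> /(_ Ax); exact: le_trans.
Qed.

Lemma ess_inf_on_le_emean (A : set E) (w : E -> R) : measurable A ->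
  mu A \is a fin_num -> 0 < mu A -> measurable_fun setT w -> (forall x, 0 <= w x)%R ->
  ess_inf_on A (EFin \o w) <= emean A w.
Proof.
move=> mA Af A0 mw w0; apply: ge_ereal_sup => y /= hy.
have f0 : (0 < fine (mu A))%R by rewrite fine_gt0// A0 -ge0_fin_numE ?(ltW A0).
have [y0|y0] := leP y 0; first exact: le_trans (emean_ge0 _ w0).
have mwA : measurable_fun A (fun x => (w x)%:E) by exact: measurable_EFin_in.
have h : \int[mu]_(x in A) y <= \int[mu]_(x in A) (w x)%:E.
  apply: ae_ge0_le_integral => //.
  - by move=> x _; exact: ltW.
  - by move=> x _; rewrite lee_fin.
rewrite /emean lee_pdivlMl// muleC.
by rewrite integral_cst// in h; rewrite fineK.
Qed.

Lemma grand_maximal_ge (T : (E -> R) -> (E -> R)) f c r x : (0 < r)%R -> eball c r x ->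
  ess_sup_on (eball c r) (fun z => `|T (off_double_ball f c r) z|%:E) <= grand_maximal T f x.
Proof. by move=> r0 xr; apply: ereal_sup_ubound; exists (c, r). Qed.

Lemma lebesgue_eball_gt0 (c : E) (r : R) : (0 < r)%R -> 0 < mu (eball c r).
Proof.
move=> r0; have [ef el _] := lebesgue_eball_bounds c r0.
by rewrite -(fineK ef) lte_fin (lt_le_trans _ el)// exprn_gt0// divr_gt0.
Qed.

Lemma grand_maximal_ge0 (T : (E -> R) -> (E -> R)) f x : 0 <= grand_maximal T f x.
Proof.
have x1 : eball x 1%R x.
  by apply/eballP; rewrite ?ltr01// /sqdist big1 ?expr1n// => i _; rewrite subrr expr0n.
apply: le_trans (grand_maximal_ge T f ltr01 x1).
apply: ess_sup_on_ge0; [exact: measurable_eball|exact: lebesgue_eball_gt0|by []].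
Qed.

(** The superlevel sets are unions of open balls, hence open. *)
Lemma measurable_grand_maximal (T : (E -> R) -> (E -> R)) f :
  measurable_fun setT (grand_maximal T f).
Proof.
apply: (measurability _ (ErealGenOInfty.measurableE R)) => // _ [_ [t ->] <-].
rewrite setTI (_ : _ @^-1` _ = \bigcup_(B in [set B : E * R | (0 < B.2)%R /\
    t%:E < ess_sup_on (eball B.1 B.2) (fun z => `|T (off_double_ball f B.1 B.2) z|%:E)])
    eball B.1 B.2).
  by apply: open_measurable_Rn; apply: bigcup_open => B _; exact: open_eball.
apply/seteqP; split => x /=.
  rewrite in_itv/= andbT => /ereal_sup_gt[_ [B [B0 xB] <-] tB].
  by exists B => //; split.
move=> [[c r] /= [r0 tB] xB]; rewrite in_itv/= andbT (lt_le_trans tB)//.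
exact: grand_maximal_ge.
Qed.

End balls.

(** * From means over balls to local oscillation on cubes *)

Section bmo_oscillation.
Context (R : realType) (n : nat).
Local Notation E := (Rn R n).
Local Notation mu := (@lebesgue R n).
Local Open Scope ereal_scope.

Definition cball (a : E) (l : R) : set E := eball (ccenter a l) (l * n.+1%:R)%R.

Lemma cball_radius_gt0 (l : R) : (0 < l)%R -> (0 < l * n.+1%:R)%R.
Proof. by move=> l0; rewrite mulr_gt0// ltr0n. Qed.

(** With this factor Chebyshev's inequality on the circumscribed ball leaves an exceptional set of
    at most lam / 2 of the cube; the half is kept because two such sets are later joined. *)
Definition level_const : R := (2 * ball_ratio R n / lam R n)%R.

Lemma ball_ratio_gt0 : (0 < ball_ratio R n)%R.
Proof. by rewrite exprn_gt0// mulr_gt0// ltr0n. Qed.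

Lemma level_const_gt0 : (0 < level_const)%R.
Proof. by rewrite divr_gt0 ?(lam_gt0 R n)// mulr_gt0// ball_ratio_gt0. Qed.

Lemma ball_level (u : E -> R) (k : R) a l : (0 < l)%R -> (0 < k)%R ->
  measurable_fun setT u -> (forall x, 0 <= u x)%R -> emean (cball a l) u <= k%:E ->
  mu (hcube a l `&` [set x | level_const * k < u x]%R) <=
    (lam R n / 2)%:E * mu (hcube a l).
Proof.
move=> l0 k0 mu_ u0 uk; have r0 := cball_radius_gt0 l0.
have [Bf _ _] := lebesgue_eball_bounds (ccenter a l) r0.
have B0 := lebesgue_eball_gt0 (ccenter a l) r0.
have fB0 : (0 < fine (mu (cball a l)))%R by rewrite fine_gt0// B0 -ge0_fin_numE ?(ltW B0).
have L0 := level_const_gt0; have r1 := ball_ratio_gt0; have la0 := lam_gt0 R n.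
have h1 : mu (hcube a l `&` [set x | level_const * k < u x]%R) <=
    mu (cball a l `&` [set x | level_const * k < u x]%R).
  by apply: le_outer_measure; apply: setSI; exact: hcube_sub_eball.
have h2 := chebyshev (measurable_eball (ccenter a l) (l * n.+1%:R)%R) mu_
  (ltW (mulr_gt0 L0 k0)) u0.
have h3 : \int[mu]_(x in cball a l) (u x)%:E <= k%:E * mu (cball a l).
  by move: uk; rewrite /emean lee_pdivrMl// muleC fineK.
have h4 := lebesgue_eball_hcube a l0.
have h5 : (level_const * k)%:E * mu (hcube a l `&` [set x | level_const * k < u x]%R)
    <= k%:E * ((ball_ratio R n)%:E * mu (hcube a l)).
  apply: le_trans (le_trans h2 (le_trans h3 _)).
    by apply: lee_wpmul2l h1; rewrite lee_fin mulr_ge0// ltW.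
  by apply: lee_wpmul2l h4; rewrite lee_fin ltW.
have -> : (lam R n / 2)%:E * mu (hcube a l) = ((level_const * k)^-1)%:E * (k%:E *
    ((ball_ratio R n)%:E * mu (hcube a l))).
  rewrite !muleA -!EFinM; congr (_%:E * _).
  by rewrite /level_const; field; rewrite !gt_eqF.
by rewrite lee_pdivlMl// mulr_gt0.
Qed.

Lemma bmo_ge0 (b : E -> R) : 0 <= bmo_norm b.
Proof.
have h0 : 0 <= emean (eball (0%R : E) 1%R) (fun x => `|b x - mean (eball (0%R : E) 1%R) b|%R).
  exact: emean_ge0.
by apply: (le_trans h0); apply: ereal_sup_ubound; exists (0%R, 1%R) => //=.
Qed.

Lemma bmo_norm_fine (b : E -> R) : BMO b -> bmo_norm b = (fine (bmo_norm b))%:E.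
Proof. by move=> [_ bfin]; rewrite fineK// ge0_fin_numE// bmo_ge0. Qed.

Lemma measurable_absB (F : E -> R) (k : R) : measurable_fun setT F ->
  measurable_fun setT (fun x => `|F x - k|%R).
Proof.
move=> mF; apply: (measurableT_comp (@normr_measurable R setT)).
by apply: measurable_funB; [exact: mF|exact: measurable_cst].
Qed.

(** A number [beta] strictly above the norm is used in its place, to have a positive height also
    when the norm is 0. *)
Lemma bmo_level (b : E -> R) (beta : R) a l : BMO b -> (0 < l)%R ->
  (fine (bmo_norm b) < beta)%R ->
  mu (hcube a l `&` [set x | level_const * beta < `|b x - mean (cball a l) b|]%R) <=
    (lam R n / 2)%:E * mu (hcube a l).
Proof.
move=> hb l0 bb; have mb : measurable_fun setT b by case: hb => -[].
have beta0 : (0 < beta)%R by apply: le_lt_trans bb; rewrite fine_ge0// bmo_ge0.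
apply: (ball_level l0 beta0 (measurable_absB _ mb)) => [x|]; first exact: normr_ge0.
apply: (@le_trans _ _ (bmo_norm b)); last by rewrite bmo_norm_fine// lee_fin ltW.
apply: ereal_sup_ubound; exists (ccenter a l, (l * n.+1%:R)%R) => //=.
exact: cball_radius_gt0.
Qed.

Lemma small_oscillation_bmo (b : E -> R) (beta : R) : BMO b ->
  (fine (bmo_norm b) < beta)%R ->
  small_oscillation b (fun a l => mean (cball a l) b) (fun _ _ => level_const * beta)%R.
Proof.
move=> hb bb a l l0; apply: (le_trans (bmo_level a hb l0 bb)).
apply: lee_wpmul2r; first exact: outer_measure_ge0.
by have := lam_gt0 R n; rewrite lee_fin; lra.
Qed.

(** Outside one set, of proportion lam / 2, F is close to c1 + tau b by Chebyshev for the power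
    delta, whence the exponent 1/delta on [level_const]. Outside another, b is close to its mean
    over the ball, and this error is multiplied by |tau|. *)
Lemma small_oscillation_perturbed (F b : E -> R) (c1 tau k : E -> R -> R) (beta delta : R) :
  BMO b -> (fine (bmo_norm b) < beta)%R -> measurable_fun setT F -> (0 < delta)%R ->
  (forall a l, 0 < l -> 0 < k a l)%R ->
  (forall a l, (0 < l)%R ->
    emean (cball a l) (fun x => (`|F x - c1 a l - tau a l * b x| `^ delta)%R)
      <= (k a l `^ delta)%:E) ->
  small_oscillation F (fun a l => c1 a l + tau a l * mean (cball a l) b)%R
    (fun a l => level_const `^ delta^-1 * k a l + `|tau a l| * (level_const * beta))%R.
Proof.
move=> hb bb mF d0 k0 hk a l l0.
have mb : measurable_fun setT b by case: hb => -[].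
have L0 := level_const_gt0.
set B1 := hcube a l `&` [set x | level_const * (k a l `^ delta)
  < `|F x - c1 a l - tau a l * b x| `^ delta]%R.
set B2 := hcube a l `&` [set x | level_const * beta < `|b x - mean (cball a l) b|]%R.
have mu1 : measurable_fun setT (fun x => `|F x - c1 a l - tau a l * b x|%R).
  apply: (measurableT_comp (@normr_measurable R setT)).
  apply: measurable_funB.
    by apply: measurable_funB; [exact: mF|exact: measurable_cst].
  by apply: measurable_funM; [exact: measurable_cst|exact: mb].
have h1 : mu B1 <= (lam R n / 2)%:E * mu (hcube a l).
  apply: (@ball_level (fun x => `|F x - c1 a l - tau a l * b x| `^ delta)%R _ a l l0).
  - by apply: powR_gt0; exact: k0.
  - exact: measurable_powR_fun.
  - by move=> x; exact: powR_ge0.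
  - exact: hk.
have h2 : mu B2 <= (lam R n / 2)%:E * mu (hcube a l) by exact: bmo_level.
apply: (@le_trans _ _ (mu (B1 `|` B2))).
  apply: le_outer_measure => x [Px /= hx].
  have [hb1|hb1] := ltP (level_const * beta)%R `|b x - mean (cball a l) b|%R.
    by right; split.
  left; split => //=.
  have hF : (level_const `^ delta^-1 * k a l < `|F x - c1 a l - tau a l * b x|)%R.
    have : (`|F x - (c1 a l + tau a l * mean (cball a l) b)| <=
        `|F x - c1 a l - tau a l * b x| + `|tau a l| * (level_const * beta))%R.
      have -> : (F x - (c1 a l + tau a l * mean (cball a l) b) =
        (F x - c1 a l - tau a l * b x) + tau a l * (b x - mean (cball a l) b))%R by ring.
      by rewrite (le_trans (ler_normD _ _))// lerD2l normrM ler_wpM2l.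
    by lra.
  have k1 := k0 a l l0.
  have e : (level_const * k a l `^ delta = (level_const `^ delta^-1 * k a l) `^ delta)%R.
    by rewrite powRM ?powR_ge0 ?(ltW k1)// -powRrM mulVf ?gt_eqF// powRr1// ltW.
  rewrite e; apply: gt0_ltr_powR => //; rewrite ?nnegrE//.
  by rewrite mulr_ge0 ?powR_ge0// ltW.
apply: (le_trans (outer_measureU2 _ _ _)).
apply: (le_trans (leeD h1 h2)).
rewrite -ge0_muleDl ?lee_fin ?divr_ge0 ?(ltW (lam_gt0 R n))//.
by rewrite -EFinD -splitr.
Qed.

End bmo_oscillation.

Section bmo_integrability.
Context (R : realType) (n : nat).
Local Notation E := (Rn R n).
Local Notation mu := (@lebesgue R n).
Local Open Scope ereal_scope.
Variables (p K : R) (v w : E -> R).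
Hypotheses (p1 : (1 < p)%R) (K1 : (1 <= K)%R) (vs : Ap_pair p K v w).

Lemma Linfty_c_bcube (f : E -> R) : Linfty_c f ->
  exists j, forall x, ~ @bcube R n j x -> f x = 0%R.
Proof.
move=> [_ _ /compact_sub_bcube[j hj]]; exists j => x xj.
apply: contrapT => /eqP fx; apply: xj; apply: hj.
exact: (@subset_closure _ [set x | f x != 0%R]).
Qed.

Lemma integral_support (Q : set E) (h : E -> \bar R) : (forall x, ~ Q x -> h x = 0) ->
  \int[mu]_x h x = \int[mu]_(x in Q) h x.
Proof.
move=> hQ; rewrite [RHS]integral_mkcond; apply: eq_integral => x _.
by rewrite patchE; case: ifPn => //; rewrite notin_setE => /hQ.
Qed.

Lemma Linfty_c_Lp (f : E -> R) : Linfty_c f ->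
  \int[mu]_x ((`|f x| `^ p)%:E * (v x)%:E) < +oo.
Proof.
move=> hf; have [j fj] := Linfty_c_bcube hf; have [mf [M fM] _] := hf.
have p0 : (0 < p)%R by exact: lt_trans p1.
have M0 : (0 <= M)%R by exact: le_trans (fM (0%R : E)).
have mv := pair_mv vs; have v0 := pair_v_ge0 vs.
have mQ : measurable (@bcube R n j) by exact: measurable_bcube.
rewrite (@integral_support (@bcube R n j)); last first.
  by move=> x /fj ->; rewrite normr0 powR0 ?gt_eqF// mul0e.
apply: (@le_lt_trans _ _ (\int[mu]_(x in @bcube R n j) ((M `^ p)%:E * (v x)%:E))).
  apply: ge0_le_integral.
  - exact: mQ.
  - by move=> x _; rewrite -EFinM lee_fin mulr_ge0 ?powR_ge0// v0.
  - apply: measurable_funTS; apply: emeasurable_funM.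
      apply/measurable_EFinP; apply: measurable_powR_fun.
      exact: (measurableT_comp (@normr_measurable R setT) mf).
    exact: measurable_EFin_in mv.
  - by apply: measurable_funeM; exact: measurable_EFin_in mv.
  - move=> x _; apply: lee_wpmul2r; first by rewrite lee_fin v0.
    rewrite lee_fin; apply: ge0_ler_powR; rewrite ?nnegrE ?(ltW p0)//; exact: fM.
rewrite ge0_integralZl_EFin; last 4 first.
- exact: mQ.
- by move=> x _; rewrite lee_fin v0.
- exact: measurable_EFin_in mv.
- exact: powR_ge0.
have := bweightE vs j; rewrite /density_of/= => ->.
by rewrite -EFinM ltry.
Qed.

Lemma BMO_mul_Lp (b f : E -> R) : BMO b -> Linfty_c f ->
  \int[mu]_x ((`|b x * f x| `^ p)%:E * (v x)%:E) < +oo.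
Proof.
move=> hb hf; have [j fj] := Linfty_c_bcube hf; have [mf [M fM] _] := hf.
have mb : measurable_fun setT b by case: hb => -[].
have p0 : (0 < p)%R by exact: lt_trans p1.
have M0 : (0 <= M)%R by exact: le_trans (fM (0%R : E)).
have mv := pair_mv vs; have v0 := pair_v_ge0 vs.
have mQ : measurable (@bcube R n j) by exact: measurable_bcube.
pose beta := (fine (bmo_norm b) + 1)%R.
have bb : (fine (bmo_norm b) < beta)%R by rewrite ltrDl.
have beta0 : (0 < beta)%R by apply: le_lt_trans bb; rewrite fine_ge0// bmo_ge0.
have hosc := small_oscillation_bmo hb bb.
have [C C0 HC] := local_sharp_estimate p1 K1 vs.
(* The oscillation of b is bounded by one number on all cubes, so a constant function is an
   admissible majorant, and its p-th power is integrable against v on a cube. *)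
pose g (x : E) := (level_const R n * beta)%:E.
have g0 x : 0 <= g x by rewrite lee_fin mulr_ge0// ltW// level_const_gt0.
have := HC b _ _ g mb hosc (measurable_cst _) g0
  (fun a l x _ _ => lexx _) (bcorner R n j) _ (bside_gt0 R j).
rewrite -/(bcube j); set c := mean _ b => Hb.
have nuQ : \int[mu]_(x in @bcube R n j) (v x)%:E = (bweight v j)%:E.
  exact: bweightE vs j.
have Ib : \int[mu]_(x in @bcube R n j) ((`|b x - c| `^ p)%:E * (v x)%:E) < +oo.
  apply: (le_lt_trans Hb); rewrite /g poweR_EFin ge0_integralZl_EFin; last 4 first.
  - exact: mQ.
  - by move=> x _; rewrite lee_fin v0.
  - exact: measurable_EFin_in mv.
  - exact: powR_ge0.
  by rewrite nuQ -!EFinM ltry.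
rewrite (@integral_support (@bcube R n j)); last first.
  by move=> x /fj ->; rewrite mulr0 normr0 powR0 ?gt_eqF// mul0e.
have mvE : measurable_fun (@bcube R n j) (fun x => (v x)%:E) by exact: measurable_EFin_in mv.
have mbc : measurable_fun (@bcube R n j) (fun x => (`|b x - c| `^ p)%:E * (v x)%:E).
  apply: emeasurable_funM; last exact: mvE.
  apply: measurable_funTS; apply/measurable_EFinP; apply: measurable_powR_fun.
  exact: measurable_absB.
have bc0 x : 0 <= (`|b x - c| `^ p)%:E * (v x)%:E.
  by rewrite -EFinM lee_fin mulr_ge0 ?powR_ge0// v0.
have cv0 x : 0 <= (`|c| `^ p)%:E * (v x)%:E.
  by rewrite -EFinM lee_fin mulr_ge0 ?powR_ge0// v0.
apply: (@le_lt_trans _ _ (\int[mu]_(x in @bcube R n j) ((M `^ p * 2 `^ p)%:E *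
    ((`|b x - c| `^ p)%:E * (v x)%:E + (`|c| `^ p)%:E * (v x)%:E)))).
  apply: ge0_le_integral.
  - exact: mQ.
  - by move=> x _; rewrite -EFinM lee_fin mulr_ge0 ?powR_ge0// v0.
  - apply: emeasurable_funM; last exact: mvE.
    apply: measurable_funTS; apply/measurable_EFinP; apply: measurable_powR_fun.
    apply: (measurableT_comp (@normr_measurable R setT)).
    by apply: measurable_funM; [exact: mb|exact: mf].
  - apply: measurable_funeM; apply: emeasurable_funD; first exact: mbc.
    by apply: measurable_funeM; exact: mvE.
  - move=> x _; rewrite -!EFinM lee_fin -mulrDl mulrA.
    apply: ler_wpM2r; first exact: v0.
    rewrite normrM mulrC powRM//.
    rewrite -mulrA; apply: ler_pM; rewrite ?powR_ge0//.
      by apply: ge0_ler_powR; rewrite ?nnegrE ?(ltW p0)//; exact: fM.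
    apply: (le_trans _ (powR_add_le (normr_ge0 _) (normr_ge0 _) (ltW p0))).
    apply: ge0_ler_powR; rewrite ?nnegrE ?(ltW p0) ?addr_ge0//.
    by rewrite -{1}(subrK c (b x)) ler_normD.
rewrite ge0_integralZl_EFin; last 4 first.
- exact: mQ.
- by move=> x _; exact: adde_ge0.
- apply: emeasurable_funD; first exact: mbc.
  by apply: measurable_funeM; exact: mvE.
- by rewrite mulr_ge0 ?powR_ge0.
rewrite ge0_integralD; last 5 first.
- exact: mQ.
- by move=> x _; exact: bc0.
- exact: mbc.
- by move=> x _; exact: cv0.
- by apply: measurable_funeM; exact: mvE.
rewrite lte_mul_pinfty ?lee_fin ?mulr_ge0 ?powR_ge0//.
apply: lte_add_pinfty; first exact: Ib.
rewrite ge0_integralZl_EFin; last 4 first.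
- exact: mQ.
- by move=> x _; rewrite lee_fin v0.
- exact: mvE.
- exact: powR_ge0.
by rewrite nuQ -EFinM ltry.
Qed.

End bmo_integrability.

(** With rho = sqrt th, the product (j + 1) rho^j is at most the geometric sum of rho^i, hence
    bounded, and the other factor rho^j tends to 0. This beats the linear growth of the means of b
    by the geometric decay of the grand maximal functions. *)
Lemma small_linear_geometric (R : realType) (k th e : R) N : 0 <= k -> 0 < th < 1 -> 0 < e ->
  exists2 j, (N <= j)%N & k * (j.+1%:R * th ^+ j) <= e.
Proof.
move=> k0 /andP[th0 th1] e0.
pose rho := Num.sqrt th.
have r0 : 0 < rho by rewrite sqrtr_gt0.
have r1 : rho < 1 by rewrite -[ltRHS]sqrtr1 ltr_sqrt.
have thE : th = rho * rho by rewrite -expr2 sqr_sqrtr// ltW.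
have lin j : j.+1%:R * rho ^+ j <= (1 - rho)^-1.
  rewrite -(mul1r (1 - rho)^-1) ler_pdivlMr ?subr_gt0//.
  have h1 : j.+1%:R * rho ^+ j <= \sum_(i < j.+1) rho ^+ i.
    rewrite mulr_natl -[X in _ *+ X]card_ord -sumr_const ler_sum// => i _.
    by apply: ler_wiXn2l; [exact: ltW|exact: ltW|rewrite -ltnS].
  have h2 := subrX1 rho j.+1.
  have h3 : 0 <= rho ^+ j.+1 by rewrite exprn_ge0// ltW.
  have h4 : 0 <= 1 - rho by rewrite subr_ge0 ltW.
  have := ler_wpM2r h4 h1; move: h2; set S := \sum_(i < _) _; lra.
have d0 : 0 < e * (1 - rho) / (k + 1).
  by rewrite divr_gt0 ?mulr_gt0 ?subr_gt0// ltr_wpDl.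
have [j jN hj] : exists2 j, (N <= j)%N & rho ^+ j <= e * (1 - rho) / (k + 1).
  have : (fun j => rho ^+ j) @ \oo --> (0 : R) by apply: cvg_expr; rewrite ger0_norm// ltW.
  move=> /cvgrPdist_le /(_ _ d0) [M _ hM].
  exists (maxn M N); first exact: leq_maxr.
  have := hM (maxn M N) (leq_maxl _ _); rewrite sub0r normrN ger0_norm//.
  by rewrite exprn_ge0// ltW.
exists j => //; rewrite thE exprMn (mulrA j.+1%:R).
apply: (@le_trans _ _ (k * ((1 - rho)^-1 * (e * (1 - rho) / (k + 1))))).
  by rewrite ler_wpM2l// ler_pM ?mulr_ge0 ?exprn_ge0 ?(ltW r0).
have -> : k * ((1 - rho)^-1 * (e * (1 - rho) / (k + 1))) = e * (k / (k + 1)).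
  by field; rewrite !gt_eqF ?subr_gt0// ltr_wpDl.
rewrite ler_piMr ?(ltW e0)// ler_pdivrMr ?ltr_wpDl// mul1r lerDl.
exact: ler01.
Qed.

(** * Constants on cubes far from the support *)

Section far_cubes.
Context (R : realType) (n : nat).
Local Notation E := (Rn R n).
Local Notation mu := (@lebesgue R n).
Local Notation Q j := (@bcube R n j).

(* Cubes sharing the top corner (2^j, ..., 2^j): [subcube j j.+1] is the centred
   cube [bcube j], and for i much smaller than j they stay away from the origin. *)
Definition scorner (j i : nat) : E := const_mx (2 ^+ j - 2 ^+ i).
Definition subcube (j i : nat) : set E := hcube (scorner j i) (2 ^+ i).

Lemma pow2_gt0 i : (0 : R) < 2 ^+ i. Proof. by rewrite exprn_gt0. Qed.

Lemma subcubeP j i x : subcube j i x <-> forall k, 2 ^+ j - 2 ^+ i < x ord0 k <= 2 ^+ j.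
Proof.
split=> [/hcubeP h k|h]; last apply/hcubeP => k; have := h k; rewrite mxE.
  by move=> /andP[? ?]; apply/andP; split; lra.
by move=> /andP[? ?]; apply/andP; split; lra.
Qed.

Lemma subcube_sub j i k : (i <= k)%N -> subcube j i `<=` subcube j k.
Proof.
move=> ik x /subcubeP h; apply/subcubeP => t; have /andP[h1 h2] := h t.
have h3 : (2 ^+ i <= 2 ^+ k :> R) by apply: ler_weXn2l; [rewrite ler1n|].
by apply/andP; split; lra.
Qed.

Lemma scorner_top j : scorner j j.+1 = bcorner R n j.
Proof. by apply/rowP => k; rewrite !mxE exprS; ring. Qed.

Lemma subcube_top j : subcube j j.+1 = Q j.
Proof. by rewrite /subcube scorner_top. Qed.

Section chains.
Variables (F : E -> R) (c o : E -> R -> R).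
Hypotheses (mF : measurable_fun setT F) (hosc : small_oscillation F c o).

Lemma subcube_chain j i d (y : R) :
  (forall k, (k <= d)%N -> o (scorner j (i + k)) (2 ^+ (i + k)) <= y) ->
  `|c (scorner j i) (2 ^+ i) - c (scorner j (i + d)) (2 ^+ (i + d))| <= 2 * d%:R * y.
Proof.
elim: d => [_|d IH hy]; first by rewrite addn0 subrr normr0 mulr0 mul0r.
have {}IH := IH (fun k kd => hy k (leqW kd)).
have h1 := hy d (leqnSn d); have h2 := hy d.+1 (leqnn _).
have h3 : `|c (scorner j (i + d)) (2 ^+ (i + d)) - c (scorner j (i + d.+1)) (2 ^+ (i + d.+1))|
    <= o (scorner j (i + d)) (2 ^+ (i + d)) + o (scorner j (i + d.+1)) (2 ^+ (i + d.+1)).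
  apply: (oscillation_compare mF hosc (pow2_gt0 _)); first by rewrite addnS exprS.
  by apply: subcube_sub; rewrite leq_add2l.
apply: (le_trans (ler_distD (c (scorner j (i + d)) (2 ^+ (i + d))) _ _)).
have e : d.+1%:R = d%:R + 1 :> R by rewrite -addn1 natrD.
by rewrite e; move: IH h1 h2 h3; lra.
Qed.

Lemma bcube_chain j (y : R) : (forall a l, o a l <= y) ->
  `|c (bcorner R n 0) (bside R 0) - c (bcorner R n j) (bside R j)| <= 2 * j%:R * y.
Proof.
move=> hy; elim: j => [|j IH]; first by rewrite subrr normr0 mulr0 mul0r.
apply: (le_trans (ler_distD (c (bcorner R n j) (bside R j)) _ _)).
have h1 := hy (bcorner R n j) (bside R j); have h2 := hy (bcorner R n j.+1) (bside R j.+1).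
have h3 : `|c (bcorner R n j) (bside R j) - c (bcorner R n j.+1) (bside R j.+1)| <=
    o (bcorner R n j) (bside R j) + o (bcorner R n j.+1) (bside R j.+1).
  apply: (oscillation_compare mF hosc (bside_gt0 _ _)); first by rewrite /bside !exprS.
  exact: bcube_sub.
have e : j.+1%:R = j%:R + 1 :> R by rewrite -addn1 natrD.
by rewrite e; move: IH h1 h2 h3; lra.
Qed.

(** Path of constants from the unit scale up the centred cubes to [bcube j] and down to the far
    subcube. Each step costs a bounded amount, so the means of a BMO function grow at most linearly
    in j. *)
Lemma subcube_center_growth j m (y : R) : (m <= j)%N -> (forall a l, o a l <= y) ->
  `|c (scorner j (j - m)) (2 ^+ (j - m))| <=
    `|c (bcorner R n 0) (bside R 0)| + 2 * (j + m.+1)%:R * y.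
Proof.
move=> mj hy; have h1 := bcube_chain j hy.
have h2 := @subcube_chain j (j - m) m.+1 y (fun k _ => hy _ _).
have e : (j - m + m.+1 = j.+1)%N by rewrite addnS subnK.
rewrite e scorner_top -/(bside R j) in h2.
set A := c (scorner _ _) _ in h2 *; set B := c (bcorner R n j) _ in h1 h2; set C := c (bcorner R n 0) _ in h1 *.
have h3 : `|A| <= `|A - B| + `|C - B| + `|C|.
  have e2 : A = (A - B) + (B - C + C) by ring.
  have e3 : `|B - C + C| <= `|C - B| + `|C| by rewrite (distrC C) ler_normD.
  apply: (@le_trans _ _ (`|A - B| + `|B - C + C|)); first by rewrite {1}e2 ler_normD.
  by rewrite -[leRHS]addrA lerD2l.
by rewrite natrD; move: h1 h2 h3; lra.
Qed.

End chains.

(** On the doubled circumscribed ball the first coordinate exceeds 2^j - 2^(j-m) (2 (n+1) + 1/2) >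
    2^(j-1) >= 2^J, by the choice of m. The ball misses the support, so cutting it out does not
    change h and the grand maximal function controls T h itself. *)
Lemma off_double_far (h : E -> R) J j m : (J < j)%N -> (m <= j)%N ->
  (4 * n.+1 + 2 <= 2 ^ m)%N -> (forall x, ~ Q J x -> h x = 0) ->
  off_double_ball h (ccenter (scorner j (j - m)) (2 ^+ (j - m))) (2 ^+ (j - m) * n.+1%:R) = h.
Proof.
move=> Jj mj hm hQ; apply/funext => x; rewrite /off_double_ball/= indicE.
set B := eball _ _; have [xB|xB] := pselect (B x); last by rewrite mem_set// mulr1.
rewrite memNset ?mulr0; last by move=> /(_ xB).
rewrite hQ// => /bcubeP /(_ ord0) /andP[_ xJ].
have l0 := pow2_gt0 (j - m).
have r0 : 0 < 2 * (2 ^+ (j - m) * n.+1%:R) :> R by rewrite !mulr_gt0// ltr0n.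
have := eball_coord ord0 r0 xB; rewrite !mxE ltr_norml => /andP[h1 _].
have h2 : (2 ^+ j.-1 : R) + 2 ^+ j.-1 = 2 ^+ j.
  by rewrite -[in RHS](prednK (leq_ltn_trans (leq0n _) Jj)) exprS; ring.
have h3 : (2 ^+ J : R) <= 2 ^+ j.-1.
  by apply: ler_weXn2l; [rewrite ler1n|rewrite -ltnS (ltn_predK Jj)].
have h4 : (2 ^+ (j - m) : R) * 2 ^+ m = 2 ^+ j by rewrite -exprD subnK.
have h5 : (2 ^+ (j - m) : R) * (4 * n.+1%:R + 2) <= 2 ^+ (j - m) * 2 ^+ m.
  rewrite ler_pM2l// -natrX -natrM -natrD ler_nat; exact: hm.
by move: h1 h2 h3 h4 h5 xJ; lra.
Qed.

Local Open Scope ereal_scope.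
Variables (p K : R) (v w : E -> R).
Hypotheses (p1 : (1 < p)%R) (K1 : (1 <= K)%R) (vs : Ap_pair p K v w).

(** 1 / v(P) is at most this number times beta^j, for P = [subcube j (j - m)]: doubling compares P
    with [bcube j], and [bweight_growth] compares the latter with [bcube 0]. *)
Definition far_const (m : nat) : R := (K * ((2 ^+ m.+1) ^+ n.+1) `^ p / bweight v 0)%R.
Definition far_ratio : R := (beta p K `^ p^-1)%R.

Lemma far_const_gt0 m : (0 < far_const m)%R.
Proof.
apply: divr_gt0; last exact: (bweight_gt0 vs 0%N).
apply: mulr_gt0; first exact: lt_le_trans K1.
by apply: powR_gt0; rewrite !exprn_gt0.
Qed.

(* The v-measure of P = subcube j (j - m) grows geometrically in j, so a lower
   bound y on P of a function of L^p(v) decays geometrically. *)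
Lemma le_far (g : E -> \bar R) (y : \bar R) (I : R) j m : (m <= j)%N ->
  measurable_fun setT g -> (forall x, 0 <= g x) -> (0 <= I)%R ->
  \int[mu]_x (g x `^ p * (v x)%:E) <= I%:E -> 0 <= y ->
  (forall x, subcube j (j - m) x -> y <= g x) ->
  y <= ((I * far_const m) `^ p^-1 * far_ratio ^+ j)%:E.
Proof.
move=> mj mg g0 I0 gI y0 yg; have p0 : (0 < p)%R by exact: lt_trans p1.
have K0 : (0 < K)%R by exact: lt_le_trans K1.
have mv := pair_mv vs; have v0 := pair_v_ge0 vs.
set P := subcube j (j - m) in yg.
have mP : measurable P by exact: measurable_hcube.
pose V := fine (\int[mu]_(x in P) (v x)%:E).
have V0 : (0 < V)%R by exact: pair_hcube_gt0 vs (pow2_gt0 _).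
have VE : \int[mu]_(x in P) (v x)%:E = V%:E.
  rewrite fineK// ge0_fin_numE; first exact: pair_vfin vs _ _.
  exact: integral_positive_ge0 (pair_v0 vs).
have yI : y `^ p * V%:E <= I%:E.
  apply: (le_trans _ gI).
  apply: (@le_trans _ _ (\int[mu]_(x in P) (g x `^ p * (v x)%:E))); last first.
    apply: ge0_subset_integral.
    - exact: mP.
    - exact: measurableT.
    - apply: emeasurable_funM; first exact: (measurable_poweR_fun p mg).
      exact: measurable_EFin_in mv.
    - by move=> x _; rewrite mule_ge0 ?poweR_ge0// lee_fin v0.
    - exact: subsetT.
  rewrite -VE -ge0_integralZl; last 4 first.
  - exact: mP.
  - exact: measurable_EFin_in mv.
  - by move=> x _; rewrite lee_fin v0.
  - exact: poweR_ge0.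
  apply: ge0_le_integral.
  - exact: mP.
  - by move=> x _; rewrite mule_ge0 ?poweR_ge0// lee_fin v0.
  - by apply: emeasurable_funM; [exact: measurable_cst|exact: measurable_EFin_in mv].
  - apply: measurable_funTS; apply: emeasurable_funM; first exact: (measurable_poweR_fun p mg).
    exact: measurable_EFin_in mv.
  - move=> x Px; apply: lee_wpmul2r; first by rewrite lee_fin v0.
    by apply: lee_poweR; [exact: ltW|exact: y0|exact: yg].
have VQ : (bweight v 0 <= beta p K ^+ j * (K * ((2 ^+ m.+1) ^+ n.+1) `^ p * V))%R.
  have h1 := bweight_growth p1 K1 vs 0 j; rewrite add0n in h1; apply: (le_trans h1).
  rewrite ler_wpM2l ?exprn_ge0 ?(ltW (beta_gt0 p1 K1 vs))//.
  have h2 : P `<=` hcube (bcorner R n j) (bside R j).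
    rewrite -/(bcube j) -subcube_top; apply: subcube_sub.
    exact: leq_trans (leq_subr _ _) (leqnSn _).
  have := pair_doubling p1 K0 vs (pow2_gt0 _) (bside_gt0 R j) h2.
  have -> : (bside R j / 2 ^+ (j - m) = 2 ^+ m.+1)%R.
    rewrite /bside; apply: (mulIf (lt0r_neq0 (pow2_gt0 (j - m)))).
    by rewrite divfK ?gt_eqF ?pow2_gt0// -exprD addSn subnKC.
  by [].
have yp : y `^ p <= (I * far_const m * beta p K ^+ j)%:E.
  apply: (@le_trans _ _ (I / V)%:E).
    by rewrite EFinM lee_pdivlMr.
  have W0 := bweight_gt0 vs 0.
  rewrite lee_fin -mulrA ler_wpM2l// /far_const -(ler_pM2r V0) mulVf ?gt_eqF//.
  by rewrite -(ler_pM2r W0) mul1r (le_trans VQ)// le_eqVlt; apply/orP; left; apply/eqP; field; rewrite gt_eqF.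
have b0 : (0 <= beta p K)%R by rewrite ltW// (beta_gt0 p1 K1 vs).
have -> : y = (y `^ p) `^ p^-1 by rewrite -poweRrM mulfV ?gt_eqF// poweRe1.
have -> : ((I * far_const m) `^ p^-1 * far_ratio ^+ j = (I * far_const m * beta p K ^+ j) `^ p^-1)%R.
  have h1 : (0 <= I * far_const m)%R by rewrite mulr_ge0// ltW// far_const_gt0.
  rewrite (powRM _ h1 (exprn_ge0 j b0)); congr (_ * _)%R.
  rewrite /far_ratio -powR_mulrn ?powR_ge0// -powRrM mulrC powRrM.
  by rewrite powR_mulrn.
rewrite -poweR_EFin; apply: lee_poweR; rewrite ?poweR_ge0 ?invr_ge0 ?(ltW p0)//.
Qed.

End far_cubes.

Section far_limit.
Context (R : realType) (n : nat).
Local Notation E := (Rn R n).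
Local Notation mu := (@lebesgue R n).
Local Open Scope ereal_scope.

Lemma lebesgue_cover4 (P A B N N' : set E) (s t : \bar R) :
  mu A <= s -> mu B <= t -> mu N = 0 -> mu N' = 0 -> s + t < mu P ->
  exists z, [/\ P z, ~ A z, ~ B z, ~ N z & ~ N' z].
Proof.
move=> As Bt N0 N'0 st; apply: contrapT => h.
have : mu P <= mu ((A `|` B) `|` (N `|` N')).
  apply: le_outer_measure => z Pz; apply: contrapT => hz; apply: h.
  by exists z; split => // ?; apply: hz; [left; left|left; right|right; left|right; right].
apply/negP; rewrite -ltNge; apply: le_lt_trans st.
apply: (le_trans (outer_measureU2 _ _ _)).
have hN : mu (N `|` N') <= 0.
  by apply: (le_trans (outer_measureU2 _ _ _)); rewrite [X in X + _]N0 [X in _ + X]N'0 adde0.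
rewrite -[leRHS]adde0; apply: leeD hN.
apply: (le_trans (outer_measureU2 _ _ _)); exact: leeD.
Qed.

Variables (p K : R) (v w : E -> R).
Hypotheses (p1 : (1 < p)%R) (K1 : (1 <= K)%R) (vs : Ap_pair p K v w).

(** Far from the support the essential supremum of |T h| on the ball is below the grand maximal
    function at every point of the cube, and [le_far] makes it decay. *)
Lemma far_value (T : (E -> R) -> (E -> R)) (h : E -> R) (I : R) J j m :
  (J < j)%N -> (m <= j)%N -> (4 * n.+1 + 2 <= 2 ^ m)%N ->
  (forall x, ~ @bcube R n J x -> h x = 0%R) -> (0 <= I)%R ->
  \int[mu]_x (grand_maximal T h x `^ p * (v x)%:E) <= I%:E ->
  \forall z \ae mu, cball (@scorner R n j (j - m)) (2 ^+ (j - m))%R z ->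
    (`|T h z| <= (I * @far_const R n p K v m) `^ p^-1 * far_ratio p K ^+ j)%R.
Proof.
move=> Jj mj hm hQ I0 hI.
have l0 := pow2_gt0 R (j - m).
have r0 := cball_radius_gt0 n l0.
have off := off_double_far Jj mj hm hQ.
set B := cball _ _.
have G := ess_sup_on_ge B (fun z => `|T h z|%:E).
have hle : ess_sup_on B (fun z => `|T h z|%:E) <=
    ((I * @far_const R n p K v m) `^ p^-1 * far_ratio p K ^+ j)%:E.
  apply: (le_far p1 K1 vs mj (measurable_grand_maximal T h) _ I0 hI).
  - by move=> x; exact: grand_maximal_ge0.
  - by apply: ess_sup_on_ge0 => //; [exact: measurable_eball|exact: lebesgue_eball_gt0].
  - move=> x xP; have xB : B x by exact: hcube_sub_eball.
    by have := grand_maximal_ge T h r0 xB; rewrite off.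
by apply: filterS G => z hz Bz; rewrite -lee_fin; apply: le_trans (hz Bz) hle.
Qed.

(** On a far subcube b is O(j) at a good point, while T f and T(bf) are O(th^j), so the commutator
    is O(j th^j) there. Its constant on the subcube inherits this bound, and so does the constant of
    the centred cube, reached by m + 1 doublings with m independent of j. *)
Theorem far_limit (T : (E -> R) -> (E -> R)) (b f : E -> R) (beta : R) (c o : E -> R -> R)
    (g : E -> \bar R) (Ig I1 I2 : R) J :
  BMO b -> (fine (bmo_norm b) < beta)%R -> measurable_fun setT (commutator b T f) ->
  small_oscillation (commutator b T f) c o -> (forall a l, 0 < l -> 0 <= o a l)%R ->
  measurable_fun setT g -> (forall x, 0 <= g x) ->
  (forall a l x, (0 < l)%R -> hcube a l x -> (o a l)%:E <= g x) ->
  (0 <= Ig)%R -> (0 <= I1)%R -> (0 <= I2)%R ->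
  \int[mu]_x (g x `^ p * (v x)%:E) <= Ig%:E ->
  \int[mu]_x (grand_maximal T f x `^ p * (v x)%:E) <= I1%:E ->
  \int[mu]_x (grand_maximal T (b \* f)%R x `^ p * (v x)%:E) <= I2%:E ->
  (forall x, ~ @bcube R n J x -> f x = 0%R) ->
  forall (e : R) N, (0 < e)%R ->
  exists2 j, (N <= j)%N & (`|c (bcorner R n j) (bside R j)| <= e)%R.
Proof.
move=> hb bb mF hosc o0 mg g0 og Ig0 I10 I20 gI fI bfI fQ e N e0.
have mb : measurable_fun setT b by case: hb => -[].
have beta0 : (0 < beta)%R by apply: le_lt_trans bb; rewrite fine_ge0// bmo_ge0.
pose m := (4 * n.+1 + 2)%N; have hm : (4 * n.+1 + 2 <= 2 ^ m)%N by rewrite ltnW// ltn_expl.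
pose A := (level_const R n * beta)%R.
have A0 : (0 < A)%R by rewrite mulr_gt0// level_const_gt0.
pose th := far_ratio p K.
have th0 : (0 < th)%R by rewrite powR_gt0 ?(beta_gt0 p1 K1 vs).
have th1 : (th < 1)%R.
  have := beta_lt1 p K1 => /(gt0_ltr_powR (r := p^-1)).
  have p0 : (0 < p)%R by exact: lt_trans p1.
  rewrite invr_gt0 powR1 => /(_ p0); apply; rewrite nnegrE ?ler01//.
  by rewrite ltW// (beta_gt0 p1 K1 vs).
pose cb a l := mean (cball a l) b.
pose kap (I : R) := ((I * @far_const R n p K v m) `^ p^-1)%R.
have kap0 I : (0 <= kap I)%R by exact: powR_ge0.
pose c0 := `|cb (bcorner R n 0) (bside R 0)|%R.
have c00 : (0 <= c0)%R by exact: normr_ge0.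
(* The three terms come from the chain of m + 1 comparisons together with the oscillation on the far
   subcube, from b T f with b at most linear in j, and from T(bf). *)
pose k := ((2 * m.+1%:R + 1) * kap Ig + (c0 + 2 * m.+1%:R * A + 3 * A) * kap I1 + kap I2)%R.
have k0 : (0 <= k)%R.
  apply: addr_ge0 (kap0 _); apply: addr_ge0; apply: mulr_ge0 (kap0 _).
    by rewrite addr_ge0// mulr_ge0.
  by rewrite !addr_ge0// mulr_ge0// ltW.
have th01 : (0 < th < 1)%R by rewrite th0.
have [j jN hj] := small_linear_geometric (maxn N (maxn J.+1 m)) k0 th01 e0.
move: jN; rewrite !geq_max => /and3P[Nj Jj mj].
exists j => //; apply: le_trans hj.
set a := @scorner R n j (j - m); set l : R := (2 ^+ (j - m))%R.
have l0 : (0 < l)%R by exact: pow2_gt0.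
have thj : (0 <= th ^+ j)%R by rewrite exprn_ge0// ltW.
have oP i : (j - m <= i)%N -> (o (@scorner R n j i) (2 ^+ i) <= kap Ig * th ^+ j)%R.
  move=> ji; rewrite -lee_fin; apply: (le_far p1 K1 vs mj mg g0 Ig0 gI).
    by rewrite lee_fin o0// pow2_gt0.
  move=> x xP; apply: og; first exact: pow2_gt0.
  exact: subcube_sub xP.
have far1 := far_value (T := T) Jj mj hm fQ I10 fI.
have bfQ x : ~ @bcube R n J x -> (b \* f)%R x = 0%R.
  by move=> /fQ /= ->; rewrite mulr0.
have far2 := far_value (T := T) Jj mj hm bfQ I20 bfI.
case: far1 => N1 [mN1 N10 far1]; case: far2 => N2 [mN2 N20 far2].
have muP : mu (hcube a l) = (l ^+ n.+1)%:E by exact: lebesgue_hcube (ltW l0).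
(* One good point is enough: the exceptional sets have proportions lam, lam / 2, 0 and 0, whose sum
   is less than 1. *)
have [z [Pz Fz bz N1z N2z]] : exists z, [/\ hcube a l z, ~ oscillation_bad (commutator b T f) c o a l z,
    ~ (hcube a l `&` [set x | (A < `|b x - cb a l|)%R]) z, ~ N1 z & ~ N2 z].
  apply: (lebesgue_cover4 (hosc a l l0) (bmo_level a hb l0 bb) N10 N20).
  have hl : (lam R n <= 2^-1)%R.
    rewrite /lam lef_pV2 ?posrE ?mulr_gt0 ?exprn_gt0//.
    have : (1 <= 2 ^+ n.+1 :> R)%R by rewrite exprn_ege1// ler1n.
    by lra.
  have ln : (0 < l ^+ n.+1)%R by rewrite exprn_gt0.
  rewrite [X in _ * X + _]muP [X in _ + _ * X]muP [ltRHS]muP -!EFinM -EFinD lte_fin.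
  rewrite -mulrDl -[ltRHS]mul1r ltr_pM2r//.
  by have := lam_gt0 R n; lra.
have Bz : cball a l z by exact: hcube_sub_eball.
have Tf : (`|T f z| <= kap I1 * th ^+ j)%R.
  by apply: contrapT => h; apply: N1z; apply: far1 => /(_ Bz).
have Tbf : (`|T (b \* f)%R z| <= kap I2 * th ^+ j)%R.
  by apply: contrapT => h; apply: N2z; apply: far2 => /(_ Bz).
have bzA : (`|b z - cb a l| <= A)%R by rewrite leNgt; apply/negP => h; apply: bz.
have FzA : (`|commutator b T f z - c a l| <= kap Ig * th ^+ j)%R.
  apply: le_trans (oP _ (leqnn _)); rewrite leNgt; apply/negP => h; exact: Fz.
have cba : (`|cb a l| <= c0 + 2 * (j + m.+1)%:R * A)%R :=
  subcube_center_growth mb (small_oscillation_bmo hb bb) mj (fun _ _ => lexx A).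
have chain := @subcube_chain R n _ c o mF hosc j (j - m) m.+1 (kap Ig * th ^+ j)
  (fun i _ => oP _ (leq_addr _ _)).
have jm : (j - m + m.+1 = j.+1)%N by rewrite addnS subnK.
rewrite jm scorner_top -/(bside R j) -/a -/l in chain.
move: Tf Tbf bzA FzA cba chain; rewrite natrD /k.
set q := (th ^+ j)%R in thj *; set M : R := m.+1%:R; set D := (c0 + 2 * M * A + 3 * A)%R.
have -> : j.+1%:R = (j%:R + 1)%R :> R by rewrite -addn1 natrD.
have j0 : (0 <= j%:R :> R)%R by [].
have M0 : (0 <= M)%R by [].
rewrite /commutator; set t1 := T f z; set t2 := T _ z; set cq := c (bcorner R n j) _.
move: (kap0 Ig) (kap0 I1) (kap0 I2); set kg := kap Ig; set k1 := kap I1; set k2 := kap I2.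
move: (c a l) (b z) (cb a l) (j%:R : R) j0 => ca bz' cba' jr jr0 kg0 k10 k20 h1 h2 h3 h4 h5 h6.
have bzD : (`|bz'| <= D * (jr + 1))%R.
  have h7 : (`|bz'| <= `|bz' - cba'| + `|cba'|)%R by rewrite -{1}(subrK cba' bz') ler_normD.
  have e1 : (0 <= c0 * jr)%R by rewrite mulr_ge0.
  have e2 : (0 <= M * A * jr)%R by apply: mulr_ge0 => //; apply: mulr_ge0 => //; exact: ltW.
  have e3 : (0 <= A * jr)%R by rewrite mulr_ge0// ltW.
  by rewrite /D; move: h3 h5 h7 e1 e2 e3 A0; lra.
have A00 : (0 <= A)%R by exact: ltW.
have D0 : (0 <= D)%R.
  by rewrite /D; apply: addr_ge0; [apply: addr_ge0 => //; apply: mulr_ge0 => //|]; apply: mulr_ge0.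
have prod : (`|bz' * t1 - t2| <= D * (jr + 1) * (k1 * q) + k2 * q)%R.
  apply: (le_trans (ler_normB _ _)); apply: lerD => //.
  by rewrite normrM; apply: ler_pM.
have h7 : (`|ca| <= `|bz' * t1 - t2 - ca| + `|bz' * t1 - t2|)%R.
  by rewrite (distrC _ ca) -{1}(subrK (bz' * t1 - t2)%R ca) ler_normD.
have h8 : (`|cq| <= `|ca - cq| + `|ca|)%R.
  by rewrite (distrC ca) -{1}(subrK ca cq) ler_normD.
have e1 : (0 <= (2 * M + 1) * kg * q * jr)%R.
  by do 3!apply: mulr_ge0 => //; apply: addr_ge0 => //; apply: mulr_ge0.
have e2 : (0 <= k2 * q * jr)%R by do 2!apply: mulr_ge0 => //.
by move: h4 h6 prod h7 h8 e1 e2; lra.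
Qed.

End far_limit.

(** * Oscillation of the commutator and conclusion *)

Section commutator_estimate.
Context (R : realType) (n : nat).
Local Notation E := (Rn R n).
Local Notation mu := (@lebesgue R n).
Local Open Scope ereal_scope.

Lemma poweR_add_le (x y : \bar R) (p : R) : 0 <= x -> 0 <= y -> (0 < p)%R ->
  (x + y) `^ p <= (2 `^ p)%:E * (x `^ p + y `^ p).
Proof.
move=> x0 y0 p0; have c0 : (0 < 2 `^ p :> R)%R by exact: powR_gt0.
have ny (z : \bar R) : 0 <= z -> z != -oo by move=> z0; rewrite gt_eqF// (lt_le_trans _ z0).
have py : +oo `^ p = +oo :> \bar R by rewrite poweRyr// gt_eqF.
case: x x0 => [x x0|_|//]; last first.
  by rewrite addye ?ny// py addye ?ny ?poweR_ge0// gt0_muley ?lte_fin ?leey.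
case: y y0 => [y y0|_|//]; last first.
  by rewrite addey ?ny// py addey ?ny ?poweR_ge0// gt0_muley ?lte_fin ?leey.
rewrite -EFinD !poweR_EFin -EFinD -EFinM lee_fin.
by apply: powR_add_le; rewrite -?lee_fin// ltW.
Qed.

Lemma scaled_ge (w : E -> R) (s : R) x : (s <= 1)%R -> (0 <= w x)%R ->
  (s * w x <= scaled w s x)%R.
Proof.
move=> s1 w0; have [xU|xU] := pselect (@unit_cell R n x); first by rewrite scaled_in.
by rewrite scaled_off// ler_piMl.
Qed.

Lemma scaled_le (w : E -> R) (s : R) x : (s <= 1)%R -> (0 <= w x)%R ->
  (scaled w s x <= w x)%R.
Proof.
move=> s1 w0; have [xU|xU] := pselect (@unit_cell R n x); last by rewrite scaled_off.
by rewrite scaled_in// ler_piMl.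
Qed.

Lemma Linfty_norm_quotient_le (f u : E -> R) (k : R) : positive_fun u -> (0 <= k)%R ->
  (forall x, `|f x| <= k * u x)%R -> 'N[mu]_+oo[(fun x => (f x / u x)%:E)] <= k%:E.
Proof.
move=> u0 k0 fu; rewrite unlock lebesgue_setT_gt0; apply/ess_supP; apply: nearW => x /=.
by rewrite lee_fin normrM normfV (gtr0_norm (u0 x)) ler_pdivrMr ?u0.
Qed.

Lemma ess_inf_on_ge0 (A : set E) (u : E -> R) : (forall x, 0 <= u x)%R ->
  0 <= ess_inf_on A (EFin \o u).
Proof.
by move=> u0; apply: ereal_sup_ubound; apply: nearW => x _; rewrite lee_fin.
Qed.

Variables (delta : R) (D : set (E -> R)) (T : (E -> R) -> (E -> R)).
Variable (Tc : (E -> R) -> E -> R -> R) (cT : R -> R).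
Hypothesis (hdelta : (0 < delta < 1)%R).
Hypothesis (hD : operator_domain D).
Hypothesis (mT : forall f, D f -> measurable_fun setT (T f)).
Hypothesis (hTc : center_value T Tc).
Hypothesis hosc : forall (b w f : E -> R) (c : E) (r : R),
  BMO b -> A1_weight w -> (0 < r)%R -> Linfty_c f ->
  ereal_inf [set emean (eball c r)
      (fun x => (`|commutator b T f x - c1 - Tc f c r * b x| `^ delta)%R) `^ delta^-1
    | c1 in [set: R]]
  <= (cT (fine (A1_const w)))%:E * 'N[mu]_+oo[(fun x => (f x / w x)%:E)]
     * bmo_norm b * ess_inf_on (eball c r) (EFin \o w).

Lemma center_value_le_grand_maximal (f : E -> R) a l x : Linfty_c f -> (0 < l)%R ->
  hcube a l x -> `|Tc f (ccenter a l) (l * n.+1%:R)%R|%:E <= grand_maximal T f x.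
Proof.
move=> hf l0 ax; have r0 := cball_radius_gt0 n l0.
apply: (le_trans (hTc (ccenter a l) hf r0)); apply: grand_maximal_ge => //.
exact: hcube_sub_eball.
Qed.

Section one_weight.
Variables (K1 : R) (b f w : E -> R) (beta L : R).
Hypotheses (K11 : (1 <= K1)%R) (hb : BMO b) (bb : (fine (bmo_norm b) < beta)%R).
Hypotheses (hf : Linfty_c f) (mw : measurable_fun setT w) (w0 : positive_fun w).
Hypotheses (fw : forall x, (`|f x| <= w x)%R) (wL : forall x, (w x <= L)%R).
Hypothesis (wA1 : forall x, maximal w x <= K1%:E * (w x)%:E).

(** The absolute value allows for a cT of any sign. The quotient comes from |f| <= u / min_scaling
    for the scaled weight u, and the added 1 makes a later inequality strict. *)
Definition cT_const : R := (`|cT (target_A1 K1)| / min_scaling n K1 + 1)%R.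

Lemma cT_const_gt0 : (0 < cT_const)%R.
Proof. by rewrite ltr_wpDl// divr_ge0// ltW// min_scaling_gt0. Qed.

Let beta0 : (0 < beta)%R.
Proof. by apply: le_lt_trans bb; rewrite fine_ge0// bmo_ge0. Qed.

Lemma emean_cball_fin a l : (0 < l)%R ->
  exists2 M : R, emean (cball a l) w = M%:E & (0 < M)%R.
Proof.
move=> l0; have r0 := cball_radius_gt0 n l0.
have [Bf _ _] := lebesgue_eball_bounds (ccenter a l) r0.
have B0 := lebesgue_eball_gt0 (ccenter a l) r0.
have mB : measurable (cball a l) by exact: measurable_eball.
have fB0 : (0 < fine (mu (cball a l)))%R by rewrite fine_gt0// B0 -ge0_fin_numE ?(ltW B0).
have I0 : 0 < \int[mu]_(x in cball a l) (w x)%:E by exact: integral_gt0_of_pos.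
have Ioo : \int[mu]_(x in cball a l) (w x)%:E < +oo.
  apply: (@le_lt_trans _ _ (\int[mu]_(x in cball a l) L%:E)).
    apply: ge0_le_integral.
    - exact: mB.
    - by move=> x _; rewrite lee_fin ltW// w0.
    - exact: measurable_EFin_in.
    - exact: measurable_cst.
    - by move=> x _; rewrite lee_fin.
  have BE : mu (cball a l) = (fine (mu (cball a l)))%:E by rewrite fineK.
  by rewrite integral_cst// [X in _ * X]BE -EFinM ltry.
have IE : \int[mu]_(x in cball a l) (w x)%:E = (fine (\int[mu]_(x in cball a l) (w x)%:E))%:E.
  by rewrite fineK// ge0_fin_numE// ltW.
exists ((fine (mu (cball a l)))^-1 * fine (\int[mu]_(x in cball a l) (w x)%:E))%R.
  by rewrite EFinM -IE.
by rewrite mulr_gt0 ?invr_gt0// fine_gt0// I0.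
Qed.

Lemma commutator_oscillation a l : (0 < l)%R -> exists c1 : R,
  emean (cball a l) (fun x => (`|commutator b T f x - c1
      - Tc f (ccenter a l) (l * n.+1%:R) * b x| `^ delta)%R)
    <= ((cT_const * beta * fine (emean (cball a l) w)) `^ delta)%:E.
Proof.
move=> l0; have r0 := cball_radius_gt0 n l0; have /andP[d0 _] := hdelta.
have [M ME M0] := emean_cball_fin a l0; rewrite ME/=.
have wN : \int[mu]_(x in @next_cell R n) (w x)%:E < +oo.
  apply: (@le_lt_trans _ _ (\int[mu]_(x in @next_cell R n) L%:E)).
    apply: ge0_le_integral.
    - exact: measurable_hcube.
    - by move=> x _; rewrite lee_fin ltW// w0.
    - exact: measurable_EFin_in.
    - exact: measurable_cst.
    - by move=> x _; rewrite lee_fin.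
  rewrite integral_cst; last exact: measurable_hcube.
  by rewrite [X in _ * X]lebesgue_unit mule1 ltry.
(* The hypothesis is applied to the scaled weight. Its A_1 constant is exactly [target_A1 K1], so cT
   enters through a single value, independent of b and f. *)
have [s [/andP[ms s1] sfin sE]] := exact_A1_const K11 mw w0 wN wA1.
have ms0 : (0 < min_scaling n K1)%R by exact: min_scaling_gt0.
have s0 : (0 < s)%R by exact: lt_le_trans ms.
pose u := scaled w s.
have u0 : positive_fun u by exact: scaled_gt0.
have mu_ : measurable_fun setT u by exact: measurable_scaled.
have uw x : (u x <= w x)%R by apply: scaled_le => //; rewrite ltW// w0.
have hu : A1_weight u.
  split; [split| |exact: sfin].
  - by move=> x; rewrite ltW// u0.
  - apply: (@locally_integrable_bounded R n u L mu_) => x.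
    by rewrite gtr0_norm ?u0// (le_trans (uw x)).
  - by apply: nearW => x; exact: u0.
have Bf : mu (cball a l) \is a fin_num by have [] := lebesgue_eball_bounds (ccenter a l) r0.
have B0 : 0 < mu (cball a l) by exact: lebesgue_eball_gt0.
have mB : measurable (cball a l) by exact: measurable_eball.
have ei : ess_inf_on (cball a l) (EFin \o u) <= M%:E.
  rewrite -ME; apply: (le_trans (ess_inf_on_le_emean mB Bf B0 mu_ _)).
    by move=> x; rewrite ltW// u0.
  by apply: le_emean => // x; rewrite ltW// u0.
have ei0 : 0 <= ess_inf_on (cball a l) (EFin \o u).
  by apply: ess_inf_on_ge0 => x; rewrite ltW// u0.
have nf : 'N[mu]_+oo[(fun x => (f x / u x)%:E)] <= ((min_scaling n K1)^-1)%:E.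
  apply: Linfty_norm_quotient_le => // [|x]; first by rewrite invr_ge0 ltW.
  rewrite ler_pdivlMl//; apply: le_trans (scaled_ge s1 (ltW (w0 x))).
  apply: ler_pM => //; exact: ltW.
have nf0 : 0 <= 'N[mu]_+oo[(fun x => (f x / u x)%:E)] by exact: Lnorm_ge0.
have beta00 : (0 <= fine (bmo_norm b))%R by rewrite fine_ge0// bmo_ge0.
have lt1 : (`|cT (target_A1 K1)| / min_scaling n K1 * fine (bmo_norm b) * M <
    cT_const * beta * M)%R.
  rewrite ltr_pM2r//.
  have q0 : (0 <= `|cT (target_A1 K1)| / min_scaling n K1)%R by rewrite divr_ge0// ltW.
  apply: (@le_lt_trans _ _ (`|cT (target_A1 K1)| / min_scaling n K1 * beta)%R).
    by rewrite ler_wpM2l// ltW.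
  by rewrite ltr_pM2r// /cT_const ltrDl.
(* The infimum over c1 need not be attained; a strict upper bound yields an actual c1. Strictness
   comes from the added 1 in [cT_const], as beta and M are positive. *)
have hinf : ereal_inf [set emean (cball a l)
      (fun x => (`|commutator b T f x - c1 - Tc f (ccenter a l) (l * n.+1%:R) * b x| `^ delta)%R)
      `^ delta^-1 | c1 in [set: R]] < (cT_const * beta * M)%:E.
  apply: le_lt_trans (hosc (ccenter a l) hb hu r0 hf) _; rewrite sE.
  apply: (@le_lt_trans _ _ ((`|cT (target_A1 K1)| / min_scaling n K1 * fine (bmo_norm b) * M)%:E)); last first.
    by rewrite lte_fin.
  rewrite (bmo_norm_fine hb) !EFinM.
  apply: (@le_trans _ _ (`|cT (target_A1 K1)|%:E * 'N[mu]_+oo[(fun x => (f x / u x)%:E)]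
      * (fine (bmo_norm b))%:E * ess_inf_on (cball a l) (EFin \o u))).
    apply: lee_wpmul2r; first exact: ei0.
    apply: lee_wpmul2r; first by rewrite lee_fin.
    by apply: lee_wpmul2r; [exact: nf0|rewrite lee_fin ler_norm].
  apply: lee_pmul.
  - by rewrite mule_ge0// mule_ge0.
  - exact: ei0.
  - apply: lee_wpmul2r; first by rewrite lee_fin.
    by apply: lee_wpmul2l; [rewrite lee_fin|exact: nf].
  - exact: ei.
have [_ [c1 _ <-] hc1] := ereal_inf_lt hinf.
exists c1; set X := emean _ _ in hc1 *.
have X0 : 0 <= X by apply: emean_ge0 => x; exact: powR_ge0.
have -> : X = (X `^ delta^-1) `^ delta by rewrite -poweRrM mulVf ?gt_eqF// poweRe1.
rewrite -poweR_EFin; apply: lee_poweR; [exact: ltW|exact: poweR_ge0|exact: ltW].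
Qed.

Let tau a l := Tc f (ccenter a l) (l * n.+1%:R)%R.

(** First term: the mean of w over the ball is at most ball_ratio K1 w(x) at every point x of the
    cube, by the A_1 condition. Second term: the error |tau| level_const beta, where |tau| is at
    most the grand maximal function. *)
Definition sharp_const : R :=
  (level_const R n `^ delta^-1 * cT_const * ball_ratio R n * K1 + level_const R n)%R.

Definition sharp_majorant (x : E) : \bar R :=
  (sharp_const * beta)%:E * ((w x)%:E + grand_maximal T f x).

Lemma sharp_const_gt0 : (0 < sharp_const)%R.
Proof.
apply: ltr_wpDl; last exact: level_const_gt0.
apply: mulr_ge0; last exact: le_trans K11.
apply: mulr_ge0; last exact: ltW (ball_ratio_gt0 R n).
by apply: mulr_ge0; [exact: powR_ge0|exact: ltW cT_const_gt0].
Qed.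

Lemma sharp_majorant_ge0 x : 0 <= sharp_majorant x.
Proof.
apply: mule_ge0; first by rewrite lee_fin mulr_ge0 ?ltW ?sharp_const_gt0.
by rewrite adde_ge0 ?grand_maximal_ge0// lee_fin ltW// w0.
Qed.

Lemma measurable_sharp_majorant : measurable_fun setT sharp_majorant.
Proof.
apply: measurable_funeM; apply: emeasurable_funD; first exact: measurable_EFin_in.
exact: measurable_grand_maximal.
Qed.

Lemma measurable_commutator : measurable_fun setT (commutator b T f).
Proof.
have mb : measurable_fun setT b by case: hb => -[].
apply: measurable_funB; last by apply: mT; exact: (domain_BMO hD).
by apply: measurable_funM; [exact: mb|apply: mT; exact: (domain_Linfty_c hD)].
Qed.

Lemma commutator_small_oscillation : exists c o : E -> R -> R,
  [/\ small_oscillation (commutator b T f) c o,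
    forall a l, (0 < l)%R -> (0 <= o a l)%R &
    forall a l x, (0 < l)%R -> hcube a l x -> (o a l)%:E <= sharp_majorant x].
Proof.
have /andP[d0 _] := hdelta.
have /choice[c1 c1P] (al : E * R) : exists c1 : R, (0 < al.2)%R ->
    emean (cball al.1 al.2) (fun x => (`|commutator b T f x - c1
      - tau al.1 al.2 * b x| `^ delta)%R)
    <= ((cT_const * beta * fine (emean (cball al.1 al.2) w)) `^ delta)%:E.
  have [l0|l0] := pselect (0 < al.2)%R; last by exists 0%R.
  by have [c1 h] := commutator_oscillation al.1 l0; exists c1.
pose k a l := (cT_const * beta * fine (emean (cball a l) w))%R.
have k0 a l : (0 < l)%R -> (0 < k a l)%R.
  move=> l0; have [M ME M0] := emean_cball_fin a l0.
  by rewrite /k ME/=; apply: mulr_gt0 => //; apply: mulr_gt0 => //; exact: cT_const_gt0.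
have osc := small_oscillation_perturbed hb bb measurable_commutator d0 k0
  (fun a l l0 => c1P (a, l) l0).
have L0 := level_const_gt0 R n.
eexists; eexists; split; first exact: osc.
  move=> a l l0 /=; apply: addr_ge0; apply: mulr_ge0 => //.
  - exact: powR_ge0.
  - exact: ltW (k0 _ _ l0).
  - by apply: mulr_ge0; exact: ltW.
move=> a l x l0 ax /=.
have Gx := center_value_le_grand_maximal hf l0 ax.
have r0 := cball_radius_gt0 n l0.
have Bx : cball a l x by exact: hcube_sub_eball.
have [M ME M0] := emean_cball_fin a l0.
have Mw : (M <= ball_ratio R n * K1 * w x)%R.
  rewrite -lee_fin -ME (le_trans (emean_eball_le_maximal mw w0 r0 Bx))//.
  rewrite -mulrA EFinM; apply: lee_wpmul2l; first by rewrite lee_fin ltW// ball_ratio_gt0.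
  by rewrite EFinM.
have Gx0 : 0 <= grand_maximal T f x by exact: grand_maximal_ge0.
have wx := w0 x.
have sc0 : (0 <= sharp_const * beta)%R by rewrite mulr_ge0 ?ltW ?sharp_const_gt0.
rewrite EFinD /sharp_majorant ge0_muleDr//; last by rewrite lee_fin ltW.
have lc0 : (0 <= level_const R n `^ delta^-1)%R by exact: powR_ge0.
have K10 : (0 < K1)%R by exact: lt_le_trans K11.
have c0 := cT_const_gt0.
have lck : (0 <= level_const R n `^ delta^-1 * cT_const * ball_ratio R n * K1)%R.
  apply: mulr_ge0; last exact: ltW.
  by apply: mulr_ge0; [apply: mulr_ge0|]; rewrite ?(ltW c0) ?(ltW (ball_ratio_gt0 R n)).
apply: leeD.
  rewrite -EFinM lee_fin /k ME/= /sharp_const.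
  apply: (@le_trans _ _ (level_const R n `^ delta^-1 * (cT_const * beta * (ball_ratio R n * K1 * w x)))%R).
    apply: ler_wpM2l => //; apply: ler_wpM2l => //.
    by apply: mulr_ge0; exact: ltW.
  have : (0 <= level_const R n * beta * w x)%R.
    by apply: mulr_ge0; [apply: mulr_ge0|]; exact: ltW.
  lra.
apply: (@le_trans _ _ ((level_const R n * beta)%:E * `|tau a l|%:E)).
  by rewrite -EFinM lee_fin mulrC.
apply: lee_pmul => //.
- by rewrite lee_fin mulr_ge0// ltW.
- by rewrite lee_fin ler_wpM2r ?(ltW beta0)// /sharp_const lerDr.
Qed.

End one_weight.
End commutator_estimate.

Section weighted_bound.
Context (R : realType) (n : nat).
Local Notation E := (Rn R n).
Local Notation mu := (@lebesgue R n).
Local Open Scope ereal_scope.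
Variables (delta : R) (D : set (E -> R)) (T : (E -> R) -> (E -> R)).
Variable (Tc : (E -> R) -> E -> R -> R) (cT : R -> R).
Hypothesis (hdelta : (0 < delta < 1)%R).
Hypothesis (hD : operator_domain D).
Hypothesis (mT : forall f, D f -> measurable_fun setT (T f)).
Hypothesis (hTc : center_value T Tc).
Hypothesis hosc : forall (b w f : E -> R) (c : E) (r : R),
  BMO b -> A1_weight w -> (0 < r)%R -> Linfty_c f ->
  ereal_inf [set emean (eball c r)
      (fun x => (`|commutator b T f x - c1 - Tc f c r * b x| `^ delta)%R) `^ delta^-1
    | c1 in [set: R]]
  <= (cT (fine (A1_const w)))%:E * 'N[mu]_+oo[(fun x => (f x / w x)%:E)]
     * bmo_norm b * ess_inf_on (eball c r) (EFin \o w).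
Variables (p K : R) (v s : E -> R).
Hypotheses (p1 : (1 < p)%R) (K1 : (1 <= K)%R) (vs : Ap_pair p K v s).
Variable CM : R.
Hypothesis CM0 : (0 <= CM)%R.
Hypothesis hM : forall h : E -> R, D h -> \int[mu]_x ((`|h x| `^ p)%:E * (v x)%:E) < +oo ->
  \int[mu]_x (grand_maximal T h x `^ p * (v x)%:E)
    <= CM%:E * \int[mu]_x ((`|h x| `^ p)%:E * (v x)%:E).

(** One parameter e measures both the excess of beta over the BMO norm and the bump added to |f|;
    the bound is continuous in e, so it survives at e = 0. *)
Lemma le_of_small_error (X : \bar R) (k B A : R) : (0 <= k)%R -> (0 <= B)%R -> (0 <= A)%R ->
  (forall e : R, (0 < e)%R -> X <= (k * ((B + e) * (A + e)))%:E) -> X <= (k * (B * A))%:E.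
Proof.
move=> k0 B0 A0 h; apply/lee_addgt0Pr => e e0.
pose d := Num.min 1%R (e / (k * (B + A + 1) + 1))%R.
have q0 : (0 < k * (B + A + 1) + 1)%R.
  by rewrite ltr_wpDl// mulr_ge0// !addr_ge0.
have d0 : (0 < d)%R by rewrite lt_min ltr01 divr_gt0.
have d1 : (d <= 1)%R by rewrite ge_min lexx.
have de : (d * (k * (B + A + 1) + 1) <= e)%R by rewrite -ler_pdivlMr// ge_min lexx orbT.
apply: (le_trans (h d d0)); rewrite -EFinD lee_fin.
have h1 : (0 <= k * (d * (1 - d)))%R.
  by apply: mulr_ge0 => //; apply: mulr_ge0; [exact: ltW|rewrite subr_ge0].
by move: de h1 d0; lra.
Qed.

Theorem commutator_bound : exists2 C : R, (0 <= C)%R & forall b f : E -> R,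
  BMO b -> Linfty_c f ->
  \int[mu]_x ((`|commutator b T f x| `^ p)%:E * (v x)%:E) <=
    C%:E * ((fine (bmo_norm b) `^ p)%:E * \int[mu]_x ((`|f x| `^ p)%:E * (v x)%:E)).
Proof.
have p0 : (0 < p)%R by exact: lt_trans p1.
have mv := pair_mv vs; have v0 := pair_v_ge0 vs.
have [Ka [C1 [Ka1 C10 HC1]]] := exists_A1_majorant p1 K1 vs.
have [Cs Cs0 HCs] := global_sharp_estimate p1 K1 vs.
pose G := sharp_const n delta cT Ka.
have G0 : (0 < G)%R by exact: sharp_const_gt0.
pose k := (Cs * (G `^ p * (2 `^ p * (C1 + CM))))%R.
have k0 : (0 <= k)%R.
  apply: mulr_ge0; first exact: ltW.
  apply: mulr_ge0; first exact: powR_ge0.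
  by apply: mulr_ge0; [exact: powR_ge0|rewrite addr_ge0// ltW].
exists k => // b f hb hf.
have [mf [M fM] _] := hf.
have If := Linfty_c_Lp p1 vs hf.
have If0 : 0 <= \int[mu]_x ((`|f x| `^ p)%:E * (v x)%:E).
  by apply: integral_ge0 => x _; rewrite -EFinM lee_fin mulr_ge0 ?powR_ge0// v0.
pose A := fine (\int[mu]_x ((`|f x| `^ p)%:E * (v x)%:E)).
have A0 : (0 <= A)%R by exact: fine_ge0.
have AE : \int[mu]_x ((`|f x| `^ p)%:E * (v x)%:E) = A%:E.
  by rewrite fineK// ge0_fin_numE.
(* Only finiteness of this integral matters: it makes the constants on large cubes tend to 0, and
   its value does not occur in [k]. *)
have Ib := BMO_mul_Lp p1 K1 vs hb hf.
have Ib0 : 0 <= \int[mu]_x ((`|b x * f x| `^ p)%:E * (v x)%:E).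
  by apply: integral_ge0 => x _; rewrite -EFinM lee_fin mulr_ge0 ?powR_ge0// v0.
pose A2 := fine (\int[mu]_x ((`|b x * f x| `^ p)%:E * (v x)%:E)).
have A20 : (0 <= A2)%R by exact: fine_ge0.
have A2E : \int[mu]_x ((`|b x * f x| `^ p)%:E * (v x)%:E) = A2%:E.
  by rewrite fineK// ge0_fin_numE.
have Gf : \int[mu]_x (grand_maximal T f x `^ p * (v x)%:E) <= (CM * A)%:E.
  by rewrite EFinM -AE; apply: hM => //; exact: (domain_Linfty_c hD).
have Gbf : \int[mu]_x (grand_maximal T (b \* f)%R x `^ p * (v x)%:E) <= (CM * A2)%:E.
  by rewrite EFinM -A2E; apply: hM => //; exact: (domain_BMO hD).
have [J fJ] := Linfty_c_bcube hf.
pose B := (fine (bmo_norm b) `^ p)%R.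
have B0 : (0 <= B)%R by exact: powR_ge0.
rewrite AE -!EFinM -/B; apply: le_of_small_error; [exact: k0|exact: B0|exact: A0|move=> e e0].
(* Strictly above the BMO norm, with beta^p exceeding the p-th power of the norm by exactly e. *)
pose beta := ((B + e) `^ p^-1)%R.
have bmo0 : (0 <= fine (bmo_norm b))%R by rewrite fine_ge0// bmo_ge0.
have bb : (fine (bmo_norm b) < beta)%R.
  have -> : fine (bmo_norm b) = (B `^ p^-1)%R by rewrite /B -powRrM mulfV ?gt_eqF// powRr1.
  by apply: gt0_ltr_powR; rewrite ?invr_gt0 ?nnegrE ?addr_ge0 ?ltrDl// ltW.
have betap : (beta `^ p = B + e)%R.
  by rewrite /beta -powRrM mulVf ?gt_eqF// powRr1// addr_ge0// ltW.
have beta0 : (0 < beta)%R by exact: le_lt_trans bb.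
have [w [[mw w0] fw [L wL] wA1 wI]] := HC1 f M e mf fM e0.
have [c [os [osc o0 og]]] := commutator_small_oscillation hdelta hD mT hTc hosc Ka1 hb bb hf mw w0 fw wL wA1.
set g := sharp_majorant delta T cT Ka f w beta in og.
have g0 x : 0 <= g x by exact: (sharp_majorant_ge0 delta T cT f Ka1 bb w0 x).
have mg : measurable_fun setT g by exact: (measurable_sharp_majorant delta T cT Ka f beta mw).
have mF : measurable_fun setT (commutator b T f) := measurable_commutator hD mT hb hf.
have mvE : measurable_fun setT (fun x => (v x)%:E) by exact: measurable_EFin_in mv.
have mGM := measurable_grand_maximal T f.
have GM0 x : 0 <= grand_maximal T f x by exact: grand_maximal_ge0.
have mgv : measurable_fun setT (fun x => grand_maximal T f x `^ p * (v x)%:E).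
  by apply: emeasurable_funM; [exact: (measurable_poweR_fun p mGM)|exact: mvE].
have mwv : measurable_fun setT (fun x => (w x `^ p)%:E * (v x)%:E).
  by apply: emeasurable_funM; [apply/measurable_EFinP; exact: measurable_powR_fun|exact: mvE].
have gv0 x : 0 <= grand_maximal T f x `^ p * (v x)%:E.
  by rewrite mule_ge0 ?poweR_ge0// lee_fin v0.
have wv0 x : 0 <= (w x `^ p)%:E * (v x)%:E.
  by rewrite -EFinM lee_fin mulr_ge0 ?powR_ge0// v0.
pose Ig := (G `^ p * (2 `^ p * (C1 + CM)) * ((B + e) * (A + e)))%R.
have gI : \int[mu]_x (g x `^ p * (v x)%:E) <= Ig%:E.
  apply: (@le_trans _ _ (\int[mu]_x ((G `^ p * (B + e) * 2 `^ p)%:E *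
      ((w x `^ p)%:E * (v x)%:E + grand_maximal T f x `^ p * (v x)%:E)))).
    apply: ge0_le_integral.
    - exact: measurableT.
    - by move=> x _; rewrite mule_ge0 ?poweR_ge0// lee_fin v0.
    - by apply: emeasurable_funM; [exact: (measurable_poweR_fun p mg)|exact: mvE].
    - by apply: measurable_funeM; apply: emeasurable_funD; [exact: mwv|exact: mgv].
    - move=> x _; rewrite -ge0_muleDl ?poweR_ge0 ?lee_fin ?powR_ge0// muleA.
      apply: lee_wpmul2r; first by rewrite lee_fin v0.
      have wx0 : 0 <= (w x)%:E by rewrite lee_fin ltW// w0.
      rewrite /g /sharp_majorant -/G poweRM; last 2 first.
      - by rewrite lee_fin mulr_ge0// ltW.
      - by rewrite adde_ge0.
      rewrite poweR_EFin powRM ?(ltW G0) ?(ltW beta0)// betap (EFinM (G `^ p * (B + e))%R (2 `^ p)%R) -muleA.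
      apply: lee_wpmul2l; first by rewrite lee_fin mulr_ge0 ?powR_ge0// addr_ge0// ltW.
      by have := poweR_add_le wx0 (GM0 x) p0; rewrite poweR_EFin.
  have c0 : (0 <= G `^ p * (B + e) * 2 `^ p)%R.
    by rewrite !mulr_ge0 ?powR_ge0// addr_ge0// ltW.
  rewrite ge0_integralZl_EFin; last 4 first.
  - exact: measurableT.
  - by move=> x _; exact: adde_ge0.
  - by apply: emeasurable_funD; [exact: mwv|exact: mgv].
  - exact: c0.
  rewrite ge0_integralD; last 5 first.
  - exact: measurableT.
  - by move=> x _; exact: wv0.
  - exact: mwv.
  - by move=> x _; exact: gv0.
  - exact: mgv.
  apply: (@le_trans _ _ ((G `^ p * (B + e) * 2 `^ p)%:E * ((C1 * (A + e))%:E + (CM * A)%:E))).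
    apply: lee_wpmul2l; first by rewrite lee_fin.
    apply: leeD; last exact: Gf.
    by apply: (le_trans wI); rewrite AE -EFinD -EFinM.
  rewrite -EFinD -EFinM lee_fin /Ig.
  have -> : (G `^ p * (2 `^ p * (C1 + CM)) * ((B + e) * (A + e)) =
    G `^ p * (B + e) * 2 `^ p * ((C1 + CM) * (A + e)))%R by ring.
  apply: ler_wpM2l => //; rewrite mulrDl lerD2l; apply: ler_wpM2l => //.
  by rewrite lerDl ltW.
have Ig0 : (0 <= Ig)%R.
  by rewrite -lee_fin; apply: le_trans gI; apply: integral_ge0 => x _; rewrite mule_ge0 ?poweR_ge0// lee_fin v0.
have far := far_limit p1 K1 vs hb bb mF osc o0 mg g0 og Ig0 (mulr_ge0 CM0 A0)
  (mulr_ge0 CM0 A20) gI Gf Gbf fJ.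
apply: (le_trans (HCs _ _ _ _ mF osc mg g0 og far)).
rewrite /k -mulrA EFinM; apply: lee_wpmul2l gI; by rewrite lee_fin ltW.
Qed.

End weighted_bound.

Section Lp_norms.
Context (R : realType) (n : nat).
Local Notation E := (Rn R n).
Local Notation mu := (@lebesgue R n).
Local Open Scope ereal_scope.
Variables (p : R) (v v' : E -> R).
Hypotheses (p0 : (0 < p)%R) (mv : measurable_fun setT v) (mv' : measurable_fun setT v').
Hypotheses (v0 : forall x, (0 <= v x)%R) (v'0 : forall x, (0 <= v' x)%R).
Hypothesis vv' : {ae mu, forall x, v x = v' x}.

Lemma Lp_normE (h : E -> \bar R) : measurable_fun setT h ->
  Lp_norm p v h = (\int[mu]_x (`|h x| `^ p * (v' x)%:E)) `^ p^-1.
Proof.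
move=> mh; rewrite /Lp_norm; congr (_ `^ _).
apply: (ae_eq_integral_mul measurableT mv mv' _ v0 v'0 _ vv').
  by apply: measurable_poweR_fun; exact: measurableT_comp.
by move=> x; exact: poweR_ge0.
Qed.

End Lp_norms.

Lemma poweR_root_le (R : realType) (X Y : \bar R) (C B p : R) : 0 < p -> 0 <= C -> 0 <= B ->
  (0 <= X)%E -> (0 <= Y)%E -> (X <= C%:E * ((B `^ p)%:E * Y))%E ->
  (X `^ p^-1 <= (C `^ p^-1)%:E * B%:E * Y `^ p^-1)%E.
Proof.
move=> p0 C0 B0 X0 Y0 h; have ip0 : 0 <= p^-1 by rewrite invr_ge0 ltW.
apply: (le_trans (lee_poweR ip0 X0 h)).
have BY : (0 <= (B `^ p)%:E * Y)%E by rewrite mule_ge0// lee_fin powR_ge0.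
rewrite poweRM ?lee_fin// poweRM ?lee_fin ?powR_ge0//.
by rewrite !poweR_EFin -powRrM mulfV ?gt_eqF// powRr1// muleA.
Qed.

Theorem theorem5 (R : realType) (n : nat) (delta : R)
  (D : set (Rn R n -> R)) (T : (Rn R n -> R) -> (Rn R n -> R))
  (Tc : (Rn R n -> R) -> Rn R n -> R -> R)
  (hdelta : 0 < delta < 1)
  (hD : operator_domain D) (hT : linear_operator D T)
  (hTc : center_value T Tc)
  (hosc : exists cT : R -> R, forall (b w f : Rn R n -> R) (c : Rn R n) (r : R),
    BMO b -> A1_weight w -> 0 < r -> Linfty_c f ->
    (ereal_inf [set emean (eball c r)
                      (fun x => (`|commutator b T f x - c1 - Tc f c r * b x|
                                 `^ delta)%R) `^ delta^-1
               | c1 in [set: R]]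
     <= (cT (fine (A1_const w)))%:E
        * 'N[@lebesgue R n]_+oo[(fun x => (f x / w x)%:E)]
        * bmo_norm b * ess_inf_on (eball c r) (EFin \o w))%E)
  (p : R) (hp : 1 < p) (v : Rn R n -> R) (hv : Ap_weight p v)
  (hM : grand_maximal_bounded D T p v) :
  exists C : R, forall b f : Rn R n -> R, BMO b -> Linfty_c f ->
    (Lp_norm p v (EFin \o commutator b T f)
     <= C%:E * bmo_norm b * Lp_norm p v (EFin \o f))%E.
Proof.
have p0 : 0 < p by exact: lt_trans hp.
(* From here on the norms are computed with an everywhere positive representative of v, which
   changes no integral. *)
have [v' [s [K [K1 vs vv']]]] := Ap_weight_pair hp hv.
have [[v0 [mv _]] _ _] := hv.
have mv' := pair_mv vs; have v'0 := pair_v_ge0 vs.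
have [cT hcT] := hosc; have [CM hCM] := hM.
have LpE (h : Rn R n -> R) : measurable_fun setT h -> (Lp_norm p v (EFin \o h) =
    (\int[@lebesgue R n]_x ((`|h x| `^ p)%:E * (v' x)%:E)) `^ p^-1)%E.
  move=> mh; rewrite (Lp_normE p mv mv' v0 v'0 vv'); last exact/measurable_EFinP.
  by congr (_ `^ _)%E; apply: eq_integral => x _; rewrite /= poweR_EFin.
have Ige0 (h : Rn R n -> R) :
    (0 <= \int[@lebesgue R n]_x ((`|h x| `^ p)%:E * (v' x)%:E))%E.
  by apply: integral_ge0 => x _; rewrite -EFinM lee_fin mulr_ge0 ?powR_ge0.
(* The constant given by the hypothesis may be negative, and its p-th power is taken below. *)
pose CM' := Num.max CM 0.
have CM'0 : 0 <= CM' by rewrite le_max lexx orbT.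
have hM' (h : Rn R n -> R) : D h ->
    (\int[@lebesgue R n]_x ((`|h x| `^ p)%:E * (v' x)%:E) < +oo)%E ->
    (\int[@lebesgue R n]_x (grand_maximal T h x `^ p * (v' x)%:E)
      <= (CM' `^ p)%:E * \int[@lebesgue R n]_x ((`|h x| `^ p)%:E * (v' x)%:E))%E.
  move=> Dh hfin; have mh := domain_measurable hD Dh.
  have LE := LpE _ mh.
  have hLfin : (Lp_norm p v (EFin \o h) < +oo)%E.
    by rewrite LE; apply: poweR_lty.
  have := hCM h Dh hLfin; rewrite LE (Lp_normE p mv mv' v0 v'0 vv'); last first.
    exact: measurable_grand_maximal.
  set X := (\int[_]_x (`|grand_maximal T h x|%E `^ p * _)%E)%E; set Y := (\int[_]_x _)%E.
  have -> : (\int[@lebesgue R n]_x (grand_maximal T h x `^ p * (v' x)%:E) = X)%E.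
    by apply: eq_integral => x _; rewrite gee0_abs ?grand_maximal_ge0.
  have X0 : (0 <= X)%E.
    by apply: integral_ge0 => x _; rewrite mule_ge0 ?poweR_ge0// lee_fin.
  have Y0 : (0 <= Y)%E by exact: Ige0.
  move=> hXY.
  have hXY' : (X `^ p^-1 <= CM'%:E * Y `^ p^-1)%E.
    by apply: (le_trans hXY); apply: lee_wpmul2r; rewrite ?poweR_ge0// lee_fin le_max lexx.
  have -> : X = ((X `^ p^-1) `^ p)%E by rewrite -poweRrM mulVf ?gt_eqF// poweRe1.
  apply: (le_trans (lee_poweR (ltW p0) (poweR_ge0 _ _) hXY')).
  by rewrite poweRM ?poweR_ge0 ?lee_fin// -poweRrM mulVf ?gt_eqF// poweRe1.
have [C C0 HC] := commutator_bound hdelta hD hT.1 hTc hcT hp K1 vs (powR_ge0 CM' p) hM'.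
exists (C `^ p^-1) => b f hb hf.
have mF := measurable_commutator hD hT.1 hb hf.
have [mf _ _] := hf.
rewrite (LpE _ mF) (LpE _ mf).
rewrite (bmo_norm_fine hb); apply: poweR_root_le.
- exact: p0.
- exact: C0.
- by rewrite fine_ge0// bmo_ge0.
- exact: Ige0.
- exact: Ige0.
- exact: HC.
Qed.
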